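(* Every flow-admissible signed graph $(G,\sigma)$ has a signed-circuit cover with length less than $\frac{19}{6}|E(G)|$.
   Context: A graph may have multiple edges and loops; a loop is also treated as an edge. A cycle is a connected 2-regular graph. A signed graph $(G,\sigma)$ is a graph $G$ associated with a mapping $\sigma:E(G)\to\{-1,+1\}$; an edge $e$ is negative if $\sigma(e)=-1$ and positive if $\sigma(e)=+1$. A cycle of $(G,\sigma)$ is positive if it contains an even number of negative edges, and negative otherwise. A short barbell is a union of two negative cycles $C_1$ and $C_2$ such that $C_1\cap C_2$ is a single vertex; a long barbell consists of two disjoint negative cycles $C_1$ and $C_2$ joined by a minimal path $P$ (one that does not contain a proper subpath joining $C_1$ and $C_2$). A barbell is a short barbell or a long barbell. A signed-circuit of $(G,\sigma)$ is a positive cycle or a barbell. A signed-circuit cover of $(G,\sigma)$ is a family $\mathcal C$ of signed-circuits of $(G,\sigma)$ which cover all edges of $G$; its length is $\ell(\mathcal C)=\sum_{C\in\mathcal C}|E(C)|$. A signed graph is flow-admissible if it admits a nowhere-zero integer flow; it is known that this holds if and only if the signed graph has a signed-circuit cover.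
   Formalization: The graph is assumed to have at least one edge: an edgeless graph is trivially flow-admissible, but its only signed-circuit cover is empty with length 0, which is not less than (19/6)·0. *)

(* Defs.v *)
From mathcomp Require Import all_boot all_order all_algebra.

Set Implicit Arguments.
Unset Strict Implicit.
Unset Printing Implicit Defensive.

Import GRing.Theory Num.Theory.

(* Finite signed multigraphs.  An edge e has the two half-edges (e, false) and
   (e, true); [endpt h] is the vertex at which the half-edge h is attached, so
   e is a loop when both half-edges have the same endpoint.
   [negative e] means sigma(e) = -1. *)
Record sgraph := SGraph {
  vertex : finType;
  edge : finType;
  endpt : edge * bool -> vertex;
  negative : pred edge }.

Definition half_edge (G : sgraph) : Type := (edge G * bool)%type.

Definition opp_half (G : sgraph) (h : half_edge G) : half_edge G :=
  (h.1, ~~ h.2).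

(* [tau h] means that h is directed away from its endpoint.  A positive edge
   has one half-edge directed away from its endpoint and one towards it; the
   half-edges of a negative edge are both directed away or both towards. *)
Definition orientation (G : sgraph) (tau : edge G * bool -> bool) : Prop :=
  forall e : edge G, (tau (e, false) == tau (e, true)) = negative e.

Definition integer_flow (G : sgraph) (tau : edge G * bool -> bool)
    (f : edge G -> int) : Prop :=
  forall v : vertex G,
    (\sum_(h : edge G * bool | (endpt h == v) && tau h) f h.1 =
     \sum_(h : edge G * bool | (endpt h == v) && ~~ tau h) f h.1)%R.

Definition flow_admissible (G : sgraph) : Prop :=
  exists (tau : edge G * bool -> bool) (f : edge G -> int),
    [/\ orientation tau, integer_flow tau f & forall e, f e != 0%R].

(* A vertex set together with an edge set; it is a graph only under
   [is_subgraph]. *)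
Definition subgr (G : sgraph) : Type := ({set vertex G} * {set edge G})%type.

Definition verts (G : sgraph) (H : subgr G) : {set vertex G} := H.1.
Definition edges (G : sgraph) (H : subgr G) : {set edge G} := H.2.

Definition is_subgraph (G : sgraph) (H : subgr G) : Prop :=
  forall (e : edge G) (b : bool), e \in edges H -> endpt (e, b) \in verts H.

Definition subgr_union (G : sgraph) (H K : subgr G) : subgr G :=
  (verts H :|: verts K, edges H :|: edges K).

Definition subgr_inter (G : sgraph) (H K : subgr G) : subgr G :=
  (verts H :&: verts K, edges H :&: edges K).

Definition subgr_sub (G : sgraph) (H K : subgr G) : Prop :=
  verts H \subset verts K /\ edges H \subset edges K.

Definition adj (G : sgraph) (H : subgr G) : rel (vertex G) := fun u v =>
  [exists h : edge G * bool,
    [&& h.1 \in edges H, endpt h == u & endpt (opp_half h) == v]].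

Definition connected (G : sgraph) (H : subgr G) : Prop :=
  verts H != set0 /\ {in verts H &, forall u v, connect (adj H) u v}.

(* A loop contributes 2, since its two half-edges are counted separately. *)
Definition degree (G : sgraph) (H : subgr G) (v : vertex G) : nat :=
  #|[set h : edge G * bool | (h.1 \in edges H) && (endpt h == v)]|.

Definition is_cycle (G : sgraph) (C : subgr G) : Prop :=
  [/\ is_subgraph C, connected C & {in verts C, forall v, degree C v = 2}].

Definition positive_cycle (G : sgraph) (C : subgr G) : Prop :=
  is_cycle C /\ ~~ odd #|[set e in edges C | negative e]|.

Definition negative_cycle (G : sgraph) (C : subgr G) : Prop :=
  is_cycle C /\ odd #|[set e in edges C | negative e]|.

(* P is a path with ends x and y.  The sequence s lists the half-edges by which
   the path leaves its successive vertices, so s = h1 ... hk visits the pairwise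
   distinct vertices x, endpt (opp_half h1), ..., endpt (opp_half hk). *)
Fixpoint walk (G : sgraph) (x : vertex G) (s : seq (half_edge G)) : bool :=
  if s is h :: s' then (endpt h == x) && walk (endpt (opp_half h)) s' else true.

Definition walk_verts (G : sgraph) (x : vertex G) (s : seq (half_edge G)) :
    seq (vertex G) :=
  x :: [seq endpt (opp_half h) | h <- s].

Definition is_path (G : sgraph) (x y : vertex G) (P : subgr G) : Prop :=
  exists s : seq (half_edge G),
    [/\ walk x s, uniq (walk_verts x s), last x (walk_verts x s) = y &
        P = ([set v in walk_verts x s], [set e in [seq h.1 | h <- s]])].

Definition joins (G : sgraph) (C1 C2 P : subgr G) : Prop :=
  exists x y : vertex G, [/\ x \in verts C1, y \in verts C2 & is_path x y P].

Definition minimal_joining_path (G : sgraph) (C1 C2 P : subgr G) : Prop :=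
  joins C1 C2 P /\
  forall Q : subgr G, subgr_sub Q P -> joins C1 C2 Q -> Q = P.

Definition short_barbell (G : sgraph) (B : subgr G) : Prop :=
  exists C1 C2 : subgr G,
    [/\ negative_cycle C1, negative_cycle C2,
        exists v : vertex G, subgr_inter C1 C2 = ([set v], set0) &
        B = subgr_union C1 C2].

Definition long_barbell (G : sgraph) (B : subgr G) : Prop :=
  exists C1 C2 P : subgr G,
    [/\ negative_cycle C1, negative_cycle C2,
        subgr_inter C1 C2 = (set0, set0), minimal_joining_path C1 C2 P &
        B = subgr_union (subgr_union C1 C2) P].

Definition barbell (G : sgraph) (B : subgr G) : Prop :=
  short_barbell B \/ long_barbell B.

Definition signed_circuit (G : sgraph) (C : subgr G) : Prop :=
  positive_cycle C \/ barbell C.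

(* A family may contain the same signed-circuit several times. *)
Definition signed_circuit_cover (G : sgraph) (cs : seq (subgr G)) : Prop :=
  (forall C, C \in cs -> signed_circuit C) /\
  (forall e : edge G, exists2 C, C \in cs & e \in edges C).

Definition cover_length (G : sgraph) (cs : seq (subgr G)) : nat :=
  \sum_(C <- cs) #|edges C|.

(* Main.v *)
(* Switch the signature so that the set N of negative edges is as small as
   possible; then N contains at most half of every edge cut.  Let g be the
   number of edges that lie in a cycle without edges of N, and let o be the
   number of the other edges.

   The g edges carry a bridgeless graph all of whose cycles are positive, so it
   suffices to cover a bridgeless graph by cycles of total length at most
   5g/3.  A Z_2 x Z_3 flow in the style of Seymour yields a mod 3 flow that
   vanishes on at most a third of an even set C and nowhere outside C; the mod 3
   flow splits into two even sets, and C with two even sets built from these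
   covers everything cheaply.

   The o remaining edges are covered at cost (3g + 6o)/2.  Work on a piece
   without bridges: some even set H contains all its N-edges, uses at most half
   of its g-edges, and contains all its o-edges, since each of these outside N
   forms a 2-cut with an edge of N.  H splits into signed circuits and vertex-disjoint
   negative cycles, and the latter are paired into barbells along a join with at
   most half of the edges.  Parity defects are repaired by using one negative
   cycle twice.  Bridges are treated by a recursion in which each side of a
   bridge offers one or two negative cycles with a path to the bridge.

   In total 10g/6 + (9g + 18o)/6 = (19g + 18o)/6, and the second cover is not
   needed if o = 0. *)

Require Import Defs.
From mathcomp Require Import all_boot all_order all_algebra.
From mathcomp Require Import zify.

Set Implicit Arguments.
Unset Strict Implicit.
Unset Printing Implicit Defensive.

Import Order.TTheory GRing.Theory Num.Theory.

(** Flow-admissibility enters once, in [switched_support]. Add the conservation laws over a vertex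
    set T: after switching, edges inside T that are not in N cancel, so a single edge that leaves T
    or lies in N inside T would carry flow 0. Hence both sides of a bridge contain edges of N, and
    no component contains exactly one. The obstacle is parity. A join needs an even number of
    terminals, while the number of negative cycles split off an even set has the parity of its
    number of N-edges. Repeating a negative cycle F repairs this but costs |F| more edges.
    [cycle_join] pays for it: in a piece with a edges, cycles of length at least f are joined by (a
    - f)/2 edges, so two joins and an extra copy of F, with f = |F|, take at most a edges together.
    The rate 3 for an o-edge is what the case of two even sets needs, where all negative cycles meet
    one of them; being below 19/6, it makes the bound strict. *)

Definition symd (T : finType) (A B : {set T}) : {set T} :=
  [set x | (x \in A) (+) (x \in B)].

Section SymmetricDifference.

Variable T : finType.
Implicit Types A B C : {set T}.

Lemma in_symd A B x : (x \in symd A B) = (x \in A) (+) (x \in B).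
Proof. by rewrite inE. Qed.

Lemma symdC A B : symd A B = symd B A.
Proof. by apply/setP=> x; rewrite !inE addbC. Qed.

Lemma symdA A B C : symd A (symd B C) = symd (symd A B) C.
Proof. by apply/setP=> x; rewrite !inE addbA. Qed.

Lemma symdv A : symd A A = set0.
Proof. by apply/setP=> x; rewrite !inE addbb. Qed.

Lemma symd0 A : symd A set0 = A.
Proof. by apply/setP=> x; rewrite !inE addbF. Qed.

Lemma sym0d A : symd set0 A = A.
Proof. by rewrite symdC symd0. Qed.

Lemma symdK A B : symd (symd A B) B = A.
Proof. by rewrite -symdA symdv symd0. Qed.

Lemma symKd A B : symd A (symd A B) = B.
Proof. by rewrite symdA symdv sym0d. Qed.

Lemma symd_sub A B C : A \subset C -> B \subset C -> symd A B \subset C.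
Proof.
move=> /subsetP sA /subsetP sB; apply/subsetP=> x; rewrite inE.
by case: (boolP (x \in A)) => [/sA //|_ /= /sB].
Qed.

Lemma symd_disjoint A B : [disjoint A & B] -> symd A B = A :|: B.
Proof.
move=> dAB; apply/setP=> x; rewrite !inE.
by case xA: (x \in A); case xB: (x \in B) => //; rewrite (disjointFr dAB xA) in xB.
Qed.

Lemma symd_subD A B : B \subset A -> symd A B = A :\: B.
Proof.
move=> /subsetP sBA; apply/setP=> x; rewrite !inE.
by case xB: (x \in B) => /=; rewrite ?addbF // addbT (sBA x xB).
Qed.

Lemma symd_eq0 A B : symd A B = set0 -> A = B.
Proof.
move/setP=> h; apply/setP=> x; have := h x; rewrite !inE.
by case: (x \in A); case: (x \in B).
Qed.

Lemma big_addb_card (P Q : pred T) :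
  \big[addb/false]_(x | P x) Q x = odd #|[set x | P x && Q x]|.
Proof.
rewrite -sum1_card (big_morph odd oddD (erefl : odd 0 = false)) /=.
rewrite big_mkcond [RHS]big_mkcond; apply: eq_bigr => x _.
by rewrite inE; case: (P x); case: (Q x).
Qed.

Lemma odd_symd A B : odd #|symd A B| = odd #|A| (+) odd #|B|.
Proof.
have e C : odd #|C| = \big[addb/false]_(x : T) (x \in C).
  by rewrite big_addb_card; congr (odd #|pred_of_set _|); apply/setP=> x; rewrite inE.
by rewrite !e -big_split; apply: eq_bigr => x _; rewrite in_symd.
Qed.

Lemma symdI A B C : symd A B :&: C = symd (A :&: C) (B :&: C).
Proof. by apply/setP=> x; rewrite !inE; case: (x \in C); rewrite ?andbF ?andbT. Qed.

End SymmetricDifference.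

(** * Even sets, cuts and joins *)

Section CycleSpace.

Variable G : sgraph.
Local Notation V := (vertex G).
Local Notation E := (edge G).
Implicit Types (W C J K H A P : {set E}) (U X T : {set V}) (u v x y : V) (e : E)
  (h : half_edge G) (s : seq (half_edge G)).

(** Parity of the degree of v in W; a loop at v has both half-edges there and cancels. So [even_set]
    describes the binary cycle space and [oddv] is the boundary map. *)
Definition bd W v : bool := \big[addb/false]_(h : E * bool | endpt h == v) (h.1 \in W).

Definition oddv W : {set V} := [set v | bd W v].

Definition even_set W : bool := oddv W == set0.

Definition crosses U e : bool := (endpt (e, false) \in U) (+) (endpt (e, true) \in U).

Definition cut U : {set E} := [set e | crosses U e].

Definition adjE W : rel V := adj ((setT, W) : subgr G).

Definition ends W : {set V} := [set endpt (e, b) | e in W, b in [set: bool]].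

Lemma bdE W v : bd W v = odd #|[set h : E * bool | (h.1 \in W) && (endpt h == v)]|.
Proof.
rewrite /bd big_addb_card; congr (odd #|pred_of_set _|).
by apply/setP=> h; rewrite !inE andbC.
Qed.

Lemma bd_symd W C v : bd (symd W C) v = bd W v (+) bd C v.
Proof. by rewrite /bd -big_split; apply: eq_bigr => h _; rewrite in_symd. Qed.

Lemma oddv_symd W C : oddv (symd W C) = symd (oddv W) (oddv C).
Proof. by apply/setP=> v; rewrite !inE bd_symd. Qed.

Lemma oddv0 : oddv set0 = set0.
Proof. by apply/setP=> v; rewrite !inE /bd big1 // => h _; rewrite inE. Qed.

Lemma even_set0 : even_set set0.
Proof. by rewrite /even_set oddv0. Qed.

Lemma even_symd W C : even_set W -> even_set C -> even_set (symd W C).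
Proof. by rewrite /even_set oddv_symd => /eqP-> /eqP->; rewrite symdv. Qed.

Lemma even_setD W C : C \subset W -> even_set W -> even_set C -> even_set (W :\: C).
Proof. by move=> sCW eW eC; rewrite -symd_subD //; apply: even_symd. Qed.

Lemma even_setU W C : [disjoint W & C] -> even_set W -> even_set C -> even_set (W :|: C).
Proof. by move=> d eW eC; rewrite -symd_disjoint //; apply: even_symd. Qed.

Lemma even_setP W : reflect (forall v, bd W v = false) (even_set W).
Proof.
apply: (iffP eqP) => [/setP h v|h]; first by have := h v; rewrite !inE.
by apply/setP=> v; rewrite !inE h.
Qed.

Lemma sum_halves (R : Type) (idx : R) (op : Monoid.com_law idx) (F : E * bool -> R) :
  \big[op/idx]_(h : E * bool) F h =
  \big[op/idx]_(e : E) op (F (e, false)) (F (e, true)).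
Proof.
rewrite (eq_bigr (fun h => F (h.1, h.2))); last by case.
rewrite -(pair_bigA op (fun e b => F (e, b))) /=; apply: eq_bigr => e _.
by rewrite big_bool Monoid.mulmC.
Qed.

(** An edge with both ends in U is counted twice and vanishes mod 2; what remains is the cut. *)
Lemma sum_bd W U :
  \big[addb/false]_(v in U) bd W v = odd #|W :&: cut U|.
Proof.
rewrite /bd (exchange_big_dep (fun h : E * bool => endpt h \in U)) /=; last first.
  by move=> v h vU /eqP->.
rewrite (eq_bigr (fun h : E * bool => h.1 \in W)); last first.
  move=> h hU; rewrite (big_pred1 (endpt h)) // => v /=.
  by rewrite eq_sym; case: eqP => [->|]; rewrite ?hU ?andbF.
rewrite big_mkcond sum_halves /=.
rewrite (eq_bigr (fun e => e \in W :&: cut U)); last first.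
  move=> e _; rewrite !inE /crosses.
  by case: (_ \in U); case: (_ \in U); rewrite ?andbT ?andbF ?addbF ?addbb.
by rewrite big_addb_card; congr (odd #|pred_of_set _|); apply/setP=> e; rewrite !inE.
Qed.

Lemma odd_oddv W U : odd #|oddv W :&: U| = odd #|W :&: cut U|.
Proof.
rewrite -sum_bd big_addb_card; congr (odd #|pred_of_set _|).
by apply/setP=> v; rewrite !inE andbC.
Qed.

Lemma cutT : cut setT = set0.
Proof. by apply/setP=> e; rewrite !inE /crosses !inE. Qed.

Lemma cut0 : cut set0 = set0.
Proof. by apply/setP=> e; rewrite !inE /crosses !inE. Qed.

Lemma even_cut W U : even_set W -> ~~ odd #|W :&: cut U|.
Proof. by move=> /eqP eW; rewrite -odd_oddv eW set0I cards0. Qed.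

Lemma even_oddv W : ~~ odd #|oddv W|.
Proof. by rewrite -(setIT (oddv W)) odd_oddv cutT setI0 cards0. Qed.

Lemma bd_edge e v : bd [set e] v = (v == endpt (e, false)) (+) (v == endpt (e, true)).
Proof.
rewrite /bd big_mkcond sum_halves /= (bigD1 e) //= big1 => [|e' ne]; last first.
  by rewrite !inE (negPf ne) !if_same.
rewrite !inE eqxx addbF !(eq_sym v).
by do 2 case: eqP.
Qed.

Lemma oddv_edge e : oddv [set e] = symd [set endpt (e, false)] [set endpt (e, true)].
Proof. by apply/setP=> v; rewrite !inE bd_edge. Qed.

Lemma oddv_half h : oddv [set h.1] = symd [set endpt h] [set endpt (opp_half h)].
Proof. by rewrite oddv_edge; case: h => e [] //=; rewrite symdC. Qed.

Lemma opp_halfK h : opp_half (opp_half h) = h.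
Proof. by case: h => e b; rewrite /opp_half /= negbK. Qed.

Lemma same_edge h h' : h.1 = h'.1 -> h = h' \/ h = opp_half h'.
Proof. by case: h h' => e [] [e' []] /= ->; [left|right|right|left]. Qed.

Lemma mem_ends W e b : e \in W -> endpt (e, b) \in ends W.
Proof. by move=> eW; apply/imset2P; exists e b; rewrite ?inE. Qed.

Lemma mem_ends_half W h : h.1 \in W -> endpt h \in ends W.
Proof. by case: h => e b; apply: mem_ends. Qed.

Lemma endsP W v : reflect (exists2 h, h.1 \in W & endpt h = v) (v \in ends W).
Proof.
apply: (iffP imset2P) => [[e b eW _ ->]|[[e b] /= eW <-]]; first by exists (e, b).
by exists e b; rewrite ?inE.
Qed.

Lemma ends_sub W C : W \subset C -> ends W \subset ends C.
Proof.
move=> /subsetP sWC; apply/subsetP=> v /endsP[h hW <-].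
by apply: mem_ends_half; apply: sWC.
Qed.

Lemma oddv_ends W : oddv W \subset ends W.
Proof.
apply/subsetP=> v; rewrite inE bdE => odd_v.
have: 0 < #|[set h : E * bool | (h.1 \in W) && (endpt h == v)]| by case: #|_| odd_v.
case/card_gt0P=> h; rewrite inE => /andP[hW /eqP <-]; exact: mem_ends_half.
Qed.

Lemma adjEP W x y :
  reflect (exists2 h, h.1 \in W & endpt h = x /\ endpt (opp_half h) = y) (adjE W x y).
Proof.
apply: (iffP existsP) => [[h /and3P[hW /eqP hx /eqP hy]]|[h hW [hx hy]]]; first by exists h.
by exists h; rewrite hW hx hy !eqxx.
Qed.

Lemma adjE_edge W h : h.1 \in W -> adjE W (endpt h) (endpt (opp_half h)).
Proof. by move=> hW; apply/adjEP; exists h. Qed.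

Lemma adjE_sym W : symmetric (adjE W).
Proof.
move=> x y; apply/adjEP/adjEP=> -[h hW [<- <-]]; exists (opp_half h) => //;
  by rewrite opp_halfK.
Qed.

Lemma connE_sym W : connect_sym (adjE W).
Proof. exact/sym_connect_sym/adjE_sym. Qed.

Lemma adjE_sub W C : W \subset C -> subrel (adjE W) (adjE C).
Proof.
by move=> /subsetP sWC x y /adjEP[h hW hxy]; apply/adjEP; exists h => //; apply: sWC.
Qed.

Lemma connE_sub W C x y : W \subset C -> connect (adjE W) x y -> connect (adjE C) x y.
Proof.
move=> sWC; apply: connect_sub x y => x y /(adjE_sub sWC); exact: connect1.
Qed.

Lemma adj_adjE (H : subgr G) : adj H =2 adjE (edges H).
Proof. by []. Qed.

Lemma crosses_half U h :
  crosses U h.1 = (endpt h \in U) (+) (endpt (opp_half h) \in U).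
Proof. by case: h => e [] //=; rewrite /crosses addbC. Qed.

Lemma connect_cut W U x y :
  connect (adjE W) x y -> x \in U -> y \notin U -> exists2 e, e \in W & e \in cut U.
Proof.
case/connectP=> p; elim: p x => [|z p IH] x /=; first by move=> _ -> ->.
case/andP=> /adjEP[h hW [hx hz]] pz ey xU yU.
have [zU|zU] := boolP (z \in U); first exact: IH pz ey zU yU.
by exists h.1 => //; rewrite inE crosses_half hx hz xU (negPf zU).
Qed.

Definition component W x : {set V} := [set y | connect (adjE W) x y].

Lemma component_refl W x : x \in component W x.
Proof. by rewrite inE connect0. Qed.

Lemma component_cut W x : W :&: cut (component W x) = set0.
Proof.
apply/setP=> e; rewrite !inE; apply/negP=> /andP[eW].
have st : connect (adjE W) (endpt (e, false)) (endpt (e, true)).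
  exact/connect1/(adjE_edge (h := (e, false))).
by rewrite /crosses !inE (same_connect_r (connE_sym W) st) addbb.
Qed.

Definition half_rel (Q : pred (E * bool)) : rel V := fun u v =>
  [exists h : E * bool, [&& Q h, endpt h == u & endpt (opp_half h) == v]].

(** Q tests half-edges rather than edges, so that the lemma yields walks inside an edge set as well
    as walks directed along a flow. *)
Lemma connect_walk (Q : pred (E * bool)) x y : connect (half_rel Q) x y ->
  exists s, [/\ walk x s, last x (walk_verts x s) = y, uniq (walk_verts x s) & all Q s].
Proof.
case/connectP=> p0 p0p ->; case/shortenP: p0p => p; rewrite -!/(walk_verts _ _).
move=> pp up _ {p0}.
suff [s [ws Qs es]] : exists s, [/\ walk x s, all Q s & [seq endpt (opp_half h) | h <- s] = p].
  by exists s; rewrite /walk_verts es.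
elim: p x pp {up} => [|z p IH] x /=; first by exists [::].
case/andP=> /existsP[h /and3P[Qh /eqP hx /eqP hz]] /IH[s [ws Qs es]].
by exists (h :: s); rewrite /= hx eqxx hz ws Qh Qs es.
Qed.

Lemma walk_edge_verts x s h : walk x s -> h \in s ->
  endpt h \in walk_verts x s /\ endpt (opp_half h) \in walk_verts x s.
Proof.
elim: s x => // h' s IH x /= /andP[/eqP hx ws].
rewrite inE => /orP[/eqP->|hs]; first by rewrite /walk_verts /= hx !inE !eqxx orbT.
have [h1 h2] := IH _ ws hs; rewrite /walk_verts /= in h1 h2 *.
by rewrite inE h1 orbT inE h2 orbT.
Qed.

Lemma walk_uniq_edges x s :
  walk x s -> uniq (walk_verts x s) -> uniq [seq h.1 | h <- s].
Proof.
elim: s x => // h s IH x /= /andP[/eqP hx ws]; rewrite /walk_verts /= => /andP[xN us].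
rewrite (IH _ ws us) andbT; apply/negP=> /mapP[h' h's e].
have [v1 v2] := walk_edge_verts ws h's.
have [E1|E1] := same_edge e.
- by have E2 : x = endpt h' by [rewrite -hx E1]; case/negP: xN; rewrite E2.
by have E2 : x = endpt (opp_half h') by [rewrite -hx E1]; case/negP: xN; rewrite E2.
Qed.

Definition wedges s : {set E} := [set e in [seq h.1 | h <- s]].

Lemma wedges_cons h s : wedges (h :: s) = h.1 |: wedges s.
Proof. by apply/setP=> e; rewrite !inE. Qed.

Lemma walk_oddv x s : walk x s -> uniq [seq h.1 | h <- s] ->
  oddv (wedges s) = symd [set x] [set last x (walk_verts x s)].
Proof.
elim: s x => [|h s IH] x /=.
  have -> : wedges [::] = set0 by apply/setP=> e; rewrite !inE.
  by rewrite symdv oddv0.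
case/andP=> /eqP hx ws /andP[hN us]; rewrite wedges_cons -symd_disjoint; last first.
  by rewrite disjoints1 inE.
rewrite oddv_symd (IH _ ws us) oddv_half hx /walk_verts /=.
by rewrite -symdA symKd.
Qed.

Lemma walk_connect x s y : walk x s -> y \in walk_verts x s ->
  connect (adjE (wedges s)) x y.
Proof.
elim: s x => [|h s IH] x /=; rewrite /walk_verts /= inE; first by move=> _ /eqP->.
case/andP=> /eqP hx ws /orP[/eqP->//|hy].
have sub : wedges s \subset wedges (h :: s) by rewrite wedges_cons subsetUr.
apply: connect_trans (connE_sub sub (IH _ ws hy)).
by apply: connect1; rewrite -hx; apply: adjE_edge; rewrite !inE eqxx.
Qed.

Lemma path_set W x y : connect (adjE W) x y ->
  exists P, [/\ P \subset W, oddv P = symd [set x] [set y] & connect (adjE P) x y].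
Proof.
case/(@connect_walk (fun h => h.1 \in W)) => s [ws ly us sW]; exists (wedges s); split.
- by apply/subsetP=> e; rewrite inE => /mapP[h hs ->]; apply: (allP sW).
- by rewrite (walk_oddv ws (walk_uniq_edges ws us)) ly.
by apply: walk_connect => //; rewrite -ly /walk_verts /= mem_last.
Qed.

(** The odd vertices of W inside one component of W are even in number, so x has a partner there. *)
Lemma oddv_path W x : x \in oddv W -> exists y P,
  [/\ y != x, y \in oddv W, P \subset W, oddv P = symd [set x] [set y] &
      connect (adjE P) x y].
Proof.
move=> xW; pose T := oddv W :&: component W x.
have Teven : ~~ odd #|T| by rewrite /T odd_oddv component_cut cards0.
have xT : x \in T by rewrite inE xW component_refl.
have : 0 < #|T :\ x|.
  by move: Teven; rewrite (cardsD1 x T) xT; case: #|_|.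
case/card_gt0P=> y; rewrite 2!inE => /andP[ynx]; rewrite inE => /andP[yW].
rewrite inE => /path_set[P [sP oP cP]]; by exists y, P.
Qed.

(** Two terminals in one component are removed by adding a path between them; parity provides the
    second terminal. *)
Lemma join_exists A T : (forall x, ~~ odd #|T :&: component A x|) ->
  exists2 J : {set E}, J \subset A & oddv J = T.
Proof.
elim: {T}_.+1 {-2}T (ltnSn #|T|) => // n IH T; rewrite ltnS => leTn ev.
have [->|[x xT]] := set_0Vmem T; first by exists set0; rewrite ?sub0set ?oddv0.
have xTc : x \in T :&: component A x by rewrite inE xT component_refl.
have : 0 < #|(T :&: component A x) :\ x|.
  by move: (ev x); rewrite (cardsD1 x) xTc; case: #|_|.
case/card_gt0P=> y; rewrite 2!inE => /andP[ynx]; rewrite inE => /andP[yT yc].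
rewrite inE in yc; have [P [sP oP _]] := path_set yc.
pose T' := symd T (symd [set x] [set y]).
have T'E : T' = T :\ x :\ y.
  apply/setP=> z; rewrite !inE.
  have [->|zx] := eqVneq z x; first by rewrite eq_sym (negPf ynx) xT.
  by have [->|zy] := eqVneq z y; rewrite ?yT //= addbF.
have cT' : #|T'| < n.
  apply: leq_trans leTn; rewrite T'E (cardsD1 x T) xT (cardsD1 y (T :\ x)).
  by rewrite !inE ynx yT.
case: (IH T' cT') => [z|J sJ oJ].
  rewrite /T' symdI odd_symd (negPf (ev z)) addFb symdI odd_symd.
  have c1 u : #|[set u] :&: component A z| = (u \in component A z).
    have [uc|uc] := boolP (u \in component A z).
      by rewrite (setIidPl _) ?cards1 ?sub1set.
    by apply/eqP; rewrite cards_eq0 setI_eq0 disjoints1.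
  rewrite !c1 !inE (same_connect_r (connE_sym A) yc).
  by rewrite addbb.
exists (symd J P); first exact: symd_sub.
by rewrite oddv_symd oJ oP symdK.
Qed.

End CycleSpace.

Arguments even_set {G}.

(** * Cycles and half-size joins *)

Section Cycles.

Variable G : sgraph.
Local Notation V := (vertex G).
Local Notation E := (edge G).
Implicit Types (W C J K H A P F : {set E}) (U X T : {set V}) (u v x y : V) (e : E)
  (h : half_edge G) (s : seq (half_edge G)).

Definition acyclic F := forall K, K \subset F -> even_set K -> K = set0.

(** A subset of F is determined by its boundary away from x: boundaries have even size, and two
    subsets with the same boundary differ by an even subset of F. So 2^|F| is at most 2^(|X| -
    1). *)
Lemma acyclic_card F X x : acyclic F -> ends F \subset X -> x \in X -> #|F| < #|X|.
Proof.
move=> acF sFX xX; pose f K := oddv K :\ x.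
have inj : {in powerset F &, injective f}.
  move=> K K'; rewrite !inE => sK sK' eqf; apply: symd_eq0; apply: acF.
    exact: symd_sub.
  rewrite /even_set oddv_symd; set D := symd _ _.
  have sD : D \subset [set x].
    apply/subsetP=> v; rewrite !inE; have := congr1 (fun S : {set V} => v \in S) eqf.
    rewrite /f !inE; case: eqP => //= _ ->; by rewrite addbb.
  have := even_oddv (symd K K'); rewrite oddv_symd -/D => ev.
  have := subset_leq_card sD; rewrite cards1 -cards_eq0.
  by case: #|D| ev => [|[|]].
have sf : f @: powerset F \subset powerset (X :\ x).
  apply/subsetP=> S /imsetP[K]; rewrite inE => sK ->; rewrite inE; apply: setSD.
  by apply: subset_trans (oddv_ends K) (subset_trans (ends_sub sK) sFX).
have := subset_leq_card sf; rewrite card_in_imset // !card_powerset leq_exp2l //.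
by rewrite (cardsD1 x X) xX.
Qed.

Definition deg W v : nat := #|[set h : E * bool | (h.1 \in W) && (endpt h == v)]|.

Lemma odd_deg W v : odd (deg W v) = (v \in oddv W).
Proof. by rewrite inE bdE. Qed.

Lemma sum_deg W X : ends W \subset X -> \sum_(v in X) deg W v = 2 * #|W|.
Proof.
move=> sWX; transitivity (\sum_(h : E * bool | h.1 \in W) 1).
  rewrite (partition_big (fun h => endpt h) (mem X)) /=.
    by apply: eq_bigr => v _; rewrite /deg -sum1_card; apply: eq_bigl => h; rewrite inE.
  by move=> h hW; apply: (subsetP sWX); apply: mem_ends_half.
rewrite big_mkcond sum_halves /= -sum1_card big_distrr [RHS]big_mkcond /=.
by apply: eq_bigr => e _; case: (e \in W).
Qed.

Lemma deg_gt0 W v : (0 < deg W v) = (v \in ends W).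
Proof.
apply/card_gt0P/endsP => [[h]|[h hW <-]]; first by rewrite inE => /andP[? /eqP]; exists h.
by exists h; rewrite inE hW eqxx.
Qed.

(** The circuits of the binary cycle space. Minimality stands in for connectedness and 2-regularity,
    which are recovered in [cyc_is_cycle]. *)
Definition cyc : pred {set E} := minset (fun K => (K != set0) && even_set K).

Lemma cycP K : reflect [/\ K != set0, even_set K &
  forall K', K' \subset K -> even_set K' -> K' = set0 \/ K' = K] (cyc K).
Proof.
apply: (iffP minsetP) => [[/andP[K0 eK] mK]|[K0 eK mK]]; split=> //.
- move=> K' sK eK'; have [->|K'0] := eqVneq K' set0; [by left|right].
  by apply: mK => //; rewrite K'0.
- by rewrite K0.
by move=> K' /andP[K'0 eK'] sK; case: (mK K' sK eK') K'0 => [->|//]; rewrite eqxx.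
Qed.

Lemma cyc_even K : cyc K -> even_set K.
Proof. by case/cycP. Qed.

Lemma cyc_ends K : cyc K -> exists x, x \in ends K.
Proof. by case/cycP=> /set0Pn[e eK] _ _; exists (endpt (e, true)); apply: mem_ends. Qed.

Lemma even_cyc H : even_set H -> H != set0 -> exists2 K : {set E}, cyc K & K \subset H.
Proof.
move=> eH H0.
case: (@minset_exists _ (fun K : {set E} => (K != set0) && even_set K) H) => [|K mK sK].
  by rewrite H0.
by exists K.
Qed.

(** The edges of K in the component of x form a nonempty even subset, hence all of K. *)
Lemma cyc_connect K : cyc K -> {in ends K &, forall x y, connect (adjE K) x y}.
Proof.
case/cycP=> K0 eK mK x y xK yK.
pose L := [set e in K | endpt (e, false) \in component K x].
have LP h : h.1 \in K -> (h.1 \in L) = (endpt h \in component K x).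
  case: h => e [] eK' //=; rewrite inE eK' //= !inE.
  apply: (same_connect_r (connE_sym K)).
  exact/connect1/(adjE_edge (h := (e, false))).
have sL : L \subset K by apply/subsetP=> e; rewrite inE => /andP[].
have eL : even_set L.
  apply/even_setP=> v; have [vc|vc] := boolP (v \in component K x).
    rewrite -(even_setP K eK v) /bd; apply: eq_bigr => h /eqP hv.
    have [hK|hK] := boolP (h.1 \in K); first by rewrite LP // hv vc.
    by apply/negP=> /(subsetP sL); rewrite (negPf hK).
  rewrite /bd big1 // => h /eqP hv; apply/negP=> hL.
  by move: (hL); rewrite LP ?hv ?(negPf vc) // (subsetP sL).
have L0 : L != set0.
  case/endsP: xK => h hK hx; apply/set0Pn; exists h.1; rewrite LP // hx.
  exact: component_refl.
case: (mK L sL eL) L0 => [->|eqL _]; first by rewrite eqxx.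
case/endsP: yK => h hK hy; have := LP h hK; rewrite eqL hK hy => /esym.
by rewrite inE.
Qed.

(** Without one edge K is acyclic, so K has at most as many edges as vertices. All degrees are at
    least 2 and sum to 2|K|, so they equal 2. *)
Lemma cyc_deg K : cyc K -> {in ends K, forall v, deg K v = 2}.
Proof.
move=> cK; case/cycP: (cK) => K0 eK mK; have [e eK'] := set0Pn _ K0.
have ge2 v : v \in ends K -> 2 <= deg K v.
  move=> vK; have : ~~ odd (deg K v) by rewrite odd_deg (eqP eK) inE.
  by move: vK; rewrite -deg_gt0; case: deg => [|[]].
have le : #|K| <= #|ends K|.
  have ac : acyclic (K :\ e).
    move=> K' sK' eK''; have := subset_trans sK' (subsetDl K [set e]).
    move=> /mK /(_ eK'')[//|eqK]; move: (subsetP sK' e); rewrite eqK => /(_ eK').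
    by rewrite !inE eqxx.
  have := acyclic_card ac (ends_sub (subsetDl K [set e])) (mem_ends true eK').
  by rewrite (cardsD1 e K) eK'.
have sum : \sum_(v in ends K) (deg K v - 2) = 0.
  apply/eqP; rewrite sumnB // sum_deg // sum_nat_const; lia.
move=> v vK; move/eqP: sum; rewrite sum_nat_eq0 => /forallP/(_ v).
by rewrite vK /= => /eqP; have := ge2 v vK; lia.
Qed.

Definition graph_of W : subgr G := (ends W, W).

Lemma cyc_is_cycle K : cyc K -> is_cycle (graph_of K).
Proof.
move=> cK; split.
- by move=> e b; apply: mem_ends.
- split; first by have [x xK] := cyc_ends cK; apply/set0Pn; exists x.
  by move=> x y xK yK; rewrite (eq_connect (adj_adjE _)); apply: cyc_connect.
by move=> v vK; apply: cyc_deg.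
Qed.

Lemma cyc_arc K x y : cyc K -> x \in ends K -> y \in ends K -> x != y ->
  exists A, [/\ A \subset K, oddv A = symd [set x] [set y],
                oddv (K :\: A) = symd [set x] [set y], A != set0 & K :\: A != set0].
Proof.
move=> cK xK yK nxy; have [A [sA oA _]] := path_set (cyc_connect cK xK yK).
have oA' : oddv (K :\: A) = symd [set x] [set y].
  by rewrite -symd_subD // oddv_symd (eqP (cyc_even cK)) sym0d.
have xo : x \in symd [set x] [set y] by rewrite !inE eqxx (negPf nxy).
exists A; split=> //; apply/eqP=> A0.
  by move: xo; rewrite -oA A0 oddv0 inE.
by move: xo; rewrite -oA' A0 oddv0 inE.
Qed.

Definition bridgeless A :=
  forall e, e \in A -> exists2 C : {set E}, C \subset A & even_set C && (e \in C).

(** If the ends of e are connected in A without e, a path closes e to an even set; otherwise the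
    component of one end yields a forbidden cut. *)
Lemma bridgelessP A : (forall U e, A :&: cut U != [set e]) -> bridgeless A.
Proof.
move=> nb e eA; pose x := endpt (e, false); pose B := A :\ e.
have [c|c] := boolP (connect (adjE B) x (endpt (e, true))).
  have [P [sP oP _]] := path_set c.
  have eP : e \notin P by apply/negP=> /(subsetP sP); rewrite !inE eqxx.
  exists (e |: P).
    by rewrite subUset sub1set eA (subset_trans sP) ?subsetDl.
  rewrite !inE eqxx andbT /even_set -symd_disjoint ?disjoints1 //.
  by rewrite oddv_symd oddv_edge oP symdv.
case/eqP: (nb (component B x) e); apply/setP=> e'; rewrite !inE.
have [->|ne] := eqVneq e' e; first by rewrite eA /crosses !inE connect0 (negPf c).
have := congr1 (fun S : {set E} => e' \in S) (component_cut B x).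
by rewrite !inE ne.
Qed.

(** Adding C is an involution of F that switches whether e is used, so each e in A lies in exactly
    half of the members of F, and some member does no worse than the average. *)
Lemma average (F : {set {set E}}) A J0 : J0 \in F ->
  (forall e, e \in A -> exists2 C : {set E}, e \in C & forall J, J \in F -> symd J C \in F) ->
  exists2 J : {set E}, J \in F & 2 * #|J :&: A| <= #|A|.
Proof.
move=> J0F tog.
have half e : e \in A -> 2 * #|[set J in F | e \in J]| = #|F|.
  case/tog=> C eC togC.
  have im : [set J in F | e \notin J] = [set symd J C | J in [set J in F | e \in J]].
    apply/setP=> J; rewrite inE; apply/andP/imsetP=> [[JF eJ]|[K]].
      exists (symd J C); last by rewrite symdK.
      by rewrite !inE togC // (negPf eJ) eC.
    by rewrite !inE => /andP[KF eK] ->; rewrite togC // !inE eK eC.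
  have c : #|[set J in F | e \notin J]| = #|[set J in F | e \in J]|.
    rewrite im card_in_imset // => K K' _ _ /(congr1 (fun S => symd S C)).
    by rewrite !symdK.
  have := cardsID [set J : {set E} | e \in J] F.
  have -> : F :&: [set J : {set E} | e \in J] = [set J in F | e \in J].
    by apply/setP=> J; rewrite !inE.
  have -> : F :\: [set J : {set E} | e \in J] = [set J in F | e \notin J].
    by apply/setP=> J; rewrite !inE andbC.
  by rewrite c addnn -mul2n.
have tot : 2 * (\sum_(J in F) #|J :&: A|) = #|A| * #|F|.
  transitivity (2 * \sum_(J in F) \sum_(e in A) (e \in J : nat)).
    congr (2 * _); apply: eq_bigr => J _; rewrite -sum1_card.
    rewrite [LHS]big_mkcond [RHS]big_mkcond; apply: eq_bigr => e _.
    by rewrite inE andbC; case: (e \in A); case: (e \in J).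
  rewrite exchange_big /= big_distrr /= -sum_nat_const; apply: eq_bigr => e eA.
  rewrite -(half e eA) -sum1_card; congr (2 * _).
  rewrite big_mkcond [RHS]big_mkcond; apply: eq_bigr => J _; rewrite inE.
  by case: (J \in F); case: (e \in J).
apply/exists_inP; apply: contraT => /exists_inPn all_big.
have : #|F| * (#|A|).+1 <= 2 * \sum_(J in F) #|J :&: A|.
  rewrite big_distrr /= -sum_nat_const; apply: leq_sum => J JF.
  by rewrite ltnNge all_big.
have : 0 < #|F| by apply/card_gt0P; exists J0.
rewrite tot; lia.
Qed.

Lemma join_half A T : bridgeless A -> (forall x, ~~ odd #|T :&: component A x|) ->
  exists J, [/\ J \subset A, oddv J = T & 2 * #|J| <= #|A|].
Proof.
move=> bA ev; have [J0 sJ0 oJ0] := join_exists ev.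
pose F := [set J : {set E} | (J \subset A) && (oddv J == T)].
have J0F : J0 \in F by rewrite inE sJ0 oJ0 eqxx.
case: (@average F A J0 J0F) => [e eA|J].
  have [C sC /andP[eC eiC]] := bA e eA; exists C => // J; rewrite !inE.
  by case/andP=> sJ /eqP oJ; rewrite symd_sub // oddv_symd oJ (eqP eC) symd0 eqxx.
rewrite inE => /andP[sJ /eqP oJ]; rewrite (setIidPl sJ) => le.
by exists J.
Qed.

End Cycles.

(** * Closed trails in two-connected sets *)

Section Walks.

Variable G : sgraph.
Local Notation V := (vertex G).
Local Notation E := (edge G).
Implicit Types (W C J K H A P F : {set E}) (U X T : {set V}) (u v x y : V) (e : E)
  (h : half_edge G) (s : seq (half_edge G)).

Definition wlast x s : V := last x (walk_verts x s).

Lemma wlast_cons x h s : wlast x (h :: s) = wlast (endpt (opp_half h)) s.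
Proof. by []. Qed.

Lemma walk_cat x s1 s2 : walk x (s1 ++ s2) = walk x s1 && walk (wlast x s1) s2.
Proof. by elim: s1 x => //= h s1 IH x; rewrite IH wlast_cons andbA. Qed.

Lemma wlast_cat x s1 s2 : wlast x (s1 ++ s2) = wlast (wlast x s1) s2.
Proof. by elim: s1 x => //= h s1 IH x; rewrite !wlast_cons IH. Qed.

Lemma in_walk_verts_cons x h s v :
  (v \in walk_verts x (h :: s)) = (v == x) || (v \in walk_verts (endpt (opp_half h)) s).
Proof. by []. Qed.

Lemma mem_walk_verts_cat x s1 s2 v :
  (v \in walk_verts x (s1 ++ s2)) =
  (v \in walk_verts x s1) || (v \in walk_verts (wlast x s1) s2).
Proof.
elim: s1 x => [|h s1 IH] x.
  rewrite /wlast /= /walk_verts /= !inE orbA.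
  by case: (v == x) => //=.
by rewrite cat_cons !in_walk_verts_cons IH wlast_cons orbA.
Qed.

Lemma walk_head x s : x \in walk_verts x s.
Proof. by rewrite /walk_verts inE eqxx. Qed.

Lemma walk_last x s : wlast x s \in walk_verts x s.
Proof. by rewrite /wlast /walk_verts /= mem_last. Qed.

Lemma walk_split x s v : walk x s -> v \in walk_verts x s ->
  exists s1 s2, [/\ s = s1 ++ s2, walk x s1, wlast x s1 = v & walk v s2].
Proof.
elim: s x => [|h s IH] x.
  by move=> _; rewrite inE => /eqP->; exists [::], [::].
move=> ws; rewrite in_walk_verts_cons => /orP[/eqP->|]; first by exists [::], (h :: s).
case/andP: ws => hx ws /(IH _ ws)[s1 [s2 [-> w1 l1 w2]]].
by exists (h :: s1), s2; rewrite /= hx.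
Qed.

Lemma wedges_cat s1 s2 : wedges (s1 ++ s2) = wedges s1 :|: wedges s2.
Proof. by apply/setP=> e; rewrite !inE map_cat mem_cat. Qed.

Lemma walk_ends x s v : walk x s -> v \in ends (wedges s) -> v \in walk_verts x s.
Proof.
move=> ws /endsP[h]; rewrite inE => /mapP[h' h's e <-].
have [v1 v2] := walk_edge_verts ws h's.
by case: h h' e v1 v2 {h's} => a [] [b []] /= ->.
Qed.

Lemma walk_verts_sub x s U : walk x s -> x \in U -> ends (wedges s) \subset U ->
  {subset walk_verts x s <= U}.
Proof.
elim: s x => [|h s IH] x; first by move=> _ xU _ v; rewrite inE => /eqP->.
case/andP=> /eqP hx ws xU; rewrite wedges_cons => sU v.
rewrite in_walk_verts_cons => /orP[/eqP->//|]; apply: IH ws _ _ v.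
  apply: (subsetP sU); apply: mem_ends_half; by rewrite !inE eqxx.
by apply: subset_trans (ends_sub _) sU; apply: subsetUr.
Qed.

Lemma connect_trail W x y : connect (adjE W) x y ->
  exists s, [/\ walk x s, wlast x s = y, uniq [seq h.1 | h <- s] & wedges s \subset W].
Proof.
case/(@connect_walk _ (fun h => h.1 \in W)) => s [ws ly us sW]; exists s; split=> //.
  exact: walk_uniq_edges us.
by apply/subsetP=> e; rewrite inE => /mapP[h hs ->]; apply: (allP sW).
Qed.

Definition inner U : {set E} :=
  [set e | (endpt (e, false) \in U) && (endpt (e, true) \in U)].

Lemma inner_half U h : (h.1 \in inner U) = (endpt h \in U) && (endpt (opp_half h) \in U).
Proof. by case: h => e [] /=; rewrite inE // andbC. Qed.

Lemma ends_inner U W : (ends W \subset U) = (W \subset inner U).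
Proof.
apply/subsetP/subsetP=> [sWU e eW|sWU v /endsP[h hW <-]].
  by rewrite inE !sWU ?mem_ends.
by have := sWU _ hW; rewrite inner_half => /andP[].
Qed.

(** This is 2-edge-connectedness of the graph induced on U. *)
Definition two_connected U := forall X, X \subset U -> X != set0 -> X != U ->
  1 < #|cut X :&: inner U|.

(** The property of lying on a closed trail through x spreads along edges, starting with the empty
    trail at x. *)
Lemma closed_trail U x y : two_connected U -> x \in U -> y \in U ->
  exists t, [/\ walk y t, wlast y t = y, uniq [seq h.1 | h <- t],
                wedges t \subset inner U & x \in walk_verts y t].
Proof.
move=> tcU xU yU.
pose R v := exists t, [/\ walk v t, wlast v t = v, uniq [seq h.1 | h <- t],
                wedges t \subset inner U & x \in walk_verts v t].
have step v z : R v -> v \in U -> adjE (inner U) v z -> R z.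
  case=> t [wt lt ut st xt] vU /adjEP[h hU [hv hz]].
  have [zt|zt] := boolP (z \in walk_verts v t).
    have [t1 [t2 [et w1 l1 w2]]] := walk_split wt zt.
    have l2 : wlast z t2 = v by rewrite -l1 -wlast_cat -et lt.
    exists (t2 ++ t1); split.
    - by rewrite walk_cat w2 l2 w1.
    - by rewrite wlast_cat l2 l1.
    - rewrite (perm_uniq (_ : perm_eq _ [seq h.1 | h <- t])) //.
      by rewrite et !map_cat perm_catC.
    - by rewrite wedges_cat setUC -wedges_cat -et.
    by move: xt; rewrite et !mem_walk_verts_cat l1 l2 orbC.
  pose S : {set V} := [set u in walk_verts v t].
  have tS : ends (wedges t) \subset S.
    by apply/subsetP=> u /(walk_ends wt); rewrite in_set.
  pose B := inner U :\: (h.1 |: wedges t).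
  have hNt : h.1 \notin wedges t.
    apply/negP=> ht; case/negP: zt; rewrite -hz.
    by have := subsetP tS _ (@mem_ends_half _ _ (opp_half h) ht); rewrite in_set.
  have zU : z \in U by move: hU; rewrite inner_half hz => /andP[].
  (* Without h and the edges of the trail, z still reaches the trail: otherwise h would be the only
     edge of [inner U] leaving the component of z. *)
  have [q qS cq] : exists2 q, q \in S & connect (adjE B) z q.
    have [/existsP[q /andP[qS qc]]|nq] := boolP [exists q, (q \in S) && (q \in component B z)].
      by exists q => //; rewrite inE in qc.
    pose K := component B z.
    have KU : K \subset U.
      apply/subsetP=> u; rewrite inE => /connect_trail[s [ws ls _ sB]].
      have sU : ends (wedges s) \subset U.
        by rewrite ends_inner; apply: subset_trans sB (subsetDl _ _).
      by rewrite -ls; apply: (walk_verts_sub ws zU sU); apply: walk_last.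
    have KS u : u \in S -> u \notin K.
      by move=> uS; apply: contra nq => uK; apply/existsP; exists u; rewrite uS.
    have vK : v \notin K by apply: KS; rewrite in_set walk_head.
    have: 1 < #|cut K :&: inner U|.
      apply: tcU => //; first by apply/set0Pn; exists z; rewrite component_refl.
      by apply: contraNneq vK => ->.
    rewrite ltnNge -(cards1 h.1) => /negP[]; apply: subset_leq_card.
    apply/subsetP=> e /setIP[eK eU]; rewrite inE.
    have eB : e \notin B.
      apply/negP=> eB; have := component_cut B z; move/setP/(_ e).
      by rewrite inE eB eK inE.
    move: eB; rewrite in_setD eU andbT negbK in_setU1 => /orP[//|et].
    move: eK; rewrite inE /crosses.
    by do 2 rewrite (negPf (KS _ (subsetP tS _ (mem_ends _ et)))).
  have [P [sPB _ cP]] := path_set cq.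
  have hdisj s e : wedges s \subset P -> e \in [seq h0.1 | h0 <- s] ->
      (e != h.1) && (e \notin [seq h0.1 | h0 <- t]).
    move=> /subsetP sP es; have := subsetP sPB _ (sP e _); rewrite !inE es => /(_ isT).
    by rewrite negb_or => /andP[].
  have qt : q \in walk_verts v t by move: qS; rewrite in_set.
  have [t1 [t2 [et w1 l1 w2]]] := walk_split wt qt.
  have l2 : wlast q t2 = v by rewrite -l1 -wlast_cat -et lt.
  have hop : walk z [:: opp_half h] by rewrite /= hz eqxx.
  have lop : wlast z [:: opp_half h] = v by rewrite /wlast /= opp_halfK.
  have hw : walk v [:: h] by rewrite /= hv eqxx.
  have lw : wlast v [:: h] = z by rewrite /wlast /=.
  have sBU s : wedges s \subset P -> wedges s \subset inner U.
    by move=> sP; apply: subset_trans (subset_trans sP sPB) (subsetDl _ _).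
  have suU i1 i2 (H : t = i1 ++ i2) : wedges i1 \subset inner U /\ wedges i2 \subset inner U.
    have sub : wedges i1 :|: wedges i2 \subset inner U by rewrite -wedges_cat -H.
    by split; apply: subset_trans sub; rewrite ?subsetUl ?subsetUr.
  (* The trail splits at q into two arcs; one that contains x is kept and closed through h and the
     path between z and q. *)
  move: xt; rewrite {1}et mem_walk_verts_cat l1 => /orP[xt|xt].
    have [r [wr lr ur sr]] := connect_trail (etrans (connE_sym P q z) cP).
    exists (opp_half h :: t1 ++ r); split.
    - rewrite -cat1s walk_cat hop lop walk_cat w1 l1 wr //.
    - by rewrite -cat1s !wlast_cat lop l1 lr.
    - rewrite /= map_cat mem_cat cat_uniq ur andbT.
      have := ut; rewrite et map_cat cat_uniq => /and3P[-> _ _] /=; apply/andP; split.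
        apply/negP=> /orP[h1|/(hdisj _ _ sr)]; last by rewrite eqxx.
        by case/negP: hNt; rewrite et wedges_cat !inE h1.
      apply/hasPn=> e /(hdisj _ _ sr)/andP[_]; rewrite et map_cat mem_cat negb_or.
      by case/andP.
    - rewrite wedges_cons wedges_cat !subUset sub1set.
      by apply/and3P; split; [exact: hU|have [] := suU _ _ et|exact: sBU].
    by rewrite -cat1s !mem_walk_verts_cat lop l1 xt orbT.
  have [r [wr lr ur sr]] := connect_trail cP.
  exists (r ++ t2 ++ [:: h]); split.
  - by rewrite walk_cat wr lr walk_cat w2 l2 hw.
  - by rewrite !wlast_cat lr l2 lw.
  - rewrite !map_cat cat_uniq ur /=.
    have := ut; rewrite et map_cat cat_uniq => /and3P[_ _ u2].
    apply/andP; split.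
      apply/hasPn=> e; rewrite mem_cat inE => e2; apply/negP.
      move=> /(hdisj _ _ sr); rewrite et map_cat mem_cat.
      by case/orP: e2 => [->|/eqP->]; rewrite ?eqxx ?orbT ?andbF.
    rewrite cats1 rcons_uniq u2 andbT; apply: contra hNt => h2.
    by rewrite et wedges_cat !inE h2 orbT.
  - rewrite !wedges_cat !subUset sBU //=; have [_ ->] := suU _ _ et.
    by apply/subsetP=> e; rewrite in_set /= mem_seq1 => /eqP->.
  by rewrite !mem_walk_verts_cat lr l2 xt /= orbT.
have Rx : R x by exists [::]; split=> //; [apply/subsetP=> e; rewrite !inE|rewrite inE].
have cxy : connect (adjE (inner U)) x y.
  pose K := component (inner U) x :&: U.
  have [/eqP KU|KU] := boolP (K == U).
    by have : y \in K by [rewrite KU]; rewrite in_setI => /andP[]; rewrite inE.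
  have: 1 < #|cut K :&: inner U|.
    apply: tcU => //; first exact: subsetIr.
    by apply/set0Pn; exists x; rewrite inE xU component_refl.
  case/ltnW/card_gt0P=> e /setIP[eK eU].
  have := component_cut (inner U) x; move/setP/(_ e); rewrite in_setI eU /=.
  rewrite !inE /crosses; move: eK; rewrite inE /crosses /K !inE.
  by move: eU; rewrite inE => /andP[-> ->]; rewrite !andbT => ->.
suff walkR u p : R u -> u \in U -> path (adjE (inner U)) u p -> R (last u p).
  by case/connectP: cxy => p px ->; exact: walkR.
elim: p u => [|z p IH] u Ru uU //= /andP[uz pz]; apply: IH pz; first exact: step Ru uU uz.
by case/adjEP: uz => h; rewrite inner_half => /andP[_ zU] [_ <-].
Qed.

End Walks.

(** * Integer and mod 3 flows *)

Section Flows.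

Variable G : sgraph.
Local Notation V := (vertex G).
Local Notation E := (edge G).
Implicit Types (W C J K H A P F : {set E}) (U X T Z Y : {set V}) (u v x y : V) (e : E)
  (h : half_edge G) (s : seq (half_edge G)) (f c g : E -> int).

Local Open Scope ring_scope.

(** These are ordinary flows of the underlying unsigned graph, each edge directed from its half-edge
    [false] to its half-edge [true]. *)
Definition flow_on f (h : E * bool) : int := if h.2 then - f h.1 else f h.1.

Definition net f v : int := \sum_(h : E * bool | endpt h == v) flow_on f h.

Lemma net_add f g v : net (fun e => f e + g e) v = net f v + net g v.
Proof.
rewrite /net -big_split; apply: eq_bigr => -[e []] _ //=; rewrite /flow_on /=.
by rewrite opprD.
Qed.

Lemma net_scale (k : int) f v : net (fun e => k * f e) v = k * net f v.
Proof.
rewrite /net big_distrr /=; apply: eq_bigr => -[e []] _ //=; rewrite /flow_on /=.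
by rewrite mulrN.
Qed.

Lemma eq_net f g v : f =1 g -> net f v = net g v.
Proof. by move=> fg; apply: eq_bigr => h _; rewrite /flow_on !fg. Qed.

Lemma eq_net_at f g v : (forall h, endpt h = v -> f h.1 = g h.1) -> net f v = net g v.
Proof. by move=> fg; apply: eq_bigr => h /eqP /fg; rewrite /flow_on => ->. Qed.

Lemma net0 v : net (fun=> 0) v = 0.
Proof. by rewrite /net big1 // => -[e []] _; rewrite /flow_on /= ?oppr0. Qed.

Lemma net_edge h0 (k : int) v :
  net (fun e => if e == h0.1 then (if h0.2 then - k else k) else 0) v =
  k * ((v == endpt h0)%:R - (v == endpt (opp_half h0))%:R).
Proof.
rewrite /net big_mkcond sum_halves /= (bigD1 h0.1) //= [X in _ + X]big1 ?addr0; last first.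
  by move=> e /negPf ne; rewrite /flow_on /= ne oppr0 !if_same addr0.
case: h0 => e [] /=; rewrite /flow_on /= eqxx /opp_half /= !(eq_sym v);
  by do 2 case: eqP => _; rewrite ?opprK ?mulr1 ?mulr0 ?subr0 ?sub0r ?subrr ?addr0 ?add0r ?mulrN1 ?mulr0 ?addrN ?addNr.
Qed.

Lemma sum_net f U :
  \sum_(v in U) net f v = \sum_(e in cut U) (if endpt (e, false) \in U then f e else - f e).
Proof.
rewrite /net (exchange_big_dep (fun h : E * bool => endpt h \in U)) /=; last first.
  by move=> v h vU /eqP->.
rewrite (eq_bigr (fun h : E * bool => flow_on f h)); last first.
  move=> h hU; rewrite (big_pred1 (endpt h)) // => v /=.
  by rewrite eq_sym; case: eqP => [->|]; rewrite ?hU ?andbF.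
rewrite big_mkcond sum_halves [RHS]big_mkcond /=; apply: eq_bigr => e _.
rewrite inE /crosses /flow_on /=.
by case: (_ \in U); case: (_ \in U); rewrite /= ?addrN ?addr0 ?add0r.
Qed.

Definition sgn_half (h : E * bool) : int := if h.2 then - 1 else 1.

Definition walk_flow s e : int := \sum_(h <- s | h.1 == e) sgn_half h.

Lemma walk_flow_cons h s e :
  walk_flow (h :: s) e = (if e == h.1 then (if h.2 then - 1 else 1) else 0) + walk_flow s e.
Proof.
rewrite /walk_flow big_cons eq_sym /sgn_half.
by case: eqP => _; rewrite ?add0r.
Qed.

Lemma net_walk_flow x s v : walk x s ->
  net (walk_flow s) v = (v == x)%:R - (v == wlast x s)%:R.
Proof.
elim: s x => [|h s IH] x /=.
  move=> _; rewrite /wlast /= subrr -[RHS](net0 v); apply: eq_net => e.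
  by rewrite /walk_flow big_nil.
case/andP=> /eqP <- ws; rewrite (eq_net _ (walk_flow_cons h s)) net_add (IH _ ws).
by rewrite (net_edge h 1) wlast_cons mul1r addrA subrK.
Qed.

Lemma walk_flow0 s e : e \notin wedges s -> walk_flow s e = 0.
Proof.
rewrite inE => /mapP eN; rewrite /walk_flow big_seq_cond big1 // => h /andP[hs /eqP he].
by case: eN; exists h.
Qed.

Lemma walk_flow_uniq s h : uniq [seq h.1 | h <- s] -> h \in s ->
  walk_flow s h.1 = sgn_half h.
Proof.
elim: s => //= h' s IH /andP[hN us]; rewrite inE walk_flow_cons => /orP[/eqP->|hs].
  by rewrite eqxx walk_flow0 ?inE // addr0.
rewrite IH //; case: eqP => [e|_]; last by rewrite add0r.
by case/negP: hN; rewrite -e; apply/mapP; exists h.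
Qed.

Lemma walk_flow_bound s e : uniq [seq h.1 | h <- s] ->
  (-1 <= walk_flow s e <= 1) /\ ((walk_flow s e == 0) = (e \notin wedges s)).
Proof.
move=> us; have [|eN] := boolP (e \in wedges s); last by rewrite walk_flow0.
rewrite inE => /mapP[h hs ->]; rewrite walk_flow_uniq //.
by rewrite /sgn_half; case: h.2.
Qed.

(** Net values on S can be prescribed by sending flow along paths in W; the total imbalance ends up
    at x. *)
Lemma route W (S : seq V) x (d : V -> int) : uniq S ->
  (forall v, v \in S -> connect (adjE W) x v) ->
  exists2 f, (forall e, e \notin W -> f e = 0) &
    forall v, net f v = (if v \in S then d v else 0) - (v == x)%:R * \sum_(u <- S) d u.
Proof.
elim: S => [|w S IH] /=.
  move=> _ _; exists (fun=> 0) => // v; rewrite net0 big_nil mulr0 subr0 //.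
case/andP=> wS uS cS; case: (IH uS) => [v vS|f fW nf]; first by apply: cS; rewrite inE vS orbT.
have [s [ws ls us sW]] := connect_trail (cS w (mem_head _ _)).
exists (fun e => f e + - d w * walk_flow s e) => [e eW|v].
  rewrite fW // walk_flow0 ?mulr0 ?addr0 //; apply: contra eW; exact: (subsetP sW).
rewrite net_add net_scale (net_walk_flow _ ws) nf ls big_cons inE.
have [->|vw] := eqVneq v w; first by rewrite (negPf wS) /=; case: eqP => _ /=; lia.
by case: eqP => _ /=; case: (v \in S) => /=; lia.
Qed.

Lemma card_sub_setU (T : finType) (A B C : {set T}) :
  A \subset B :|: C -> (#|A| <= #|B| + #|C|)%N.
Proof. by move/subset_leq_card => le; apply: leq_trans le (leq_card_setU B C).1. Qed.

Lemma cut_disjointU U X e : [disjoint U & X] -> e \in cut (U :|: X) ->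
  e \in cut U \/ e \in cut X.
Proof.
move=> dUX; rewrite !inE /crosses !inE.
have nd v : ~~ ((v \in U) && (v \in X)).
  by apply/negP=> /andP[vU vX]; rewrite (disjointFr dUX vU) in vX.
move: (nd (endpt (e, false))) (nd (endpt (e, true))).
by do 4 case: (_ \in _); auto.
Qed.

(** The sum b1 + b2 takes the values -2, 0 and 2, one for each residue mod 3; a single unit would
    miss a residue. This is why two edges to the contracted part are needed below. *)
Lemma mod3_two_units (r : int) : exists b1 b2 : int,
  [/\ b1 = 1 \/ b1 = -1, b2 = 1 \/ b2 = -1 & (3 %| r + b1 + b2)%Z].
Proof.
have : (3 %| r)%Z \/ (3 %| r - 1)%Z \/ (3 %| r + 1)%Z by lia.
by case=> [h|[h|h]]; [exists 1, (-1)|exists 1, 1|exists (-1), (-1)]; split; try lia; auto.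
Qed.

(* The vertex set A is what remains after contracting its complement; a closed
   trail Q in A with two edges x1, x2 to the complement is contracted next. *)
Lemma six_flow_aux (A' : {set V}) : (forall U, U != set0 -> U \subset A' -> (2 < #|cut U|)%N) ->
  exists c g, [/\ forall e, -1 <= c e <= 1, forall v, net c v = 0,
    forall e, c e != 0 -> e \in inner A', forall v, v \in A' -> (3 %| net g v)%Z &
    forall e, c e == 0 -> ~~ (3 %| g e)%Z].
Proof.
elim: {A'}_.+1 {-2}A' (ltnSn #|A'|) => // n IH A; rewrite ltnS => leAn cutA.
have [A0|[a aA]] := set_0Vmem A.
  exists (fun=> 0), (fun=> 1); split=> // [v|v]; first by rewrite net0.
  by rewrite A0 inE.
(* A nonempty part of A tied to the rest of A by at most one edge; a smallest one is
   2-edge-connected. *)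
pose good U := (U != set0) && (#|cut U :&: cut (A :\: U)| <= 1)%N && (U \subset A).
have goodA : good A.
  rewrite /good subxx setDv cut0 setI0 cards0 /= !andbT; apply/set0Pn; by exists a.
pose U := [arg min_(X < A | good X) #|X|].
have [/andP[/andP[U0 cU] UA] minU] : good U /\ forall X, good X -> (#|U| <= #|X|)%N.
  by rewrite /U; case: arg_minnP.
(* If at most one edge joined X to Y, then each of them, not being good, would have an edge to the
   rest of A, and U would have two. *)
have tcU : two_connected U.
  move=> X XU X0 XnU; pose Y := U :\: X.
  have YU : Y \subset U by apply: subsetDl.
  have pX : X \proper U by rewrite properEneq XnU.
  have Y0 : Y != set0 by rewrite -card_gt0 cardsDS // subn_gt0 proper_card.
  have dXY : [disjoint X & Y] by rewrite -setI_eq0 setIDA (setIidPl XU) setDv.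
  have nX : ~~ good X.
    by apply/negP=> /minU; rewrite leqNgt proper_card.
  have nY : ~~ good Y.
    apply/negP=> /minU; rewrite leqNgt; apply/negP; rewrite negbK; apply: proper_card.
    rewrite properEneq YU andbT; apply: contraNneq X0 => YE.
    by rewrite -(setIidPl XU) -YE setI_eq0.
  have split Z Z' : Z \subset U -> Z' = U :\: Z ->
      cut Z :&: cut (A :\: Z) \subset (cut Z :&: cut (A :\: U)) :|: (cut Z :&: cut Z').
    move=> ZU ->; apply/subsetP=> e; rewrite !(in_setI, in_setU) => /andP[eZ].
    have -> : A :\: Z = (A :\: U) :|: (U :\: Z).
      apply/setP=> v; rewrite !inE; case vU: (v \in U) => /=.
        by rewrite (subsetP UA v vU) ?andbT.
      by case vZ: (v \in Z); rewrite ?andbF ?orbF //; rewrite (subsetP ZU v vZ) in vU.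
    have dd : [disjoint A :\: U & U :\: Z].
      by rewrite -setI_eq0; apply/eqP/setP=> v; rewrite !inE; case: (v \in U); rewrite ?andbF.
    by case/(cut_disjointU dd)=> ->; rewrite ?eZ ?orbT.
  have inXY : cut X :&: cut Y \subset cut X :&: inner U.
    apply/subsetP=> e; rewrite !in_setI => /andP[eX eY]; rewrite eX /=.
    move: eX eY; rewrite !inE /crosses /Y !inE.
    move: (subsetP XU (endpt (e, false))) (subsetP XU (endpt (e, true))).
    case: (endpt (e, false) \in X); case: (endpt (e, true) \in X) => //= h1 h2 _.
      by rewrite h1 //= => ->.
    by rewrite h2 // addbF => ->.
  apply: leq_trans (subset_leq_card inXY); rewrite ltnNge; apply/negP=> le1.
  have gt1 Z : Z != set0 -> Z \subset U -> ~~ good Z -> (1 < #|cut Z :&: cut (A :\: Z)|)%N.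
    by move=> Z0 ZU; rewrite /good Z0 (subset_trans ZU UA) andbT /= -ltnNge.
  have nonz Z Z' : Z != set0 -> Z \subset U -> ~~ good Z -> Z' = U :\: Z ->
      (#|cut Z :&: cut Z'| <= 1)%N -> (0 < #|cut Z :&: cut (A :\: U)|)%N.
    move=> Z0 ZU nZ eZ' leZ; have := gt1 Z Z0 ZU nZ.
    move: (card_sub_setU (split Z Z' ZU eZ')) leZ; clear; lia.
  have /card_gt0P[e1 /setIP[e1X e1A]] := nonz X Y X0 XU nX (erefl _) le1.
  have XE : X = U :\: Y by rewrite setDDr setDv set0U (setIidPr XU).
  have /card_gt0P[e2 /setIP[e2Y e2A]] : (0 < #|cut Y :&: cut (A :\: U)|)%N.
    by apply: (nonz Y X) => //; rewrite setIC.
  have dU Z : Z \subset U -> [disjoint Z & A :\: U].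
    move=> ZU; rewrite -setI_eq0; apply/eqP/setP=> v; rewrite !inE.
    by case vZ: (v \in Z) => //=; rewrite (subsetP ZU v vZ).
  have one Z e : Z \subset U -> e \in cut Z -> e \in cut (A :\: U) -> e \in cut U.
    move=> ZU; rewrite !inE /crosses !inE.
    move: (subsetP ZU (endpt (e, false))) (subsetP ZU (endpt (e, true))).
    case: (endpt (e, false) \in Z); case: (endpt (e, true) \in Z) => //= h1 h2 _.
      by rewrite h1 //=; case: (_ \in U).
    by rewrite h2 //=; case: (_ \in U); rewrite ?andbF.
  have : e1 != e2.
    apply: contraTneq e2Y => <-; move: e1X e1A; rewrite !inE /crosses !inE.
    move: (subsetP XU (endpt (e1, false))) (subsetP XU (endpt (e1, true))).
    case: (endpt (e1, false) \in X); case: (endpt (e1, true) \in X) => //= h1 h2 _.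
      by rewrite h1 //=; case: (_ \in U).
    by rewrite h2 //=; case: (_ \in U).
  move=> ne; have : (1 < #|cut U :&: cut (A :\: U)|)%N.
    apply/card_gt1P; exists e1, e2; split=> //; rewrite in_setI.
      by rewrite (one X e1).
    by rewrite (one Y e2).
  by rewrite ltnNge cU.
(* At least three edges leave U and at most one of them ends in A, so two leave A. *)
have [x1 [x2 [x1P x2P ne12]]] : exists x1 x2 : E * bool,
    [/\ endpt x1 \in U /\ endpt (opp_half x1) \notin A,
        endpt x2 \in U /\ endpt (opp_half x2) \notin A & x1.1 != x2.1].
  pose B := cut U :&: cut A.
  have : (1 < #|B|)%N.
    have sub : cut U \subset (cut U :&: cut (A :\: U)) :|: B.
      apply/subsetP=> e eU; rewrite !(in_setI, in_setU) eU /=.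
      move: eU; rewrite !inE /crosses !inE.
      move: (subsetP UA (endpt (e, false))) (subsetP UA (endpt (e, true))).
      case: (endpt (e, false) \in U); case: (endpt (e, true) \in U) => //= h1 h2 _.
        by rewrite h1 //=; case: (_ \in A).
      by rewrite h2 //=; case: (_ \in A).
    move: (cutA U U0 UA) (card_sub_setU sub) cU; clear; lia.
  case/card_gt1P=> e1 [e2 [/setIP[e1U e1A] /setIP[e2U e2A] ne]].
  have half e : e \in cut U -> e \in cut A ->
      exists2 h, h.1 = e & endpt h \in U /\ endpt (opp_half h) \notin A.
    rewrite !inE /crosses.
    move: (subsetP UA (endpt (e, false))) (subsetP UA (endpt (e, true))).
    case e0: (_ \in U); case e1': (_ \in U) => //= h1 h2.
      by rewrite h1 // => _ nA; exists (e, false).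
    by rewrite h2 // addbT => _ nA; exists (e, true).
  have [h1 E1 p1] := half e1 e1U e1A; have [h2 E2 p2] := half e2 e2U e2A.
  by exists h1, h2; rewrite E1 E2.
have [x1U x1A] := x1P; have [x2U x2A] := x2P.
set x := endpt x1 in x1U *; set y := endpt x2 in x2U *.
have [t [wt lt ut st xt]] := closed_trail tcU x1U x2U.
pose W : {set V} := [set v in walk_verts y t].
have memW v : (v \in W) = (v \in walk_verts y t) by rewrite in_set.
have WU : W \subset U.
  apply/subsetP=> v; rewrite memW; apply: walk_verts_sub => //.
  by rewrite ends_inner.
have WA : W \subset A by apply: subset_trans WU UA.
have xW : x \in W by rewrite memW.
have yW : y \in W by rewrite memW walk_head.
have tW : wedges t \subset inner W.
  by rewrite -ends_inner; apply/subsetP=> v /(walk_ends wt); rewrite memW.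
have cardA' : (#|A :\: W| < n)%N.
  apply: leq_trans leAn; apply: proper_card; rewrite properE subsetDl /=.
  by apply/subsetPn; exists y; rewrite ?(subsetP WA) // inE yW.
have cutA' Z : Z != set0 -> Z \subset A :\: W -> (2 < #|cut Z|)%N.
  by move=> Z0 ZA; apply: cutA => //; apply: subset_trans ZA (subsetDl _ _).
have [c' [g' [c'1 c'0 c'A g'0 g'1]]] := IH _ cardA' cutA'.
(* The edges of x1 and x2 have their far ends outside A, where the net of g is not constrained. They
   are reset to units that make the total over W divisible by 3. *)
pose g1 e := if (e == x1.1) || (e == x2.1) then 0 else g' e.
pose t0 := \sum_(v in W) net g1 v.
have [b1 [b2 [b1P b2P t0P]]] : exists b1 b2 : int,
    [/\ b1 = 1 \/ b1 = -1, b2 = 1 \/ b2 = -1 & (3 %| t0 + b1 + b2)%Z].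
  exact: mod3_two_units.
pose ed (h0 : E * bool) (k : int) e : int := if e == h0.1 then (if h0.2 then - k else k) else 0.
pose g2 e := g1 e + ed x1 b1 e + ed x2 b2 e.
have net2 v : v \in A -> net g2 v = net g1 v + b1 * (v == x)%:R + b2 * (v == y)%:R.
  move=> vA; rewrite /g2 !net_add /ed !net_edge -/x -/y.
  have -> : (v == endpt (opp_half x1)) = false by apply: contraNF x1A => /eqP <-.
  have -> : (v == endpt (opp_half x2)) = false by apply: contraNF x2A => /eqP <-.
  by rewrite !subr0.
have sum1 w : w \in W -> \sum_(v in W) (v == w)%:R = 1 :> int.
  by move=> wW; rewrite (bigD1 w) //= eqxx big1 ?addr0 // => v /andP[_ /negPf->].
have sum2 : \sum_(v in W) net g2 v = t0 + b1 + b2.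
  rewrite (eq_bigr (fun v => net g1 v + b1 * (v == x)%:R + b2 * (v == y)%:R)).
    by rewrite !big_split /= -!big_distrr /= !sum1 // !mulr1.
  by move=> v /(subsetP WA) /net2.
pose d v := - net g2 v.
have conW v : v \in enum W -> connect (adjE (wedges t)) y v.
  by rewrite mem_enum memW; apply: walk_connect.
(* Flow along the trail clears every vertex of W except y, where a multiple of 3 remains. On the
   trail g may take any value, since c is nonzero there. *)
have [f f0 netf] := route (W := wedges t) (x := y) d (enum_uniq _) conW.
have sumd : \sum_(u <- enum W) d u = - (t0 + b1 + b2).
  by rewrite big_enum /= /d sumrN sum2.
exists (fun e => c' e + walk_flow t e), (fun e => g2 e + f e); split.
- move=> e; have [wfb _] := walk_flow_bound e ut.
  have [et|et] := boolP (e \in wedges t); last first.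
    by rewrite walk_flow0 // addr0.
  suff -> : c' e = 0 by rewrite add0r.
  apply/eqP; apply: contraTT (subsetP tW e et) => /c'A; rewrite !inE.
  by case/andP=> /andP[/negPf-> _].
- by move=> v; rewrite net_add c'0 (net_walk_flow _ wt) lt subrr addr0.
- move=> e; have [et _|et] := boolP (e \in wedges t).
    move: (subsetP tW e et); rewrite [e \in inner W]inE => /andP[h1 h2].
    by rewrite inE !(subsetP WA).
  rewrite walk_flow0 // addr0 => /c'A; rewrite !inE.
  by case/andP=> /andP[_ ->] /andP[_ ->].
- move=> v vA; rewrite net_add netf mem_enum sumd.
  have [vW|vW] := boolP (v \in W).
    rewrite /d addrA subrr add0r; case: eqP => _; rewrite ?mul0r ?mul1r ?oppr0 ?opprK //.
  have vx : v != x by apply: contraNneq vW => ->.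
  have vy : v != y by apply: contraNneq vW => ->.
  rewrite net2 // (negPf vx) (negPf vy) !mulr0 mul0r subr0 !addr0.
  rewrite (_ : net g1 v = net g' v); first by apply: g'0; rewrite inE vW.
  apply: eq_net_at => h hv; rewrite /g1; case: ifP => // /orP[/eqP e|/eqP e].
  - have [E1|E1] := same_edge e.
      by rewrite -hv E1 eqxx in vx.
    by move: x1A; rewrite -E1 hv vA.
  have [E1|E1] := same_edge e.
    by rewrite -hv E1 eqxx in vy.
  by move: x2A; rewrite -E1 hv vA.
move=> e; have [et|et] := boolP (e \in wedges t).
  have [_ wf0] := walk_flow_bound e ut.
  have -> : c' e = 0.
    apply/eqP; apply: contraTT (subsetP tW e et) => /c'A; rewrite !inE.
    by case/andP=> /andP[/negPf-> _].
  by rewrite add0r wf0 et.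
rewrite walk_flow0 // addr0 f0 // addr0 /g2 /g1 /ed => ce.
have [->|n1] := eqVneq e x1.1.
  rewrite (negPf ne12) /= addr0 add0r.
  by case: b1P => ->; case: x1.2.
have [->|n2] := eqVneq e x2.1.
  by rewrite /= addr0 add0r; case: b2P => ->; case: x2.2.
by rewrite /= !addr0 g'1.
Qed.

End Flows.

(** * An even set and a mod 3 flow that together miss no edge *)

Section SixFlow.

Local Open Scope ring_scope.

Definition has_six_flow (G : sgraph) := exists c g : edge G -> int,
  [/\ forall e, -1 <= c e <= 1, forall v, net c v = 0,
      forall v, (3 %| net g v)%Z & forall e, c e == 0 -> ~~ (3 %| g e)%Z].

Lemma dvdz_sum (T : finType) (P : pred T) (F : T -> int) (d : int) :
  (forall x, P x -> (d %| F x)%Z) -> (d %| \sum_(x | P x) F x)%Z.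
Proof. by move=> h; apply: rpred_sum. Qed.

(** The construction is applied to all vertices except one root per component. A nonempty set
    without roots has a nonempty cut, and divisibility at a root follows from the zero sum over its
    component. *)
Lemma six_flow_3cut (G : sgraph) :
  (forall U : {set vertex G}, #|cut U| != 1%N /\ #|cut U| != 2%N) -> has_six_flow G.
Proof.
move=> cutG; pose r := fingraph.root (adjE [set: edge G]).
pose A := [set v | r v != v].
have sym := connE_sym [set: edge G].
have closed U : cut U = set0 -> forall u, u \in U -> r u \in U.
  move=> cU u uU; apply: contraT => ruU.
  have [e _] := connect_cut (fingraph.connect_root (adjE [set: edge G]) u) uU ruU.
  by rewrite cU inE.
have cutA U : U != set0 -> U \subset A -> (2 < #|cut U|)%N.
  move=> /set0Pn[u uU] /subsetP UA; have [n1 n2] := cutG U.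
  have : #|cut U| != 0%N.
    rewrite cards_eq0; apply/eqP => cU; have := UA _ (closed U cU u uU).
    by rewrite inE /r fingraph.root_root // eqxx.
  by move: n1 n2; case: #|_| => [|[|[]]].
have [c [g [c1 c0 _ gA g1]]] := six_flow_aux cutA.
exists c, g; split=> // v.
have [vA|vA] := boolP (v \in A); first exact: gA.
have rv : r v = v by apply/eqP; move: vA; rewrite inE negbK.
pose U := component [set: edge G] v.
have cU : cut U = set0.
  by have := component_cut [set: edge G] v; rewrite setTI.
have := sum_net g U; rewrite cU big_set0 (bigD1 v) /= ?component_refl //.
move/eqP; rewrite addr_eq0 => /eqP ->.
rewrite dvdzE abszN -dvdzE; apply: dvdz_sum => u /andP[uU uv]; apply: gA.
rewrite inE; apply: contra uv => /eqP ru; rewrite inE in uU.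
by rewrite -ru -rv eq_sym /r (fingraph.root_connect sym).
Qed.

(** The types of vertices and edges are kept: y becomes isolated and the edges between x and y
    become loops, so it is the number of [links] that drops. *)
Definition contract (G : sgraph) (x y : vertex G) : sgraph :=
  @SGraph (vertex G) (edge G) (fun h => if endpt h == y then x else endpt h) (@negative G).

Lemma net_contract (G : sgraph) (x y : vertex G) (f : edge G -> int) v : x != y ->
  @net (contract x y) f v =
  if v == x then net f x + net f y else if v == y then 0 else net f v.
Proof.
move=> nxy; rewrite /net /=.
have E0 h : ((if endpt h == y then x else endpt h) == v) =
  if v == x then (endpt h == x) || (endpt h == y)
  else if v == y then false else endpt h == v.
  have [->|ny] := eqVneq (endpt h) y.
    rewrite eq_sym orbT; have [//|vx] := eqVneq v x.
    by have [|] := eqVneq v y.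
  have [->|vx] := eqVneq v x; first by rewrite orbF.
  by have [->|//] := eqVneq v y; rewrite (negPf ny).
rewrite (eq_bigl _ _ E0); case: (eqVneq v x) => _.
  rewrite (bigID (fun h => endpt h == x)) /=; congr (_ + _); apply: eq_bigl => h.
    by case: (endpt h == x) => //=; rewrite andbF.
  by case: (eqVneq (endpt h) x) => [->|] //=; rewrite ?andbT ?(negPf nxy).
by case: eqP => _ //; apply: big_pred0.
Qed.

Lemma cut_contract (G : sgraph) (x y : vertex G) (U : {set vertex G}) :
  @cut (contract x y) U = cut [set v | (if v == y then x else v) \in U].
Proof. by apply/setP=> e; rewrite !inE /crosses /= !inE. Qed.

Definition links (G : sgraph) : {set edge G} :=
  [set e | endpt (e, false) != endpt (e, true)].

(* The two edges of a 2-cut carry the same value up to sign, so one of them may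
   be contracted. *)
Lemma six_flow (G : sgraph) :
  (forall U : {set vertex G}, #|cut U| != 1%N) -> has_six_flow G.
Proof.
have [n] := ubnP #|links G|; elim: n G => // n IH G len cut1; rewrite ltnS in len.
have [/existsP[U /eqP cU2]|no2] := boolP [exists U : {set vertex G}, #|cut U| == 2%N]; last first.
  apply: six_flow_3cut => U; split; first exact: cut1.
  by apply: contra no2 => cU; apply/existsP; exists U.
have /cards2P[e [f [nef cUE]]] : #|cut U| == 2%N by apply/eqP.
pose x := endpt (e, false); pose y := endpt (e, true).
have eU : e \in cut U by rewrite cUE !inE eqxx.
have nxy : x != y by apply: contraTneq eU => E; rewrite inE /crosses -/x -/y E addbb.
have len' : (#|links (contract x y)| < n)%N.
  apply: leq_trans len; apply: proper_card; apply/properP; split.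
    apply/subsetP=> e'; rewrite !inE /=; apply: contraNneq => E; by rewrite E.
  by exists e; rewrite !inE //= -/x -/y eqxx (negPf nxy) eqxx.
have [U'|c' [g' [c'1 c'0 g'0 g'1]]] := IH _ len'; first by rewrite cut_contract.
(* Changing the value on e by the net at x balances x exactly; y then gets the net that the merged
   vertex had in the contraction. *)
pose cor (k : int) (f0 : edge G -> int) e' := f0 e' + (if e' == e then - k else 0).
have ncor k f0 v : net (cor k f0) v = net f0 v - k * ((v == x)%:R - (v == y)%:R).
  rewrite /cor net_add; congr (_ + _); rewrite -mulNr.
  exact: (net_edge (e, false) (- k) v).
have other v : v != x -> v != y -> forall f0, net f0 v = @net (contract x y) f0 v.
  by move=> vx vy f0; rewrite net_contract // (negPf vx) (negPf vy).
pose c := cor (@net G c' x) c'; pose g := cor (@net G g' x) g'.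
have c0 v : net c v = 0.
  rewrite ncor; have [->|vx] := eqVneq v x.
    by rewrite (negPf nxy) [_ - false%:R]subr0 mulr1 addrN.
  have [->|vy] := eqVneq v y; last by rewrite subrr mulr0 subr0 other.
  have := c'0 x; rewrite net_contract // eqxx.
  by rewrite sub0r mulrN1 opprK addrC.
have g0 v : (3 %| net g v)%Z.
  rewrite ncor; have [->|vx] := eqVneq v x.
    by rewrite (negPf nxy) [_ - false%:R]subr0 mulr1 addrN.
  have [->|vy] := eqVneq v y; last by rewrite subrr mulr0 subr0 other.
  have := g'0 x; rewrite net_contract // eqxx.
  by rewrite sub0r mulrN1 opprK addrC.
have sumU f0 : \sum_(v in U) net f0 v =
    (if endpt (e, false) \in U then f0 e else - f0 e) +
    (if endpt (f, false) \in U then f0 f else - f0 f).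
  by rewrite sum_net cUE big_setU1 ?inE //= big_set1.
have cf : c f = c' f by rewrite /c /cor eq_sym (negPf nef) addr0.
have gf : g f = g' f by rewrite /g /cor eq_sym (negPf nef) addr0.
(* Conservation across the 2-cut ties e to f, so the bound on c and the nonvanishing known at f
   carry over to e. *)
have ce : c e = c f \/ c e = - c f.
  have := sumU c; rewrite big1 => [|v _]; last exact: c0.
  by case: ifP => _; case: ifP => _; lia.
have ge : (3 %| g e)%Z -> (3 %| g f)%Z.
  have : (3 %| \sum_(v in U) net g v)%Z by apply: dvdz_sum.
  by rewrite sumU; case: ifP => _; case: ifP => _; lia.
exists c, g; split=> // e'; have [->|ne] := eqVneq e' e.
- by have := c'1 f; rewrite -cf; lia.
- by have := c'1 e'; rewrite /c /cor (negPf ne) addr0.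
- move=> cz; have := g'1 f; rewrite -cf -gf => h; apply: contra (h _); first exact: ge.
  by case: ce cz => ->; rewrite ?oppr_eq0.
by rewrite /c /g /cor (negPf ne) !addr0; apply: g'1.
Qed.

End SixFlow.

(** * Lifting mod 3 flows and splitting them into two even sets *)

Section ModThreeFlow.

Local Open Scope ring_scope.

Section Parity.

Variable G : sgraph.
Implicit Types (f : edge G -> int) (v : vertex G).

Lemma odd_absD (a b : int) : odd `|(a + b)%R|%N = odd `|a|%N (+) odd `|b|%N.
Proof. lia. Qed.

Lemma odd_abs_sum (T : finType) (P : pred T) (F : T -> int) :
  odd `|(\sum_(x | P x) F x)%R|%N = odd #|[set x | P x && odd `|F x|%N]|.
Proof.
rewrite (big_morph (fun z : int => odd `|z|%N) odd_absD (erefl : odd `|0|%N = false)).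
by rewrite big_addb_card.
Qed.

Lemma odd_net f v : odd `|net f v|%N = bd [set e | odd `|f e|%N] v.
Proof.
rewrite /net odd_abs_sum bdE; congr (odd #|pred_of_set _|); apply/setP=> h.
by rewrite !inE andbC /flow_on; case: h.2; rewrite ?abszN.
Qed.

Lemma odd_cut_sum f (U : {set vertex G}) :
  odd `|(\sum_(v in U) net f v)%R|%N = odd #|[set e | odd `|f e|%N] :&: cut U|.
Proof.
rewrite sum_net odd_abs_sum; congr (odd #|pred_of_set _|); apply/setP=> e.
by rewrite !inE andbC; case: ifP => _; rewrite ?abszN.
Qed.

End Parity.

Lemma lift_arith (r F F' w : int) (b : bool) : -1 <= r <= 1 ->
  F = (if b then -2 * r else r) -> F' = (if ~~ b then -2 * r else r) ->
  w = 1 \/ w = -1 -> 0 < w * F -> F' = F + -3 * w.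
Proof. by move=> ? -> -> [->|->]; case: b => /=; lia. Qed.

Lemma abs_shift (a b : int) : (3 %| a)%Z -> (3 %| b)%Z -> 0 < a -> b < 0 ->
  (`|(a - 3)%R| < `|a|)%N /\ (`|(b + 3)%R| <= `|b|)%N.
Proof. lia. Qed.

(* A mod 3 flow lifts to an integer flow with values of modulus at most 2:
   among the lifts choose one of least total imbalance and reverse a positive
   path if it is not conserved. *)
Lemma mod3_lift (G : sgraph) (g : edge G -> int) : (forall v, (3 %| net g v)%Z) ->
  exists F : edge G -> int, [/\ forall v, net F v = 0,
    forall e, -2 <= F e <= 2 & forall e, (F e == 0) = (3 %| g e)%Z].
Proof.
move=> g0; pose r e : int := if (3 %| g e)%Z then 0 else if (3 %| g e - 1)%Z then 1 else -1.
have r1 e : -1 <= r e <= 1 by rewrite /r; do 2 case: ifP => _ //.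
have rg e : (3 %| r e - g e)%Z.
  by rewrite /r; move: (g e) => x; case: ifP => h; [lia|case: ifP => h'; lia].
(* [-2 * r e] is the other lift of the residue of modulus at most 2; S collects the edges where it
   is chosen, and [Phi] is the total imbalance. *)
pose lift (S : {set edge G}) e : int := if e \in S then -2 * r e else r e.
pose Phi S := (\sum_v `|net (lift S) v|)%N.
pose S := [arg min_(X < set0) Phi X].
have minS X : (Phi S <= Phi X)%N by rewrite /S; case: arg_minnP => // Y _; apply.
pose F := lift S.
have F3 v : (3 %| net F v)%Z.
  have -> : net F v = net g v + net (fun e => F e - g e) v.
    by rewrite -net_add; apply: eq_net => e; rewrite addrC subrK.
  apply: rpredD => //; apply: dvdz_sum => h _.
  have : (3 %| F h.1 - g h.1)%Z.
    by have := rg h.1; rewrite /F /lift; move: (r h.1) (g h.1) => a b; case: ifP => _; lia.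
  by rewrite /flow_on; case: h.2; rewrite ?dvdzE ?abszN.
have sumF : \sum_v net F v = 0.
  rewrite (eq_bigl (fun v => v \in [set: vertex G])) => [|v]; last by rewrite inE.
  by rewrite sum_net cutT big_set0.
have F0 v : net F v = 0.
  apply/eqP; apply: contraT => nv.
  have [p p0] : exists p, 0 < net F p.
    apply/existsP; apply: contraT => /existsPn le0.
    have le0' u : net F u <= 0 by rewrite leNgt le0.
    case/eqP: nv; apply/eqP; rewrite eq_le le0' /=.
    move/eqP: sumF; rewrite (bigD1 v) //= addr_eq0 => /eqP->.
    by rewrite oppr_ge0; apply: sumr_le0.
  pose Q (h : edge G * bool) := 0 < flow_on F h.
  pose U := [set w | connect (half_rel Q) p w].
  have pU : p \in U by rewrite inE connect0.
  have leU : \sum_(w in U) net F w <= 0.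
    rewrite sum_net; apply: sumr_le0 => e eU.
    have stp (h : edge G * bool) : endpt h \in U -> endpt (opp_half h) \notin U -> flow_on F h <= 0.
      rewrite !inE => c nc; rewrite leNgt; apply: contra nc => Qh.
      by apply: connect_trans c (connect1 _); apply/existsP; exists h; rewrite /Q Qh !eqxx.
    move: eU; rewrite inE /crosses; case: ifP => h0.
      by case h1: (_ \in U) => // _; apply: (stp (e, false)); rewrite ?h1.
    by move=> h1; apply: (stp (e, true)) => //; rewrite h0.
  (* Otherwise the nets in U would have a positive sum, although no edge leaving U carries a
     positive value outwards. *)
  have [q qU q0] : exists2 q, q \in U & net F q < 0.
    apply/exists_inP; apply: contraT => /exists_inPn ge0.
    have : 0 < \sum_(w in U) net F w.
      rewrite (bigD1 p) //= ltr_pwDl //; apply: sumr_ge0 => w /andP[wU _].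
      by rewrite leNgt ge0.
    by rewrite ltNge leU.
  move: qU; rewrite inE => /connect_walk[s [ws ls us /allP Qs]].
  have ue := walk_uniq_edges ws us.
  have FE e : lift (symd S (wedges s)) e = F e + -3 * walk_flow s e.
    have [|es] := boolP (e \in wedges s); last first.
      by rewrite walk_flow0 // mulr0 addr0 /F /lift in_symd (negPf es) addbF.
    move=> ew; have := ew; rewrite inE => /mapP[h hs E]; subst e.
    rewrite (walk_flow_uniq ue hs).
    apply: (@lift_arith (r h.1) _ _ _ (h.1 \in S)) => //.
    - by rewrite /lift in_symd ew addbT.
    - by rewrite /sgn_half; case: h.2; auto.
    have := Qs h hs; rewrite /Q /flow_on /sgn_half.
    by case: h.2; rewrite ?mulN1r ?mul1r.
  have netE w : net (lift (symd S (wedges s))) w = net F w + -3 * ((w == p)%:R - (w == q)%:R).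
    rewrite (eq_net _ FE) net_add net_scale (net_walk_flow _ ws); congr (_ + -3 * (_ - _)).
    by rewrite /wlast ls.
  (* Nets are multiples of 3, so moving 3 units from p to q lowers the modulus at p and does not
     raise the one at q. *)
  have [lp lq] := abs_shift (F3 p) (F3 q) p0 q0.
  have npq : p != q by apply: contraTneq p0 => ->; rewrite -leNgt ltW.
  have := minS (symd S (wedges s)); rewrite leqNgt => /negP[].
  rewrite /Phi (bigD1 p) //= [X in (_ < X)%N](bigD1 p) //= -addSn leq_add //.
    by rewrite netE eqxx (negPf npq) [_ - false%:R]subr0 mulr1.
  apply: leq_sum => w wp; rewrite netE (negPf wp) [false%:R - _]sub0r.
  have [->|wq] := eqVneq w q; first by rewrite mulrN1 opprK.
  by rewrite [- false%:R]oppr0 mulr0 addr0.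
exists F; split=> // e.
  by rewrite /F /lift; have := r1 e; move: (r e) => x; case: ifP => _; lia.
rewrite /F /lift (fun_if (fun z => z == 0)) mulf_eq0 /= if_same /r.
by case: ifP => // _; case: ifP.
Qed.

(** Lift g to F. The odd values form an even set D; the values 2 and -2 form T, whose boundary is
    repaired by K inside D. Then [symd T K] and its sum with D cover T and D. *)
Lemma mod3_cover (G : sgraph) (g : edge G -> int) : (forall v, (3 %| net g v)%Z) ->
  exists D1 D2 : {set edge G}, [/\ even_set D1, even_set D2 &
    D1 :|: D2 = [set e | ~~ (3 %| g e)%Z]].
Proof.
move=> /mod3_lift[F [F0 F2 Fg]].
pose D := [set e | odd `|F e|%N].
have eD : even_set D by apply/even_setP=> v; rewrite -odd_net F0.
pose f2 e : int := if F e == 2 then 1 else if F e == -2 then -1 else 0.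
pose T := [set e | odd `|f2 e|%N].
have FT e : e \notin D -> F e = 2 * f2 e.
  rewrite inE /f2; move: (F2 e); move: (F e) => x; do 2 (case: eqP => [->|?] //); lia.
(* On a component U of D all edges leaving U have even values, so the halves [f2] also sum to 0
   across the cut, and T meets it evenly. *)
have [x|K KD oK] := @join_exists G D (oddv T).
  set U := component D x; have DU : D :&: cut U = set0 by apply: component_cut.
  rewrite odd_oddv -odd_cut_sum; suff -> : \sum_(v in U) net f2 v = 0 by [].
  have : \sum_(v in U) net F v = 2 * \sum_(v in U) net f2 v.
    rewrite !sum_net big_distrr /=; apply: eq_bigr => e eU.
    have eN : e \notin D by apply/negP=> eD'; have := in_set0 e; rewrite -DU inE eD' eU.
    by rewrite FT //; case: ifP => _; rewrite ?mulrN.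
  by rewrite big1 // => h; move: (\sum_(v in U) net f2 v) h => z; lia.
have eD1 : even_set (symd T K) by rewrite /even_set oddv_symd oK symdv.
exists (symd T K), (symd (symd T K) D); split=> //; first exact: even_symd.
apply/setP=> e; rewrite !in_setU !in_symd [RHS]inE -Fg.
have := subsetP KD e; have eN := FT e.
have TD : (e \in T) = (F e == 2) || (F e == -2).
  by rewrite inE /f2; do 2 case: eqP => //.
rewrite TD; have : (e \in D) = (F e == 1) || (F e == -1).
  by rewrite inE; have := F2 e; move: (F e) => z; lia.
have := F2 e; move: (F e) => z z2 ->.
case: (e \in K) => [/(_ isT)|_]; move: z2; lia.
Qed.

End ModThreeFlow.

(** * Covering a bridgeless graph by three even sets *)

Lemma card_symdU (T : finType) (A B : {set T}) :
  #|A| + #|B| + #|symd A B| = 2 * #|A :|: B|.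
Proof.
have dAB : [disjoint symd A B & A :&: B].
  by rewrite -setI_eq0; apply/eqP/setP=> x; rewrite !inE; do 2 case: (_ \in _).
have UE : A :|: B = symd A B :|: (A :&: B).
  by apply/setP=> x; rewrite !inE; do 2 case: (_ \in _).
have := cardsUI A B; have := cardsUI (symd A B) (A :&: B).
move: dAB; rewrite -setI_eq0 => /eqP->; rewrite cards0 -UE; lia.
Qed.

Lemma card_symdI (T : finType) (A B : {set T}) :
  #|symd A B| + 2 * #|A :&: B| = #|A| + #|B|.
Proof. by have := card_symdU A B; have := cardsUI A B; lia. Qed.

Lemma min_of_three (P : nat -> Prop) a b c k : P a -> P b -> P c -> a + b + c <= 3 * k ->
  exists2 m, P m & m <= k.
Proof.
move=> Pa Pb Pc le; have : a <= k \/ b <= k \/ c <= k by lia.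
by case=> [h|[h|h]]; [exists a|exists b|exists c].
Qed.

(* With C of size x + z (x edges where the mod 3 flow vanishes) and y edges
   outside C, the cheapest two of D1, D2, D1 + D2 cost at most 4(y + z)/3; what
   they miss lies in C and in every C + D, one of which has at most
   x + z/3 + 2y/3 edges. *)
Lemma five_thirds_arith (x y z p c d : nat) : z <= 2 * x -> 3 * p <= 4 * (y + z) ->
  c = x + z -> 3 * d <= 3 * x + z + 2 * y ->
  3 * (p + c) <= 5 * (x + y + z) \/ 3 * (p + d) <= 5 * (x + y + z).
(* The second alternative holds if y <= 2x. Otherwise 2z <= 4x < 2x + y, which gives the first. *)
Proof. lia. Qed.

Lemma dvdz3_shift (c g : int) : c != 0%R -> (-1 <= c <= 1)%R ->
  exists i : 'I_3, (3 %| (g + c *+ i)%R)%Z.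
Proof.
move=> c0 c1; have cE : c = 1%R \/ c = (-1)%R by lia.
have : (3 %| g)%Z \/ (3 %| (g + c)%R)%Z \/ (3 %| (g + c *+ 2)%R)%Z by case: cE => ->; lia.
case=> [h|[h|h]]; [exists ord0|exists (@Ordinal 3 1 isT)|exists (@Ordinal 3 2 isT)] => //=.
by rewrite mulr0n addr0.
Qed.

(** Adding multiples of c to g changes the zeros mod 3 only on the support C of c, and the zero sets
    of the three shifts together cover C. *)
Lemma even_cover_bridgeless (G : sgraph) : (forall U : {set vertex G}, #|cut U| != 1) ->
  exists E1 E2 E3 : {set edge G}, [/\ even_set E1, even_set E2, even_set E3,
    E1 :|: E2 :|: E3 = setT & 3 * (#|E1| + #|E2| + #|E3|) <= 5 * #|edge G|].
Proof.
case/six_flow=> c [g [c1 c0 g0 gN0]].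
pose C := [set e | c e != 0%R].
have eC : even_set C.
  have -> : C = [set e | odd `|c e|%N].
    by apply/setP=> e; rewrite !inE; have := c1 e; move: (c e) => z; lia.
  by apply/even_setP=> v; rewrite -odd_net c0.
pose gi (i : nat) e : int := (g e + c e *+ i)%R.
have gi0 i v : (3 %| net (gi i) v)%Z.
  rewrite /gi net_add; have -> : net (fun e => c e *+ i)%R v = (i%:R * net c v)%R.
    by rewrite -net_scale; apply: eq_net => e; rewrite mulr_natl.
  by rewrite c0 mulr0 addr0.
pose X (i : nat) := [set e | (3 %| gi i e)%Z].
have XC i : X i \subset C.
  apply/subsetP=> e; rewrite !inE /gi; apply: contraTneq => ce.
  by rewrite ce mul0rn addr0; apply: gN0; rewrite ce.
(* A shift with many zeros is wanted, at least a third of C, since D1, D2 and D3 have to cover only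
   its support S. *)
have [i leX] : exists i : 'I_3, #|C| <= 3 * #|X i|.
  have : #|C| <= \sum_(i < 3) #|X i|.
    have sub : C \subset \bigcup_(i < 3) X i.
      apply/subsetP=> e; rewrite inE => ce; have [i hi] := dvdz3_shift (g e) ce (c1 e).
      by apply/bigcupP; exists i; rewrite // inE.
    apply: leq_trans (subset_leq_card sub) _.
    apply: (big_ind2 (fun (S : {set edge G}) n => #|S| <= n)); rewrite ?cards0 //.
    move=> S n S' n' le le'; apply: leq_trans (leq_card_setU S S').1 _; exact: leq_add.
  have -> : \sum_(i < 3) #|X i| = #|X 0| + #|X 1| + #|X 2|.
    by rewrite !big_ord_recr big_ord0.
  move=> le; have : #|C| <= 3 * #|X 0| \/ #|C| <= 3 * #|X 1| \/ #|C| <= 3 * #|X 2|.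
    by move: le; clear; lia.
  by case=> [h|[h|h]]; [exists ord0|exists (@Ordinal 3 1 isT)|exists (@Ordinal 3 2 isT)].
have [D1 [D2 [eD1 eD2 DU]]] := mod3_cover (gi0 i).
pose S := ~: X i; have SE : D1 :|: D2 = S by rewrite DU; apply/setP=> e; rewrite !inE.
pose D3 := symd D1 D2; have eD3 : even_set D3 by apply: even_symd.
have S13 : D1 :|: D3 = S.
  by rewrite -SE; apply/setP=> e; rewrite !inE; case: (_ \in D1).
have S23 : D2 :|: D3 = S.
  by rewrite -SE; apply/setP=> e; rewrite !inE; do 2 case: (_ \in _).
have sumD : #|D1| + #|D2| + #|D3| = 2 * #|S| by rewrite card_symdU SE.
have sumCD : #|C :&: D1| + #|C :&: D2| + #|C :&: D3| = 2 * #|C :&: S|.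
  have -> : C :&: D3 = symd (C :&: D1) (C :&: D2).
    by rewrite ![C :&: _]setIC -symdI.
  by rewrite card_symdU -setIUr SE.
pose x := #|X i|; pose z := #|C :&: S|; pose y := #|~: C|.
have cardC : #|C| = x + z.
  rewrite -(cardsID (X i) C) (setIidPr (XC i)); congr (_ + #|pred_of_set _|).
  by apply/setP=> e; rewrite !inE andbC.
have cardS : #|S| = y + z.
  rewrite -(cardsID C S) addnC setIC; congr (#|pred_of_set _| + _).
  apply/setP=> e; rewrite in_setD in_setC in_setC; case eX: (e \in X i); rewrite ?andbF ?andbT //=.
  by rewrite (subsetP (XC i) e eX).
have cardE : #|edge G| = x + y + z by rewrite -(cardsC C) cardC; lia.
have [p [E1 [E2 [eE1 eE2 SE12 pE]]] lep] : exists2 p, exists E1 E2 : {set edge G},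
    [/\ even_set E1, even_set E2, E1 :|: E2 = S & p = 3 * (#|E1| + #|E2|)] & p <= 4 * (y + z).
  apply: (@min_of_three _ (3 * (#|D1| + #|D2|)) (3 * (#|D1| + #|D3|)) (3 * (#|D2| + #|D3|))).
  - by exists D1, D2.
  - by exists D1, D3.
  - by exists D2, D3.
  by move: sumD; rewrite cardS; clear; lia.
have XSD (D D' : {set edge G}) : D :|: D' = S -> S :|: symd C D = setT.
  move=> SD; apply/setP=> e; rewrite in_setU in_symd [RHS]inE.
  have [//|eS] := boolP (e \in S).
  have eD : e \notin D by apply: contra eS => eD; rewrite -SD in_setU eD.
  have eX : e \in X i by apply: contraR eS; rewrite in_setC.
  by rewrite (negPf eD) (subsetP (XC i) e eX).
have [d [E3 [eE3 UE3 dE]] led] : exists2 d, exists E3 : {set edge G},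
    [/\ even_set E3, S :|: E3 = setT & d = 3 * #|E3|] & d <= 3 * x + z + 2 * y.
  apply: (@min_of_three _ (3 * #|symd C D1|) (3 * #|symd C D2|) (3 * #|symd C D3|)).
  - by exists (symd C D1); rewrite even_symd // (XSD D1 D2).
  - by exists (symd C D2); rewrite even_symd // (XSD D2 D3).
  - by exists (symd C D3); rewrite even_symd // (XSD D3 D1) // setUC.
  move: (card_symdI C D1) (card_symdI C D2) (card_symdI C D3) sumCD sumD.
  rewrite cardS cardC -/z; clear; lia.
have zx : z <= 2 * x by move: leX; rewrite cardC -/x; clear; lia.
have UC : S :|: C = setT.
  apply/setP=> e; rewrite in_setU [RHS]inE in_setC.
  by case eX: (e \in X i) => //=; rewrite (subsetP (XC i) e eX).
have := @five_thirds_arith x y z (#|E1| + #|E2|) #|C| #|E3| zx.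
rewrite cardE; case.
- by rewrite -pE.
- exact: cardC.
- by rewrite -dE.
- by move=> le; exists E1, E2, C; rewrite SE12.
by move=> le; exists E1, E2, E3; rewrite SE12.
Qed.

Lemma bd_cut (G : sgraph) (W : {set edge G}) v : bd W v = odd #|W :&: cut [set v]|.
Proof. by rewrite -sum_bd big_set1. Qed.

(** In the graph whose edge type is restricted to A, bridgelessness of A means that no cut has
    exactly one edge. *)
Lemma even_cover (G : sgraph) (A : {set edge G}) : bridgeless A ->
  exists E1 E2 E3 : {set edge G}, [/\ even_set E1, even_set E2, even_set E3,
    E1 :|: E2 :|: E3 = A & 3 * (#|E1| + #|E2| + #|E3|) <= 5 * #|A|].
Proof.
move=> bA; pose E' := {e : edge G | e \in A}.
pose G' := @SGraph (vertex G) E' (fun h => endpt (val h.1, h.2)) (fun e => negative (val e)).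
pose im (W : {set edge G'}) : {set edge G} := [set val e | e in W].
have cardim W : #|im W| = #|W| by rewrite card_imset //; apply: val_inj.
have imA W e : e \in im W -> e \in A by case/imsetP=> e' _ ->; apply: valP.
have cutE e' (U : {set vertex G}) : (e' \in @cut G' U) = (val e' \in cut U).
  by rewrite !inE.
have imcut W (U : {set vertex G}) : im (W :&: @cut G' U) = im W :&: cut U.
  apply/setP=> e; rewrite in_setI; apply/imsetP/andP=> [[e' /setIP[eW eU] ->]|[/imsetP[e' eW ->] eU]].
    by split; [apply/imsetP; exists e'|rewrite -cutE].
  by exists e' => //; rewrite in_setI eW cutE.
have evim W : even_set W -> even_set (im W).
  move=> /even_setP eW; apply/even_setP=> v; rewrite bd_cut -imcut cardim.
  by have := eW v; rewrite (@bd_cut G').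
have [U|E1 [E2 [E3 [e1 e2 e3 U le]]]] := @even_cover_bridgeless G'.
  apply/negP=> /cards1P[e' cU].
  have [C sC /andP[eC eiC]] := bA (val e') (valP e').
  have := @even_cut G C U eC; suff -> : C :&: @cut G U = [set val e'] by rewrite cards1.
  apply/setP=> e; rewrite in_setI in_set1; apply/andP/eqP=> [[eiC' eU]|->].
    have eA : e \in A := subsetP sC e eiC'.
    have : (Sub e eA : E') \in @cut G' U by rewrite cutE.
    by rewrite cU inE => /eqP <-.
  by split=> //; rewrite -cutE cU inE.
exists (im E1), (im E2), (im E3); split; try exact: evim.
  apply/setP=> e; rewrite !in_setU; apply/orP/idP.
    by case=> [/orP[]|]; apply: imA.
  move=> eA; have := in_setT (Sub e eA : E'); rewrite -U !in_setU.
  case/orP=> [/orP[]|] h; [left; apply/orP; left|left; apply/orP; right|right];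
    by apply/imsetP; exists (Sub e eA).
rewrite !cardim; have -> : #|A| = #|edge G'| by rewrite card_sig.
exact: le.
Qed.

(** * Signed circuits from even sets *)

Section SignedCircuits.

Variable G : sgraph.
Local Notation V := (vertex G).
Local Notation E := (edge G).
Implicit Types (W C J K H A P F D B Z : {set E}) (U X T : {set V}) (u v x y : V) (e : E)
  (h : half_edge G) (s : seq (half_edge G)) (cs : seq (subgr G)) (Ds : seq {set E}).

Definition oddneg W : bool := odd #|[set e in W | negative e]|.

Lemma oddneg_symd A B : oddneg (symd A B) = oddneg A (+) oddneg B.
Proof.
rewrite /oddneg !setIdE -odd_symd -symdI; congr (odd #|pred_of_set _|).
Qed.

Lemma oddneg0 : oddneg set0 = false.
Proof.
rewrite /oddneg (_ : [set _ in _ | _] = set0) ?cards0 //.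
by apply/setP=> e; rewrite !inE.
Qed.

Definition negcyc W := cyc W && oddneg W.

Lemma disjointD H K : [disjoint H :\: K & K].
Proof. by rewrite -setI_eq0; apply/eqP/setP=> e; rewrite !inE; case: (e \in K); rewrite ?andbF. Qed.

(** The two arcs of D between the ends of an ear have different signs because D is negative, so the
    ear closes with one of them to an even set of positive sign. Taking a smallest ear makes this
    set a cycle. *)
Lemma two_negcyc D D' x y : negcyc D -> negcyc D' -> [disjoint D & D'] -> x != y ->
  x \in ends D -> y \in ends D -> x \in ends D' -> y \in ends D' ->
  exists K, [/\ cyc K, ~~ oddneg K & K \subset D :|: D'].
Proof.
case/andP=> cD oD /andP[cD' oD'] dDD' nxy xD yD xD' yD'.
have [D0 eD mD] := cycP _ cD; have [D0' eD' mD'] := cycP _ cD'.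
have arc0 u v : u != v -> symd [set u] [set v] != set0.
  by move=> uv; apply/set0Pn; exists u; rewrite !inE eqxx (negPf uv).
(* An ear is recorded by its boundary alone: two distinct vertices of D. *)
pose ear B := (B \subset D') && [exists u, exists v,
  [&& u != v, u \in ends D, v \in ends D & oddv B == symd [set u] [set v]]].
have [B0 [sB0 oB0 _ _ _]] := cyc_arc cD' xD' yD' nxy.
have earB0 : ear B0.
  by rewrite /ear sB0; apply/existsP; exists x; apply/existsP; exists y; rewrite nxy xD yD oB0 eqxx.
pose B := [arg min_(Z < B0 | ear Z) #|Z|].
have [earB minB] : ear B /\ forall Z, ear Z -> #|B| <= #|Z|.
  by rewrite /B; case: arg_minnP.
have {earB}[sB /existsP[u /existsP[v /and4P[nuv uD vD /eqP oB]]]] := andP earB.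
(* The parts of an even subset Z in A and in B have the same boundary, which lies on D. If it is
   nonempty, Z contains an ear inside B, hence all of B by minimality, and then all of A. *)
have cycAB A : A \subset D -> oddv A = symd [set u] [set v] -> cyc (A :|: B).
  move=> sA oA; have dAB : [disjoint A & B].
    by apply: disjointWl sA _; apply: disjointWr sB _.
  have nAD : A != D by apply: contraNneq (arc0 u v nuv) => AD; rewrite -oA AD.
  have nBD : B != D' by apply: contraNneq (arc0 u v nuv) => BD; rewrite -oB BD.
  have smallA K : K \subset A -> even_set K -> K = set0.
    move=> sK eK; case: (mD K (subset_trans sK sA) eK) => // KD.
    by case/negP: nAD; rewrite eqEsubset sA -{1}KD sK.
  have smallB K : K \subset B -> even_set K -> K = set0.
    move=> sK eK; case: (mD' K (subset_trans sK sB) eK) => // KD.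
    by case/negP: nBD; rewrite eqEsubset sB -{1}KD sK.
  apply/cycP; split.
  - apply: contraNneq (arc0 u v nuv) => AB0; rewrite -oA.
    by have := subsetUl A B; rewrite AB0 subset0 => /eqP->; rewrite oddv0.
  - by rewrite -symd_disjoint // /even_set oddv_symd oA oB symdv.
  move=> Z sZ eZ; pose Z1 := Z :&: A; pose Z2 := Z :&: B.
  have ZE : Z = symd Z1 Z2.
    rewrite symd_disjoint -?setIUr ?(setIidPl sZ) //.
    by apply: disjointWl (subsetIr Z A) _; apply: disjointWr (subsetIr Z B) _.
  have oZ : oddv Z1 = oddv Z2.
    by apply: symd_eq0; rewrite -oddv_symd -ZE; apply/eqP.
  have [Z10|[x' x'Z]] := set_0Vmem (oddv Z1).
    left; rewrite ZE (smallA Z1) ?subsetIr ?/even_set ?Z10 //.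
    by rewrite (smallB Z2) ?subsetIr ?/even_set -?oZ ?Z10 // symdv.
  have endD w : w \in oddv Z1 -> w \in ends D.
    move=> wZ; apply: (subsetP (ends_sub (subset_trans (subsetIr Z A) sA))).
    exact: (subsetP (oddv_ends _)).
  have x'Z2 : x' \in oddv Z2 by rewrite -oZ.
  have [y' [P [nyx y'Z sP oP _]]] := oddv_path x'Z2.
  have earP : ear P.
    rewrite /ear (subset_trans sP (subset_trans (subsetIr _ _) sB)).
    apply/existsP; exists x'; apply/existsP; exists y'.
    by rewrite eq_sym nyx !endD ?oP ?eqxx // oZ.
  have Z2B : Z2 = B.
    apply/eqP; rewrite eqEcard subsetIr /=.
    by apply: leq_trans (minB P earP) (subset_leq_card sP).
  have Z1A : Z1 = A.
    have sZA : Z1 \subset A by apply: subsetIr.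
    have eA : even_set (A :\: Z1).
      by rewrite -symd_subD // /even_set oddv_symd oA oZ Z2B oB symdv.
    have := smallA _ (subsetDl A Z1) eA; move/eqP; rewrite setD_eq0 => sAZ.
    by apply/eqP; rewrite eqEsubset sZA.
  by right; rewrite ZE Z1A Z2B symd_disjoint.
have [A [sA oA oA' _ _]] := cyc_arc cD uD vD nuv.
have dB K : K \subset D -> [disjoint K & B].
  by move=> sK; apply: disjointWl sK _; apply: disjointWr sB _.
have par K : K \subset D -> oddneg (K :|: B) = oddneg K (+) oddneg B.
  by move=> sK; rewrite -oddneg_symd symd_disjoint ?dB.
have sub K : K \subset D -> K :|: B \subset D :|: D' by move=> sK; apply: setUSS.
have parA : oddneg (D :\: A) = ~~ oddneg A.
  by rewrite -symd_subD // oddneg_symd oD.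
have [odd1|ev1] := boolP (oddneg A (+) oddneg B).
  exists (D :\: A :|: B); split; rewrite ?cycAB ?subsetDl ?sub ?subsetDl //.
  by rewrite par ?subsetDl // parA addNb odd1.
by exists (A :|: B); split; rewrite ?cycAB ?sub // par.
Qed.

Definition cover_of cs Ds H : Prop := forall e, e \in H ->
  (exists2 C, C \in cs & e \in edges C) \/ (exists2 D, D \in Ds & e \in D).

Definition vdisj (K D : {set E}) := [disjoint ends K & ends D].

(** The order of removal matters: once no positive cycle and no short barbell is left, edge-disjoint
    negative cycles share no vertex, since one common vertex gives a short barbell and two give a
    positive cycle. *)
Lemma decompose H : even_set H -> exists cs Ds,
  [/\ forall C : subgr G, C \in cs -> signed_circuit C,
      forall D, D \in Ds -> negcyc D /\ D \subset H,
      pairwise vdisj Ds,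
      \sum_(C <- cs) #|edges C| + \sum_(D <- Ds) #|D| = #|H| &
      cover_of cs Ds H /\ odd (size Ds) = oddneg H].
Proof.
have [n] := ubnP #|H|; elim: n H => // n IH H leHn eH.
have smaller K : K \subset H -> K != set0 -> #|H :\: K| < n.
  move=> sK K0; apply: leq_trans (_ : #|H| <= n); last by [].
  by rewrite cardsDS //; have := subset_leq_card sK; rewrite -card_gt0 in K0; lia.
have cardD K : K \subset H -> #|K| + #|H :\: K| = #|H|.
  by move=> sK; rewrite -(cardsID K H) (setIidPr sK).
have parD K : K \subset H -> oddneg (H :\: K) = oddneg H (+) oddneg K.
  by move=> sK; rewrite -symd_subD // oddneg_symd.
have [/existsP[K /and3P[cK pK sK]]|noPos] :=
    boolP [exists K : {set E}, [&& cyc K, ~~ oddneg K & K \subset H]].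
  have [K0 eK _] := cycP _ cK.
  have [cs [Ds [csP DsP dDs sz [cov par]]]] := IH _ (smaller K sK K0) (even_setD sK eH eK).
  exists (graph_of K :: cs), Ds; split=> //.
  - by move=> C; rewrite inE => /orP[/eqP->|/csP//]; left; split=> //; apply: cyc_is_cycle.
  - by move=> D /DsP[nD sD]; split=> //; apply: subset_trans sD (subsetDl _ _).
  - by rewrite big_cons -addnA sz cardD.
  split; last by rewrite par parD // (negPf pK) addbF.
  move=> e eH'; have [eK'|eK'] := boolP (e \in K).
    by left; exists (graph_of K); rewrite ?mem_head.
  have [|[C Cin eC]|[D Din eD]] := cov e; first by rewrite inE eK'.
    by left; exists C; rewrite ?inE ?Cin ?orbT.
  by right; exists D.
have [/existsP[K /existsP[K' /existsP[v /and5P[nK nK' sU dKK' /eqP iv]]]]|noShort] := boolP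
  [exists K : {set E}, exists K' : {set E}, exists v : V,
    [&& negcyc K, negcyc K', K :|: K' \subset H, [disjoint K & K'] &
        ends K :&: ends K' == [set v]]].
  have [cK oK] := andP nK; have [cK' oK'] := andP nK'.
  have [K0 eK _] := cycP _ cK; have [K0' eK' _] := cycP _ cK'.
  pose B := K :|: K'.
  have B0 : B != set0 by apply: contraNneq K0 => BE; rewrite -subset0 -BE subsetUl.
  have eB : even_set B by apply: even_setU.
  have oB : oddneg B = false by rewrite /B -symd_disjoint // oddneg_symd oK oK'.
  have [cs [Ds [csP DsP dDs sz [cov par]]]] := IH _ (smaller B sU B0) (even_setD sU eH eB).
  pose S := subgr_union (graph_of K) (graph_of K').
  exists (S :: cs), Ds; split=> //.
  - move=> C; rewrite inE => /orP[/eqP->|/csP//]; right; left.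
    exists (graph_of K), (graph_of K'); split=> //; try (split=> //; exact: cyc_is_cycle).
    exists v; rewrite /subgr_inter /= iv; congr (_, _).
    by apply/eqP; rewrite setI_eq0.
  - by move=> D /DsP[nD sD]; split=> //; apply: subset_trans sD (subsetDl _ _).
  - by rewrite big_cons -addnA sz cardD.
  split; last by rewrite par parD // oB addbF.
  move=> e eH'; have [eB'|eB'] := boolP (e \in B).
    by left; exists S; rewrite ?mem_head.
  have [|[C Cin eC]|[D Din eD]] := cov e; first by rewrite inE eB'.
    by left; exists C; rewrite ?inE ?Cin ?orbT.
  by right; exists D.
have [H0|H0] := eqVneq H set0.
  exists [::], [::]; split=> //; first by rewrite !big_nil H0 cards0.
  by split; [move=> e; rewrite H0 inE|rewrite H0 oddneg0].
have [K cK sK] := even_cyc eH H0; have [K0 eK _] := cycP _ cK.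
have oK : oddneg K.
  by apply: contraR noPos => oK; apply/existsP; exists K; rewrite cK oK.
have [cs [Ds [csP DsP dDs sz [cov par]]]] := IH _ (smaller K sK K0) (even_setD sK eH eK).
exists cs, (K :: Ds); split=> //.
- move=> D; rewrite inE => /orP[/eqP->|/DsP[nD sD]]; first by rewrite /negcyc cK.
  by split=> //; apply: subset_trans sD (subsetDl _ _).
- rewrite /= dDs andbT; apply/allP=> D /DsP[nD sD].
  have dKD : [disjoint K & D].
    by rewrite disjoint_sym; apply: disjointWl sD _; apply: disjointD.
  have sKD : K :|: D \subset H by rewrite subUset sK (subset_trans sD (subsetDl _ _)).
  rewrite /vdisj -setI_eq0; apply: contraT => /set0Pn[v vKD].
  case/existsP: noShort; exists K; apply/existsP; exists D; apply/existsP; exists v.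
  rewrite /negcyc cK oK -/(negcyc D) nD sKD dKD /= eqEsubset sub1set vKD andbT.
  apply/subsetP=> w wKD; rewrite inE; apply: contraT => nwv.
  have [vK vD] := setIP vKD; have [wK wD] := setIP wKD.
  have nK : negcyc K by rewrite /negcyc cK.
  have [L [cL oL sL]] := two_negcyc nK nD dKD nwv wK vK wD vD.
  by case/existsP: noPos; exists L; rewrite cL oL (subset_trans sL).
- by rewrite big_cons addnCA sz cardD.
split; last by rewrite /= par parD // oK addbT negbK.
move=> e eH'; have [eK'|eK'] := boolP (e \in K).
  by right; exists K; rewrite ?mem_head.
have [|[C Cin eC]|[D Din eD]] := cov e; first by rewrite inE eK'.
  by left; exists C.
by right; exists D; rewrite // inE Din orbT.
Qed.

Lemma size_walk_verts x s : size (walk_verts x s) = (size s).+1.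
Proof. by rewrite /walk_verts /= size_map. Qed.

Lemma card_set_of_seq (T : finType) (l : seq T) : uniq l -> #|[set z in l]| = size l.
Proof. by move=> ul; rewrite cardsE; apply/card_uniqP. Qed.

(** A path with fewest edges among those in W between the cycles is minimal in the sense of long
    barbells. The last clause holds because the path must cross every cut that separates the cycles;
    it is what gets bridges covered later. *)
Lemma barbell_join C1 C2 W x y : negcyc C1 -> negcyc C2 -> vdisj C1 C2 ->
  x \in ends C1 -> y \in ends C2 -> connect (adjE W) x y ->
  exists B : subgr G, [/\ signed_circuit B, C1 :|: C2 \subset edges B,
    #|edges B| <= #|C1| + #|C2| + #|W| &
    forall U e, cut U = [set e] ->
      (ends C1 \subset U) && [disjoint ends C2 & U] ||
      (ends C2 \subset U) && [disjoint ends C1 & U] -> e \in edges B].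
Proof.
move=> n1 n2 d12 xC yC cxy.
(* Tuples make the walks of length n a finite type, so that the predicate is decidable and a least
   length exists. *)
pose joined n := [exists t : n.-tuple (E * bool), exists u, [&& u \in ends C1, walk u t,
  uniq (walk_verts u t), last u (walk_verts u t) \in ends C2 & wedges t \subset W]].
have ex_joined : exists n, joined n.
  case/(@connect_walk _ (fun h => h.1 \in W)): cxy => s [ws ls us sW].
  exists (size s); apply/existsP; exists (in_tuple s); apply/existsP; exists x.
  rewrite xC ws us ls yC; apply/subsetP=> e; rewrite inE => /mapP[h hs ->].
  exact: (allP sW).
have [n /existsP[t /existsP[u /and5P[uC wt ut lt tW]]] minn] := ex_minnP ex_joined.
pose s : seq (half_edge G) := tval t.
have sz : size s = n by rewrite size_tuple.
pose P : subgr G := ([set v in walk_verts u s], wedges s).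
have isP : is_path u (last u (walk_verts u s)) P by exists s.
have vP : #|verts P| = n.+1 by rewrite card_set_of_seq // size_walk_verts sz.
have eP : #|edges P| = n.
  by rewrite card_set_of_seq ?size_map // ?sz //; apply: walk_uniq_edges ut.
have mP : minimal_joining_path (graph_of C1) (graph_of C2) P.
  split; first by exists u, (last u (walk_verts u s)).
  move=> Q [sV sE] [a [b [aC bC [r [wr ur lr QE]]]]].
  have ler : n <= size r.
    apply: minn; apply/existsP; exists (in_tuple r); apply/existsP; exists a.
    rewrite aC wr ur lr bC; apply: subset_trans tW; move: sE; rewrite QE /=.
    by [].
  have vQ : verts Q = verts P.
    by apply/eqP; rewrite eqEcard sV vP QE card_set_of_seq // size_walk_verts.
  have eQ : edges Q = edges P.
    apply/eqP; rewrite eqEcard sE eP QE card_set_of_seq ?size_map //.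
    exact: walk_uniq_edges ur.
  by rewrite (surjective_pairing Q) (surjective_pairing P); congr (_, _).
pose S := subgr_union (subgr_union (graph_of C1) (graph_of C2)) P.
have [c1 o1] := andP n1; have [c2 o2] := andP n2.
exists S; split.
- right; right; exists (graph_of C1), (graph_of C2), P; split=> //;
    try (split=> //; exact: cyc_is_cycle).
  rewrite /subgr_inter /=; congr (_, _); apply/eqP; first by rewrite setI_eq0.
  apply: contraT => /set0Pn[e /setIP[e1 e2]].
  by have := disjointFr d12 (mem_ends true e1); rewrite mem_ends.
- exact: subsetUl.
- apply: leq_trans (leq_card_setU _ _).1 _; apply: leq_add.
    exact: (leq_card_setU _ _).1.
  exact: subset_leq_card.
move=> U e cU; have cst : connect (adjE (wedges s)) u (last u (walk_verts u s)).
  by apply: walk_connect wt _; apply: walk_last.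
have ee e' : e' \in wedges s -> e' \in cut U -> e \in edges S.
  by rewrite cU inE => es /eqP <-; rewrite /S /= inE es orbT.
case/orP=> /andP[/subsetP sU dU].
  have lU : last u (walk_verts u s) \notin U by rewrite (disjointFr dU lt).
  by have [e' e's e'U] := connect_cut cst (sU _ uC) lU; apply: ee e'U.
have uU : u \notin U by rewrite (disjointFr dU uC).
rewrite connE_sym in cst.
by have [e' e's e'U] := connect_cut cst (sU _ lt) uU; apply: ee e'U.
Qed.

End SignedCircuits.

(** * Pairing negative cycles into barbells along a join *)

Section Linking.

Variable G : sgraph.
Local Notation V := (vertex G).
Local Notation E := (edge G).
Implicit Types (W J K H A P F D B Z : {set E}) (U X T : {set V}) (u v x y : V) (e : E)
  (h : half_edge G) (cs : seq (subgr G)).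

(* An item is a negative cycle together with an edge set joining it to a
   vertex; an item at x is what remains of a barbell cut at x. *)
Definition item : Type := ({set E} * {set E} * V)%type.
Implicit Types (i j : item) (I ls : seq item).

Definition icyc i : {set E} := i.1.1.
Definition ijoin i : {set E} := i.1.2.
Definition ipos i : V := i.2.

Definition is_item i : Prop :=
  negcyc (icyc i) /\ exists2 x, x \in ends (icyc i) & connect (adjE (ijoin i)) x (ipos i).

Definition icost i : nat := #|icyc i| + #|ijoin i|.

Definition idisj i j := vdisj (icyc i) (icyc j).

(** Positions come as a list because items may share a vertex; the boundary of a join sees them only
    mod 2. *)
Definition parity_set (l : seq V) : {set V} := [set v | odd (count_mem v l)].

Lemma parity_set_perm l l' : perm_eq l l' -> parity_set l = parity_set l'.
Proof. by move/permP=> p; apply/setP=> v; rewrite !inE p. Qed.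

Lemma parity_set_cons v l : parity_set (v :: l) = symd [set v] (parity_set l).
Proof. by apply/setP=> w; rewrite !inE /= oddD oddb eq_sym. Qed.

Lemma parity_set_cat l l' : parity_set (l ++ l') = symd (parity_set l) (parity_set l').
Proof. by apply/setP=> w; rewrite !inE count_cat oddD. Qed.

Lemma parity_set_nil : parity_set [::] = set0.
Proof. by apply/setP=> w; rewrite !inE. Qed.

Lemma mem_parity_set l v : v \in parity_set l -> v \in l.
Proof. by rewrite inE -has_pred1 has_count; case: count. Qed.

Lemma odd_parity_set l : odd #|parity_set l| = odd (size l).
Proof.
elim: l => [|v l IH]; first by rewrite parity_set_nil cards0.
by rewrite parity_set_cons odd_symd cards1 IH.
Qed.

(* i ends up in a circuit that contains every bridge separating its cycle from
   the cycles of the other items, or it is passed on. *)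
Definition served I cs ls i : Prop :=
  (exists B : subgr G, [/\ B \in cs, icyc i \subset edges B &
     forall U e, cut U = [set e] -> ends (icyc i) \subset U ->
       (forall j, j \in I -> icyc j != icyc i -> [disjoint ends (icyc j) & U]) ->
       e \in edges B]) \/
  (exists2 l, l \in ls & icyc l = icyc i).

Lemma barbell_items i j P : is_item i -> is_item j -> idisj i j ->
  connect (adjE P) (ipos i) (ipos j) ->
  exists B : subgr G, [/\ signed_circuit B, icyc i :|: icyc j \subset edges B,
    #|edges B| <= icost i + icost j + #|P| &
    forall U e, cut U = [set e] ->
      (ends (icyc i) \subset U) && [disjoint ends (icyc j) & U] ||
      (ends (icyc j) \subset U) && [disjoint ends (icyc i) & U] -> e \in edges B].
Proof.
move=> [ni [x xi cx]] [nj [y yj cy]] dij cP.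
pose W := ijoin i :|: P :|: ijoin j.
have cW : connect (adjE W) x y.
  apply: connect_trans (connE_sub _ cx) _; first by rewrite /W -setUA subsetUl.
  apply: connect_trans (connE_sub _ cP) _; first by rewrite /W setUAC subsetUr.
  by rewrite connE_sym; apply: connE_sub cy; rewrite subsetUr.
have [B [sB cB szB brB]] := barbell_join ni nj dij xi yj cW.
exists B; split=> //; apply: leq_trans szB _; rewrite /icost.
have l1 := (leq_card_setU (ijoin i :|: P) (ijoin j)).1.
have l2 := (leq_card_setU (ijoin i) P).1.
by move: l1 l2; rewrite -/W; clear; lia.
Qed.

Lemma cyc_neq i j : is_item i -> idisj i j -> icyc j != icyc i.
Proof.
move=> [/andP[ci _] _] dij; have [x xi] := cyc_ends ci.
by apply: contraTneq (xi) => E; rewrite (disjointFl dij) // E.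
Qed.

Let link_arith (a b c d e x y p q : nat) : a + b <= c + d -> e <= x + y + p -> d + p = q ->
  e + a + b <= x + (y + c) + q.
Proof. lia. Qed.

(** Each step removes from J a path P that starts at the first item. It ends at another item, which
    gives a barbell, or at the vertex in r, and then the item is passed on with P added to its
    join. *)
Lemma link I (r : seq V) J : (forall i, i \in I -> is_item i) -> pairwise idisj I ->
  size r <= 1 -> oddv J = parity_set (map ipos I ++ r) ->
  exists cs ls, [/\ forall B : subgr G, B \in cs -> signed_circuit B,
    forall l, l \in ls -> is_item l /\ exists2 i, i \in I & icyc l = icyc i,
    map ipos ls = r,
    \sum_(B <- cs) #|edges B| + \sum_(l <- ls) icost l <= \sum_(i <- I) icost i + #|J| &
    forall i, i \in I -> served I cs ls i].
Proof.
have [n] := ubnP (size I); elim: n I r J => // n IH [|i I] r J.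
  move=> _ _ _ sr oJ; have r0 : r = [::].
    have := even_oddv J; rewrite oJ /= odd_parity_set.
    by case: r sr {oJ} => [|? []].
  by exists [::], [::]; split; rewrite ?r0 //; rewrite !big_nil.
rewrite /= ltnS => leIn okI /andP[/allP dI pI] sr oJ.
have oki : is_item i by apply: okI; rewrite mem_head.
have okI' j : j \in I -> is_item j by move=> jI; apply: okI; rewrite inE jI orbT.
set p := ipos i in oJ *.
have [y [P [yin sP oP cP]]] : exists y P, [/\ y \in map ipos I ++ r, P \subset J,
    oddv P = symd [set p] [set y] & connect (adjE P) p y].
  (* Two terminals at one vertex cancel in [parity_set]; they are matched by the empty path. *)
  have [pin|pNin] := boolP (p \in map ipos I ++ r).
    by exists p, set0; rewrite pin sub0set oddv0 symdv.
  have podd : p \in oddv J.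
    rewrite oJ inE /= eqxx /= -[odd _]negbK; apply: contra pNin.
    by rewrite -has_pred1 has_count; case: count.
  have [y [P [nyp yJ sP oP cP]]] := oddv_path podd; exists y, P; split=> //.
  by move: yJ; rewrite oJ => /mem_parity_set; rewrite inE (negPf nyp).
have oJ' l : perm_eq (y :: l) (map ipos I ++ r) -> oddv (J :\: P) = parity_set l.
  move=> /parity_set_perm; rewrite parity_set_cons => El.
  rewrite -symd_subD // oddv_symd oJ oP parity_set_cons -El.
  by apply/setP=> w; rewrite !in_symd; do 3 case: (w \in _).
have szJ : #|J :\: P| + #|P| = #|J|.
  by rewrite addnC -(cardsID P J) (setIidPr sP).
have := yin; rewrite mem_cat => /orP[/mapP[j jI yj]|yr]; last first.
  have r1 : r = [:: y] by case: r sr yr {oJ yin oJ'} => [|a []] // _; rewrite inE => /eqP->.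
  have [|||||cs [ls [csP lsP lr sz srv]]] := IH I [::] (J :\: P) => //.
    by apply: oJ'; rewrite r1 cats0 cats1 -perm_rcons.
  have ls0 : ls = [::] by case: ls lr {lsP sz srv}.
  pose l0 : item := (icyc i, ijoin i :|: P, y).
  have okl0 : is_item l0.
    have [ni [x xi cx]] := oki; split=> //; exists x => //.
    apply: connect_trans (connE_sub (subsetUl _ _) cx) _.
    exact: connE_sub (subsetUr _ _) cP.
  exists cs, [:: l0]; split=> //.
  - by move=> l; rewrite inE => /eqP->; split=> //; exists i; rewrite ?mem_head.
  - rewrite big_cons big_nil big_cons; move: sz; rewrite ls0 big_nil.
    have : icost l0 <= icost i + #|P|.
      by rewrite /icost -addnA leq_add2l; apply: (leq_card_setU _ _).1.
    by move: szJ; clear; lia.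
  move=> j; rewrite inE => /orP[/eqP->|jI]; first by right; exists l0; rewrite ?mem_head.
  have [[B [Bin cB brB]]|[l lin _]] := srv j jI; last by rewrite ls0 in lin.
  left; exists B; split=> // U e cU sU dU; apply: brB cU sU _ => k kI.
  by apply: dU; rewrite inE kI orbT.
have dij : idisj i j by apply: dI.
have permI := perm_to_rem jI; set I' := rem j I in permI.
have pI' : pairwise idisj I' := subseq_pairwise (rem_subseq j I) pI.
have I'I k : k \in I' -> k \in I by move=> kI'; rewrite (perm_mem permI) inE kI' orbT.
have okj := okI' j jI.
have [|k /I'I/okI'||||cs [ls [csP lsP lr sz srv]]] := IH I' r (J :\: P) => //.
  by apply: leq_trans leIn; rewrite (perm_size permI) /=.
  apply: oJ'; rewrite yj -cat_cons; apply: perm_cat => //.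
  by rewrite perm_sym; apply: (perm_map ipos permI).
have cij : connect (adjE P) (ipos i) (ipos j) by rewrite -yj.
have [B [sB cB szB brB]] := barbell_items oki okj dij cij.
exists (B :: cs), ls; split=> //.
- by move=> C; rewrite inE => /orP[/eqP->|/csP].
- move=> l /lsP[okl [k kI' e]]; split=> //; exists k => //.
  by rewrite inE I'I // orbT.
- rewrite big_cons big_cons (perm_big _ permI) big_cons /=.
  exact: link_arith sz szB szJ.
have nji : icyc j != icyc i by apply: cyc_neq.
move=> k; rewrite inE => /orP[/eqP->|].
  left; exists B; split; rewrite ?mem_head //; first exact: subset_trans (subsetUl _ _) cB.
  move=> U e cU sU dU; apply: brB cU _.
  by rewrite sU (dU j) // inE jI orbT.
rewrite (perm_mem permI) inE => /orP[/eqP->|kI'].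
  left; exists B; split; rewrite ?mem_head //; first exact: subset_trans (subsetUr _ _) cB.
  move=> U e cU sU dU; apply: brB cU _.
  by rewrite sU (dU i) ?orbT ?mem_head // eq_sym.
have [[C [Cin cC brC]]|[l lin E0]] := srv k kI'; last by right; exists l.
left; exists C; split=> //; first by rewrite inE Cin orbT.
move=> U e cU sU dU; apply: brC cU sU _ => m mI'.
by apply: dU; rewrite inE I'I // orbT.
Qed.

End Linking.

(** * Contraction of disjoint cycles and joins that spare one of them *)

Section Quotient.

Variables (G : sgraph) (rho : vertex G -> vertex G).

(** The fibres of [rho] are contracted by moving end points only, so an edge set can be read in both
    graphs. *)
Definition quotient : sgraph :=
  @SGraph (vertex G) (edge G) (fun h => rho (endpt h)) (@negative G).

(** The image of a vertex set mod 2; boundaries follow this map under the contraction. *)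
Definition push (S : {set vertex G}) : {set vertex G} :=
  [set r | odd #|S :&: [set v | rho v == r]|].

Lemma cut_quotient r : @cut quotient [set r] = cut [set v | rho v == r].
Proof. by apply/setP=> e; rewrite !inE /crosses /= !inE. Qed.

Lemma oddv_quotient (W : {set edge G}) : @oddv quotient W = push (oddv W).
Proof.
by apply/setP=> r; rewrite inE (@bd_cut quotient) cut_quotient [RHS]inE odd_oddv.
Qed.

Lemma push_symd S S' : push (symd S S') = symd (push S) (push S').
Proof. by apply/setP=> r; rewrite !inE symdI odd_symd. Qed.

Lemma push_parity_set l : push (parity_set l) = parity_set (map rho l).
Proof.
elim: l => [|v l IH] /=.
  by rewrite !parity_set_nil; apply/setP=> r; rewrite !inE set0I cards0.
rewrite !parity_set_cons push_symd IH; congr symd; apply/setP=> r; rewrite !inE.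
have [e|ne] := eqVneq r (rho v).
  by rewrite (setIidPl _) ?cards1 // sub1set inE e.
rewrite (_ : _ :&: _ = set0) ?cards0 //; apply/setP=> w; rewrite !inE.
by case: eqP => //= ->; rewrite eq_sym (negPf ne).
Qed.

End Quotient.

Section Joins.

Variable G : sgraph.
Local Notation V := (vertex G).
Local Notation E := (edge G).
Implicit Types (W J K H A P F D B Z : {set E}) (U X T S : {set V}) (u v x y : V) (e : E)
  (h : half_edge G) (Ds L : seq {set E}).

Definition links_all A X := {in X &, forall x y, connect (adjE A) x y}.

Lemma linked_even A X T : links_all A X -> T \subset X -> ~~ odd #|T| ->
  forall x, ~~ odd #|T :&: component A x|.
Proof.
move=> lA sTX eT x; have [->|[t /setIP[tT tx]]] := set_0Vmem (T :&: component A x).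
  by rewrite cards0.
rewrite (setIidPl _) //; apply/subsetP=> w wT; rewrite inE in tx; rewrite inE.
exact: connect_trans tx (lA t w (subsetP sTX _ tT) (subsetP sTX _ wT)).
Qed.

Lemma cyc_bridgeless D : cyc D -> bridgeless D.
Proof. by move=> cD e eD; exists D; rewrite // (cyc_even cD). Qed.

Lemma sum_cycles A Ds : (forall D, D \in Ds -> D \subset A) -> pairwise (@vdisj G) Ds ->
  \sum_(D <- Ds) #|D| + #|[set e in A | all (fun D => e \notin D) Ds]| = #|A|.
Proof.
elim: Ds => [|D L IH] sA /=.
  move=> _; rewrite big_nil add0n; congr #|pred_of_set _|.
  by apply/setP=> e; rewrite !inE andbT.
case/andP=> /allP dD pL; rewrite big_cons -IH //; last first.
  by move=> K KL; apply: sA; rewrite inE KL orbT.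
set R := [set e in A | all _ L].
have -> : [set e in A | (e \notin D) && all (fun D0 => e \notin D0) L] = R :\: D.
  by apply/setP=> e; rewrite !inE andbCA.
have sDR : D \subset R.
  apply/subsetP=> e eD; rewrite inE (subsetP (sA D _)) ?mem_head //=; apply/allP=> K KL.
  apply/negP=> eK; have := disjointFr (dD K KL) (mem_ends true eD).
  by rewrite mem_ends.
by rewrite -(cardsID D R) (setIidPr sDR) addnCA addnA.
Qed.

(** In each D the points of S are paired up, except for one left over at p D, by at most half of D.
    On [Dx] there is only one point and nothing to add, which saves |Dx|. *)
Lemma fill_arcs Ds S (p : {set E} -> V) Dx :
  (forall D, D \in Ds -> cyc D) -> pairwise (@vdisj G) Ds ->
  (forall D, D \in Ds -> odd #|S :&: ends D| /\ p D \in S :&: ends D) ->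
  #|S :&: ends Dx| = 1 -> uniq Ds ->
  exists K, [/\ forall e, e \in K -> has (fun D => e \in D) Ds,
    oddv K = symd [set v in S | has (fun D => v \in ends D) Ds] (parity_set (map p Ds)) &
    2 * #|K| + (if Dx \in Ds then #|Dx| else 0) <= \sum_(D <- Ds) #|D|].
Proof.
elim: Ds => [|D L IH] cDs /=.
  exists set0; split; first by move=> e; rewrite inE.
    rewrite parity_set_nil symd0 oddv0; apply/setP=> v; by rewrite !inE andbF.
  by rewrite cards0 big_nil.
case/andP=> /allP dD pL pP S1 /andP[DL uL].
have [||K [KL oK szK]] := IH _ pL _ S1 uL.
- by move=> K KL; apply: cDs; rewrite inE KL orbT.
- by move=> K KL; apply: pP; rewrite inE KL orbT.
have cD : cyc D by apply: cDs; rewrite mem_head.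
have [oD pD] := pP D (mem_head _ _).
pose T := symd (S :&: ends D) [set p D].
have sT : T \subset ends D.
  by apply: symd_sub; rewrite ?subsetIr // sub1set; case/setIP: pD.
have eT : ~~ odd #|T| by rewrite odd_symd oD cards1.
have [C [sC oC szC]] := join_half (cyc_bridgeless cD) (linked_even (cyc_connect cD) sT eT).
have [C' [sC' oC' szC']] : exists C' : {set E}, [/\ C' \subset D, oddv C' = T &
    2 * #|C'| + (if Dx == D then #|Dx| else 0) <= #|D|].
  have [E1|_] := eqVneq Dx D; last by exists C; rewrite addn0.
  exists set0; rewrite sub0set oddv0 cards0 E1 leqnn; split=> //.
  move/eqP: S1; rewrite E1 => /cards1P[w Sw]; rewrite /T Sw.
  by move: pD; rewrite Sw inE => /eqP->; rewrite symdv.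
exists (symd K C'); split.
- move=> e; rewrite in_symd; case eC: (e \in C'); first by rewrite (subsetP sC' e eC).
  by rewrite addbF => /KL->; rewrite orbT.
- rewrite oddv_symd oK oC' parity_set_cons /T.
  have -> : [set v in S | (v \in ends D) || has (fun D0 => v \in ends D0) L] =
      symd [set v in S | has (fun D0 => v \in ends D0) L] (S :&: ends D).
    apply/setP=> v; rewrite !inE; case: (v \in S) => //=.
    case vD: (v \in ends D); rewrite /= ?addbF ?addbT //.
    apply/esym/hasPn=> K' K'L; apply/negP=> vK.
    by rewrite (disjointFr (dD K' K'L) vD) in vK.
  by apply/setP=> v; rewrite !in_symd; do 4 case: (v \in _).
rewrite big_cons inE; have := card_symdI K C'.
have or_le (a b : bool) n : (if a || b then n else 0) <=
    (if b then n else 0) + (if a then n else 0).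
  by case: a; case: b => //=; rewrite ?addn0 ?leq_addr.
move: (or_le (Dx == D) (Dx \in L) #|Dx|) szK szC'.
by move: (if _ then _ else _) (if _ then _ else _) (if _ then _ else _); clear; lia.
Qed.

Let sub_le_zero (j k : nat) : j <= j - k -> k <= j -> k = 0.
Proof. lia. Qed.

Let leaf_arith (j w s : nat) : j < w -> s <= 1 -> 2 * w <= 2 * j + s -> False.
Proof. lia. Qed.

(* Contract the cycles and take a smallest join there.  It is a forest, and
   since at most one of its leaves is not a contracted cycle, some cycle has
   degree at most one in it; there no arc is needed, while at any other cycle an
   arc of at most half its length reconnects the join. *)
Lemma cycle_join A X Ds (r : seq V) phi x0 : bridgeless A -> links_all A X -> x0 \in X ->
  (forall D, D \in Ds -> [/\ cyc D, D \subset A, ends D \subset X & phi <= #|D|]) ->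
  pairwise (@vdisj G) Ds -> (forall u, u \in r -> u \in X) -> size r <= 1 ->
  ~~ odd (size Ds + size r) -> phi <= #|A| ->
  exists p J, [/\ forall D, D \in Ds -> p D \in ends D, J \subset A,
    oddv J = parity_set (map p Ds ++ r) & 2 * #|J| + phi <= #|A|].
Proof.
move=> bA lA x0X DsP pDs rX szr ev phiA.
have [Ds0|[D0 D0in]] : Ds = [::] \/ exists D, D \in Ds.
  by case: (Ds) => [|D L]; [left|right; exists D; rewrite mem_head].
  have r0 : r = [::] by move: ev szr; rewrite Ds0; case: (r) => [|a []].
  exists (fun=> x0), set0; rewrite Ds0 r0 sub0set oddv0 cards0 /= parity_set_nil.
  by split.
have cDs D : D \in Ds -> cyc D by case/DsP.
pose pt D := odflt x0 [pick v in ends D].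
have ptD D : D \in Ds -> pt D \in ends D.
  move=> /cDs/cyc_ends[v vD]; rewrite /pt; case: pickP => [//|/(_ v)].
  by rewrite vD.
pose blk v := nth set0 Ds (find (fun D => v \in ends D) Ds).
(* Each cycle is contracted to its vertex [pt D]; all other vertices stay. *)
pose rho v := if has (fun D => v \in ends D) Ds then pt (blk v) else v.
have blkP v : has (fun D => v \in ends D) Ds -> blk v \in Ds /\ v \in ends (blk v).
  by move=> hv; split; [rewrite mem_nth -?has_find|apply: (nth_find set0 hv)].
have dis D D' v : D \in Ds -> D' \in Ds -> v \in ends D -> v \in ends D' -> D = D'.
  move=> DI D'I vD vD'; have symP : symmetric (@vdisj G).
    by move=> a b; rewrite /vdisj disjoint_sym.
  elim: (Ds) pDs DI D'I => //= K L IH /andP[/allP dK pL].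
  rewrite !inE => /orP[/eqP EK|DL] /orP[/eqP EK'|D'L].
  - by rewrite EK EK'.
  - by have := disjointFr (dK _ D'L); rewrite -EK => /(_ _ vD); rewrite vD'.
  - by have := disjointFr (dK _ DL); rewrite -EK' => /(_ _ vD'); rewrite vD.
  exact: IH.
have hasD D v : D \in Ds -> v \in ends D -> has (fun D => v \in ends D) Ds.
  by move=> DI vD; apply/hasP; exists D.
have rhoD D v : D \in Ds -> v \in ends D -> rho v = pt D.
  move=> DI vD; have hv := hasD D v DI vD; rewrite /rho hv.
  by have [bI vb] := blkP v hv; rewrite (dis _ _ _ bI DI vb vD).
have rhoN v : ~~ has (fun D => v \in ends D) Ds -> rho v = v.
  by rewrite /rho => /negPf->.
have preD D : D \in Ds -> [set v | rho v == pt D] = ends D.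
  move=> DI; apply/setP=> v; rewrite inE; apply/eqP/idP=> [e|]; last exact: rhoD.
  have [hv|hv] := boolP (has (fun D => v \in ends D) Ds).
    have [bI vb] := blkP v hv; rewrite (rhoD _ _ bI vb) in e.
    by rewrite (dis D _ (pt D) DI bI) ?ptD // -e ptD.
  by rewrite -(rhoN v hv) e ptD.
have preN v : ~~ has (fun D => v \in ends D) Ds -> [set w | rho w == v] = [set v].
  move=> hv; apply/setP=> w; rewrite !inE; apply/eqP/eqP=> [e|->]; last exact: rhoN.
  have [hw|hw] := boolP (has (fun D => w \in ends D) Ds); last by rewrite -(rhoN w hw).
  have [bI wb] := blkP w hw; rewrite (rhoD _ _ bI wb) in e.
  by case/negP: hv; rewrite -e; exact: hasD _ _ bI (ptD _ bI).
have rhopt : map rho (map pt Ds) = map pt Ds.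
  by rewrite -map_comp; apply/eq_in_map=> D DI /=; exact: rhoD _ _ DI (ptD D DI).
have uDs : uniq Ds.
  rewrite uniq_pairwise; apply: (@sub_in_pairwise _ (mem Ds) _ _ _ _ (allss Ds) pDs).
  move=> D D' DI D'I /=; apply: contraTneq => <-; rewrite /vdisj.
  have [v vD] := cyc_ends (cDs D DI).
  by apply/negP=> dD; have := disjointFr dD vD; rewrite vD.
have upt : uniq (map pt Ds).
  rewrite map_inj_in_uniq // => D D' DI D'I e; apply: (dis D D' (pt D)) => //.
    exact: ptD.
  by rewrite e ptD.
pose Gq := quotient rho.
pose A' := [set e in A | all (fun D => e \notin D) Ds].
have sA' : A' \subset A by apply/subsetP=> e; rewrite inE => /andP[].
pose Tq := parity_set (map rho (map pt Ds ++ r)).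
(* Edges on the cycles are loops in the quotient and do not contribute to boundaries there. *)
have restr W : W \subset A -> @oddv Gq (W :&: A') = @oddv Gq W.
  move=> sW; apply/setP=> z; rewrite !inE !(@bd_cut Gq); congr (odd #|pred_of_set _|).
  apply/setP=> e; rewrite !in_setI -andbA; case eW: (e \in W) => //=.
  rewrite inE (subsetP sW e eW) /=; case: (boolP (all _ Ds)) => //= /allPn[D DI].
  rewrite negbK => eD; rewrite inE /crosses /= !inE.
  by rewrite (rhoD D _ DI (mem_ends false eD)) (rhoD D _ DI (mem_ends true eD)) addbb.
have Tsub : parity_set (map pt Ds ++ r) \subset X.
  apply/subsetP=> v /mem_parity_set; rewrite mem_cat => /orP[/mapP[D DI ->]|/rX//].
  by have [_ _ sX _] := DsP D DI; apply: (subsetP sX); apply: ptD.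
have Tev : ~~ odd #|parity_set (map pt Ds ++ r)|.
  by rewrite odd_parity_set size_cat size_map.
have [J0 sJ0 oJ0] := join_exists (linked_even lA Tsub Tev).
pose F := [set J : {set edge Gq} | (J \subset A') && (@oddv Gq J == Tq)].
have oq W : @oddv Gq W = push rho (oddv W) by apply: oddv_quotient.
have J0F : (J0 :&: A') \in F.
  by rewrite inE subsetIr restr // oq oJ0 push_parity_set eqxx.
have [J1 J1F szJ1] : exists2 J, J \in F & 2 * #|J| <= #|A'|.
  have [e eA'|J JF sz] := @average Gq F A' _ J0F; last first.
    exists J => //; move: (JF); rewrite inE => /andP[sJ _]; by rewrite -{1}(setIidPl sJ).
  have [C sC /andP[eC eiC]] := bA e (subsetP sA' e eA').
  exists (C :&: A') => [|J]; first by rewrite inE eiC.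
  rewrite !inE => /andP[sJ /eqP oJ]; rewrite symd_sub ?subsetIr //=.
  rewrite (@oddv_symd Gq) oJ restr // oq (eqP eC).
  have -> : push rho set0 = set0.
    by rewrite -[set0 in LHS](@parity_set_nil G) push_parity_set parity_set_nil.
  by rewrite symd0.
pose J2 : {set E} := [arg min_(J < J1 | J \in F) #|J|].
have [J2F minJ2] : J2 \in F /\ forall J, J \in F -> #|J2| <= #|J|.
  by rewrite /J2; case: arg_minnP.
have szJ2 : 2 * #|J2| <= #|A'| by apply: leq_trans szJ1; rewrite leq_mul2l; apply: minJ2.
have [sJ2 oJ2] : J2 \subset A' /\ @oddv Gq J2 = Tq.
  by move: J2F; rewrite inE => /andP[-> /eqP->].
have acJ2 : @acyclic Gq J2.
  move=> K sK eK; have : symd J2 K \in F.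
    rewrite inE symd_sub ?(subset_trans sK) //= (@oddv_symd Gq) oJ2 (eqP eK).
    by rewrite symd0.
  move/minJ2; rewrite symd_subD // cardsDS // => le; apply/eqP; rewrite -cards_eq0.
  by apply/eqP; apply: sub_le_zero le (subset_leq_card sK).
have [Dx DxI degx] : exists2 D, D \in Ds & @deg Gq J2 (pt D) <= 1.
  have [J20|[e eJ2]] := set_0Vmem J2.
    exists D0 => //; rewrite leqNgt; apply/negP=> /ltnW; rewrite deg_gt0.
    by case/endsP=> h; rewrite J20 inE.
  apply/hasP; apply: contraT => /hasPn big.
  pose W := @ends Gq J2.
  have lt := @acyclic_card Gq J2 W _ acJ2 (subxx _) (@mem_ends Gq J2 e true eJ2).
  have sumW := @sum_deg Gq J2 W (subxx _).
  (* A leaf of the forest is a terminal. If every cycle had degree at least 2, only the one point of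
     r could be a leaf, and the degree sum would be too large for a forest. *)
  have : 2 * #|W| <= \sum_(w in W) (@deg Gq J2 w + (w \in map rho r)).
    rewrite -sum1_card big_distrr /=; apply: leq_sum => w wW; rewrite muln1.
    have : 0 < @deg Gq J2 w by rewrite deg_gt0.
    case E1: (@deg Gq J2 w) => [|[|d]] // _.
    rewrite addSn add0n ltnS lt0b.
    have : w \in @oddv Gq J2 by rewrite -(@odd_deg Gq) E1.
    rewrite oJ2 => /mem_parity_set; rewrite map_cat mem_cat rhopt.
    case/orP=> // /mapP[D DI wD]; have := big D DI.
    by rewrite -wD E1.
  rewrite big_split /= sumW.
  have : \sum_(w in W) (w \in map rho r : nat) <= 1.
    rewrite -big_mkcondr /= sum1_card; apply: leq_trans szr; rewrite -(size_map rho).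
    apply: leq_trans (card_size _); apply: subset_leq_card.
    by apply/subsetP=> w /andP[].
  by move=> le1 le2; case: (leaf_arith lt le1 le2).
(* The terminals left open by the forest when it is read in G: an odd number on each cycle and none
   elsewhere. *)
pose S := symd (@oddv G J2) (parity_set r).
have pushS : push rho S = parity_set (map pt Ds).
  rewrite push_symd -oq oJ2 push_parity_set /Tq map_cat rhopt parity_set_cat.
  by rewrite symdK.
have SD D : D \in Ds -> odd #|S :&: ends D|.
  move=> DI; rewrite -(preD D DI).
  have -> : odd #|S :&: [set v | rho v == pt D]| = (pt D \in push rho S) by rewrite inE.
  by rewrite pushS inE count_uniq_mem // map_f.
have SN v : v \in S -> has (fun D => v \in ends D) Ds.
  apply: contraTT => hv; have : v \notin push rho S.
    rewrite pushS; apply/negP=> /mem_parity_set/mapP[D DI vD].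
    by case/negP: hv; rewrite vD; exact: hasD _ _ DI (ptD D DI).
  rewrite inE preN //; apply: contra => vS.
  by rewrite (setIidPr _) ?cards1 ?sub1set.
(* At most one odd vertex of the forest lies on [Dx], and r adds at most one; the number is odd,
   hence 1. *)
have Sx : #|S :&: ends Dx| = 1.
  have le1 : #|@oddv G J2 :&: ends Dx| <= 1.
    apply: leq_trans degx; rewrite -(preD Dx DxI) -sum1_card.
    have -> : @deg Gq J2 (pt Dx) = \sum_(v in [set v | rho v == pt Dx]) @deg G J2 v.
      rewrite /deg -sum1_card (partition_big (fun h => endpt h) (mem [set v | rho v == pt Dx])) /=.
        apply: eq_bigr => v; rewrite inE => vx; rewrite -sum1_card; apply: eq_bigl => h.
        rewrite !inE -andbA; congr (_ && _); case: (eqVneq (endpt h) v) => [->|]; rewrite ?andbF //.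
        by rewrite vx.
      by move=> h; rewrite !inE => /andP[].
    rewrite big_mkcond [X in _ <= X]big_mkcond /=; apply: leq_sum => v _.
    rewrite in_setI; case: (v \in [set v | _]); rewrite ?andbF // andbT.
    by case: ifP => // vJ; rewrite deg_gt0; apply: (subsetP (@oddv_ends G J2)).
  have le2 : #|S :&: ends Dx| <= #|@oddv G J2 :&: ends Dx| + #|parity_set r :&: ends Dx|.
    by rewrite /S symdI -card_symdI leq_addr.
  have le3 : #|parity_set r :&: ends Dx| <= 1.
    apply: leq_trans szr; apply: leq_trans (card_size r); apply: subset_leq_card.
    by apply/subsetP=> v /setIP[/mem_parity_set].
  move: (SD Dx DxI) le1 le2 le3; case: #|S :&: _| => [|[|[|k]]] //; clear; lia.
pose p D := odflt x0 [pick v in S :&: ends D].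
have pP D : D \in Ds -> odd #|S :&: ends D| /\ p D \in S :&: ends D.
  move=> DI; have oD := SD D DI; split=> //; rewrite /p; case: pickP => [//|no].
  by move: oD; rewrite (eq_card0 no).
have [K [KDs oK szK]] := fill_arcs cDs pDs pP Sx uDs.
have sK : K \subset A.
  by apply/subsetP=> e /KDs/hasP[D DI eD]; have [_ sD _ _] := DsP D DI; apply: (subsetP sD).
exists p, (symd J2 K); split.
- by move=> D /pP[_ /setIP[]].
- by apply: symd_sub => //; apply: subset_trans sJ2 sA'.
- rewrite oddv_symd oK parity_set_cat.
  have -> : [set v in S | has (fun D => v \in ends D) Ds] = S.
    by apply/setP=> v; rewrite inE; case vS: (v \in S) => //=; rewrite SN.
  by apply/setP=> v; rewrite !in_symd; do 3 case: (v \in _).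
have [_ _ _ phix] := DsP Dx DxI.
have sumA := sum_cycles (fun D DI => let: And4 _ s _ _ := DsP D DI in s) pDs.
have := card_symdI J2 K; move: szK; rewrite DxI.
by move: sumA szJ2 phix; rewrite -/A'; clear; lia.
Qed.

End Joins.

(** * The edges outside Ghat *)

Section Secondary.

Variables (G : sgraph) (N : {set edge G}).
Local Notation V := (vertex G).
Local Notation E := (edge G).
Implicit Types (A W J K H P F D M S : {set E}) (U X Y T Z : {set V}) (r p u v x y : V) (e : E)
  (h : half_edge G) (B : subgr G) (cs : seq (subgr G)) (Ds : seq {set E}) (i j l : item G)
  (I ls : seq (item G)) (f k : nat).

(** The three facts about a smallest switched set of negative edges on which the section rests; they
    come from [switched_parity], [switched_min] and [switched_support]. *)
Hypothesis N_parity : forall C : {set E}, even_set C -> odd #|C :&: N| = oddneg C.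
Hypothesis N_min : forall U, 2 * #|N :&: cut U| <= #|cut U|.
Hypothesis N_support : forall T e, cut T :|: (N :&: inner T) != [set e].

Lemma N_side U e : cut U = [set e] -> N :&: inner U != set0.
Proof.
by move=> cU; apply: contraNneq (N_support U e) => N0; rewrite cU N0 setU0.
Qed.

Definition Ghat : {set E} :=
  [set e | [exists C : {set E}, [&& even_set C, C \subset ~: N & e \in C]]].

(** Twice the allowed cost, which is 3/2 for an edge of [Ghat] and 3 for any other edge. The bounds
    k below also refer to twice a length. *)
Definition wt S : nat := 3 * #|S :&: Ghat| + 6 * #|S :\: Ghat|.

Lemma wt_setU S S' : [disjoint S & S'] -> wt (S :|: S') = wt S + wt S'.
Proof.
move=> dS; rewrite /wt setIUl setDUl.
have d1 : [disjoint S :&: Ghat & S' :&: Ghat].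
  by apply: disjointWl (subsetIl _ _) _; apply: disjointWr (subsetIl _ _) dS.
have d2 : [disjoint S :\: Ghat & S' :\: Ghat].
  by apply: disjointWl (subsetDl _ _) _; apply: disjointWr (subsetDl _ _) dS.
rewrite !cardsU (disjoint_setI0 d1) (disjoint_setI0 d2) cards0 !subn0.
by clear; lia.
Qed.

Lemma wt_sub S S' : S \subset S' -> wt S <= wt S'.
Proof.
move=> sS; rewrite /wt leq_add // leq_mul2l /= subset_leq_card //.
  exact: setSI.
exact: setSD.
Qed.

Lemma bridge_notin_Ghat U e : cut U = [set e] -> e \notin Ghat.
Proof.
move=> cU; rewrite inE; apply/existsPn=> C; apply/negP=> /and3P[eC _ eiC].
have := even_cut U eC; rewrite cU (setIidPr _) ?cards1 // sub1set //.
Qed.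

Lemma wt_bridge U e : cut U = [set e] -> wt [set e] = 6.
Proof.
move=> cU; have dG : [disjoint [set e] & Ghat] by rewrite disjoints1 (bridge_notin_Ghat cU).
by rewrite /wt (disjoint_setI0 dG) (setDidPl dG) cards0 cards1.
Qed.

(** A connected piece without bridges. The last clause extends each cut of the piece to a cut of G,
    which makes [N_min] available inside it. *)
Definition block X := [/\ links_all (inner X) X,
  forall U e, inner X :&: cut U != [set e] &
  forall U, U \subset X -> exists U', cut U' = inner X :&: cut U].

Section Block.

Variable X : {set V}.
Hypothesis blockX : block X.
Let A := inner X.

Lemma block_bridgeless : bridgeless A.
Proof. by case: blockX => _ b2 _; apply: bridgelessP. Qed.

Lemma block_ext U : exists U', cut U' = A :&: cut U.
Proof.
case: blockX => _ _ /(_ (U :&: X) (subsetIr _ _))[U' cU']; exists U'.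
rewrite cU'; apply/setP=> e; rewrite !inE /crosses !inE.
by case: (_ \in X) => //; case: (_ \in X); rewrite ?andbT ?andbF.
Qed.

Lemma block_min U : 2 * #|N :&: (A :&: cut U)| <= #|A :&: cut U|.
Proof. by have [U' <-] := block_ext U; apply: N_min. Qed.

(** Otherwise some nonempty cut of the piece would consist of edges of N only. *)
Lemma block_pos_links : links_all (A :\: N) X.
Proof.
move=> x y xX yX; apply: contraT => nc.
have [b1 _ _] := blockX; pose U := component (A :\: N) x.
have xU : x \in U by apply: component_refl.
have yU : y \notin U by rewrite inE.
have [e eA eU] := connect_cut (b1 x y xX yX) xU yU.
have cU : A :&: cut U \subset N.
  apply/subsetP=> e' /setIP[eA' eU']; apply: contraT => eN.
  have := in_set0 e'; rewrite -(component_cut (A :\: N) x) -/U.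
  by rewrite in_setI eU' in_setD eN eA'.
have := block_min U; rewrite (setIidPr cU).
have : 0 < #|A :&: cut U| by apply/card_gt0P; exists e; rewrite inE eA.
by clear; lia.
Qed.

(** Such an e is a bridge of A without N, so some cut of A has e as its only edge outside N. At most
    half of this cut lies in N, and it has more than one edge, so it consists of e and some n in
    N. *)
Lemma block_partner e : e \in A -> e \notin N ->
  ~~ [exists C : {set E}, [&& even_set C, C \subset A :\: N & e \in C]] ->
  exists U n, [/\ n \in N, n \in A, e != n & cut U = [set e; n]].
Proof.
move=> eA eN noC.
have [U cU] : exists U, (A :\: N) :&: cut U = [set e].
  pose B := (A :\: N) :\ e; pose x := endpt (e, false).
  have nc : ~~ connect (adjE B) x (endpt (e, true)).
    apply/negP=> c; have [P [sP oP _]] := path_set c.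
    have eP : e \notin P by apply/negP=> /(subsetP sP); rewrite !inE eqxx.
    case/existsP: noC; exists (e |: P); rewrite setU11 andbT.
    rewrite subUset sub1set inE eN eA (subset_trans sP) ?subsetDl // andbT.
    rewrite /even_set -symd_disjoint ?disjoints1 //.
    by rewrite oddv_symd oddv_edge oP symdv eqxx.
  exists (component B x); apply/setP=> e'; rewrite in_set1.
  have [->|ne] := eqVneq e' e.
    rewrite in_setI in_setD eN eA /= inE /crosses -/x component_refl.
    by rewrite inE (negPf nc).
  have := in_set0 e'; rewrite -(component_cut B x) in_setI [e' \in B]inE.
  by rewrite in_set1 ne in_setI.
have [U' cU'] := block_ext U.
have ecut : e \in A :&: cut U.
  by have := set11 e; rewrite -cU !inE => /andP[/andP[_ ->] ->].
have eqD : (A :&: cut U) :\: N = [set e].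
  by rewrite -cU; apply/setP=> e'; rewrite !inE andbA.
have c2 : #|N :&: (A :&: cut U)| <= 1.
  have := cardsID N (A :&: cut U); rewrite eqD cards1 setIC => E1.
  by have := block_min U; move: E1; clear; lia.
have [n nI] : exists n, n \in N :&: (A :&: cut U).
  apply/set0Pn; apply: contraT; rewrite negbK => /eqP I0.
  have [_ b2 _] := blockX; case/eqP: (b2 U e).
  by rewrite -eqD; apply/esym/setDidPl; rewrite -setI_eq0 setIC I0.
have [nN /setIP[nA nU]] := setIP nI.
exists U', n; split=> //; first by apply: contraNneq eN => ->.
rewrite cU' -(setID (A :&: cut U) N) eqD setUC; congr (_ :|: _).
apply/eqP; rewrite eq_sym eqEcard sub1set cards1 setIC nI /=.
by rewrite setIC in c2 *.
Qed.

(** Membership in [Ghat] has a witness somewhere in G. If none lay in A, the 2-cut formed by e and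
    some n in N would meet the given witness in e alone. *)
Lemma Ghat_block e : e \in A -> e \in Ghat ->
  exists C : {set E}, [&& even_set C, C \subset A :\: N & e \in C].
Proof.
move=> eA eG; apply/existsP; apply: contraT => noC.
move: eG; rewrite inE => /existsP[C /and3P[eC sC eiC]].
have eN : e \notin N by have := subsetP sC e eiC; rewrite inE.
have [U [n [nN nA nen cU]]] := block_partner eA eN noC.
have := even_cut U eC; suff -> : C :&: cut U = [set e] by rewrite cards1.
rewrite cU; apply/setP=> e'; rewrite !inE.
have [->|_] := eqVneq e' e; first by rewrite eiC.
case: eqP => [->|_]; rewrite ?andbF //.
by apply/negbTE; rewrite andbT; apply/negP=> /(subsetP sC); rewrite inE nN.
Qed.

Lemma even_partner e : e \in A -> e \notin N -> e \notin Ghat ->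
  exists2 n, n \in N :&: A & forall C : {set E}, even_set C -> n \in C -> e \in C.
Proof.
move=> eA eN eG; have [|U [n [nN nA nen cU]]] := block_partner eA eN.
  apply: contra eG => /existsP[C /and3P[eC sC eiC]]; rewrite inE; apply/existsP; exists C.
  by rewrite eC eiC andbT; apply: subset_trans sC _; rewrite setDE subsetIr.
exists n => [|C eC nC]; first by rewrite inE nN.
have := even_cut U eC; rewrite cU; apply: contraNT => eC'.
suff -> : C :&: [set e; n] = [set n] by rewrite cards1.
apply/setP=> e'; rewrite !inE; have [->|] := eqVneq e' n; first by rewrite nC orbT.
by have [->|_] := eqVneq e' e; rewrite ?andbF // (negPf eC').
Qed.

(** Adding an even set that avoids N keeps the trace M on N, so averaging over all candidates halves
    the use of [Ghat]. *)
Lemma even_through M : M \subset N :&: A -> exists H, [/\ even_set H, H \subset A,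
  H :&: N = M & 2 * #|H| <= #|A :&: Ghat| + 2 * #|A :\: Ghat|].
Proof.
move=> sM; have [sMN sMA] : M \subset N /\ M \subset A.
  by split; apply: subset_trans sM _; rewrite ?subsetIl ?subsetIr.
have Todd : oddv M \subset X.
  by apply: subset_trans (oddv_ends M) _; rewrite ends_inner.
have [J sJ oJ] := join_exists (linked_even block_pos_links Todd (even_oddv M)).
pose F := [set H : {set E} | [&& even_set H, H \subset A & H :&: N == M]].
have JF : symd M J \in F.
  have [sJA sJN] : J \subset A /\ J :&: N = set0.
    split; first by apply: subset_trans sJ (subsetDl _ _).
    by apply/eqP; rewrite setI_eq0; apply: disjointWl sJ _; rewrite disjointD.
  rewrite inE /even_set oddv_symd oJ symdv eqxx symd_sub //=.
  by rewrite symdI sJN symd0 (setIidPl sMN).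
case: (@average G F (A :&: Ghat) _ JF) => [e /setIP[eA eG]|H].
  have [C /and3P[eC sC eiC]] := Ghat_block eA eG; exists C => // H.
  rewrite !inE => /and3P[eH sH /eqP HN]; rewrite even_symd //= symd_sub //=; last first.
    by apply: subset_trans sC (subsetDl _ _).
  rewrite symdI HN (_ : C :&: N = set0) ?symd0 //.
  by apply/eqP; rewrite setI_eq0; apply: disjointWl sC _; rewrite disjointD.
rewrite inE => /and3P[evH sH /eqP HN] sz; exists H; split=> //.
rewrite -(cardsID (A :&: Ghat) H) mulnDr; apply: leq_add => //.
rewrite leq_mul2l /=; apply: subset_leq_card; apply/subsetP=> e.
rewrite !(in_setI, in_setD) negb_and => /andP[nG eH].
by move: nG; rewrite (subsetP sH e eH) /= ?andbT => ->.
Qed.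

End Block.

(* An item with a vertex set that is kept free of the cycles of other items. *)
Definition homed : Type := ({set V} * item G)%type.
Implicit Types (a b : homed) (L : seq homed).

Definition homes_ok T L : Prop :=
  (forall a, a \in L -> [/\ is_item a.2, ends (icyc a.2) \subset a.1 & a.1 \subset T]) /\
  pairwise (fun a b => [disjoint a.1 & b.1]) L.

(* e lies on the cycle of an item, or it is a bridge that any circuit leading
   from that cycle to the root r uses. *)
Definition pending r L e : Prop := exists2 a, a \in L & e \in icyc a.2 \/
  exists U, [/\ cut U = [set e], U \subset a.1, r \notin U & ends (icyc a.2) \subset U].

(** The counterpart of [pending] after linking: e is covered, or its cover is left to an item that
    is passed on to r. *)
Definition settled T r cs ls e : Prop :=
  (exists2 B, B \in cs & e \in edges B) \/
  exists2 l, l \in ls & e \in icyc l \/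
  exists U, [/\ cut U = [set e], U \subset T, r \notin U & ends (icyc l) \subset U].

Lemma pairwise_in (Q : eqType) (R : rel Q) (s : seq Q) (x y : Q) : symmetric R ->
  pairwise R s -> x \in s -> y \in s -> x != y -> R x y.
Proof.
move=> symR; elim: s => //= z s IH /andP[/allP Rz pR].
rewrite !inE => /predU1P[->|xs] /predU1P[->|ys]; rewrite ?eqxx // => nxy.
- exact: Rz.
- by rewrite symR; apply: Rz.
exact: IH.
Qed.

Lemma homes_idisj T L : homes_ok T L -> pairwise (@idisj G) (map snd L).
Proof.
case=> okL pL; rewrite pairwise_map.
apply: (sub_in_pairwise _ (allss L) pL) => a b aL bL /= dab.
have [[_ sa _] [_ sb _]] := (okL a aL, okL b bL).
by apply: disjointWl sa _; apply: disjointWr sb dab.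
Qed.

Lemma link_homes T r L (rr : seq V) J : homes_ok T L -> size rr <= 1 ->
  oddv J = parity_set (map (fun a => ipos a.2) L ++ rr) -> exists cs ls,
  [/\ forall B, B \in cs -> signed_circuit B,
      forall l, l \in ls -> is_item l /\ ends (icyc l) \subset T,
      map (@ipos G) ls = rr,
      \sum_(B <- cs) #|edges B| + \sum_(l <- ls) icost l <=
        \sum_(a <- L) icost a.2 + #|J| &
      forall e, pending r L e -> settled T r cs ls e].
Proof.
move=> okL szr oJ; have [okI pL] := okL.
have [|||cs [ls [csP lsP lr sz srv]]] := @link G (map snd L) rr J _ _ szr.
- by move=> _ /mapP[a aL ->]; case: (okI a aL).
- exact: homes_idisj okL.
- by rewrite -map_comp.
exists cs, ls; split=> //.
- move=> l /lsP[okl [_ /mapP[a aL ->] ->]]; split=> //.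
  by case: (okI a aL) => _ s1 s2; apply: subset_trans s1 s2.
- by move: sz; rewrite big_map.
move=> e [a aL ae]; have [oka sa saT] := okI a aL.
have [[B [Bin cB brB]]|[l lin cl]] := srv a.2 (map_f snd aL).
  left; exists B => //; case: ae => [ea|[U [cU sU rU eU]]]; first exact: subsetP cB e ea.
  apply: brB cU eU _ => _ /mapP[b bL ->] nab; have [_ sb _] := okI b bL.
  have dab : [disjoint b.1 & a.1].
    apply: (@pairwise_in _ (fun c d : homed => [disjoint c.1 & d.1]) L) => //.
      by move=> c d; rewrite disjoint_sym.
    by apply: contraNneq nab => ->.
  by apply: disjointWl sb _; apply: disjointWr sU dab.
right; exists l => //; rewrite cl; case: ae => [|[U [cU sU rU eU]]]; [by left|right].
by exists U; split=> //; apply: subset_trans sU saT.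
Qed.

Lemma settled_mono T T' r cs cs' ls ls' e : T \subset T' -> {subset cs <= cs'} ->
  {subset ls <= ls'} -> settled T r cs ls e -> settled T' r cs' ls' e.
Proof.
move=> sT scs sls [[B Bin eB]|[l lin [el|[U [cU sU rU eU]]]]].
- by left; exists B; first exact: scs.
- by right; exists l; [exact: sls | left].
right; exists l; [exact: sls | right; exists U; split=> //].
exact: subset_trans sU sT.
Qed.

(* Both values of f are needed: the parity of a join decides whether a piece is
   used once or twice. *)
Definition rooted T S k r : Prop := forall f, 0 < f <= 2 -> exists cs ls,
  [/\ forall B, B \in cs -> signed_circuit B,
      forall l, l \in ls -> is_item l /\ ends (icyc l) \subset T,
      map (@ipos G) ls = nseq f r,
      2 * (\sum_(B <- cs) #|edges B| + \sum_(l <- ls) icost l) <= k &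
      forall e, e \in S -> e \notin Ghat -> settled T r cs ls e].

Lemma rooted_mono T T' S S' k k' r : T \subset T' -> S' \subset S -> k <= k' ->
  rooted T S k r -> rooted T' S' k' r.
Proof.
move=> sT sS lek rT f fP; have [cs [ls [csP lsP lr sz cov]]] := rT f fP.
exists cs, ls; split=> //.
- by move=> l /lsP[okl sl]; split=> //; apply: subset_trans sl sT.
- exact: leq_trans sz lek.
by move=> e eS eG; apply: settled_mono (cov e (subsetP sS e eS) eG).
Qed.

Let bridge_arith (a b c f k : nat) : f <= 2 -> 2 * (a + b) <= k -> c <= b + f ->
  2 * (a + c) <= k + 6.
Proof. lia. Qed.

(** At most two items cross the bridge, one more edge for each, which the weight 6 allows. The
    bridge itself is settled through the cut of Y. *)
Lemma rooted_bridge Y S k h : cut Y = [set h.1] -> endpt h \in Y ->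
  endpt (opp_half h) \notin Y -> rooted Y S k (endpt h) ->
  rooted Y (h.1 |: S) (k + 6) (endpt (opp_half h)).
Proof.
set u := endpt h; set p := endpt (opp_half h) => cY uY pY rT f fP.
have [cs [ls [csP lsP lr sz cov]]] := rT f fP.
pose ext l : item G := (icyc l, h.1 |: ijoin l, p).
exists cs, (map ext ls); split=> //.
- move=> _ /mapP[l lin ->]; have [[nl [x xl cx]] sl] := lsP l lin.
  split=> //; split=> //; exists x => //.
  have lu : ipos l = u.
    have : ipos l \in nseq f u by rewrite -lr map_f.
    by rewrite mem_nseq => /andP[_ /eqP].
  apply: connect_trans (connE_sub (subsetUr _ _) cx) _; rewrite lu.
  by apply: connect1; apply: adjE_edge; rewrite !inE eqxx.
- rewrite -map_comp; have -> : nseq f p = map (fun=> p) (nseq f u) by rewrite map_nseq.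
  by rewrite -lr -map_comp; apply: eq_map.
- have szl : size ls = f by have := congr1 size lr; rewrite size_map size_nseq.
  have le : \sum_(l <- map ext ls) icost l <= \sum_(l <- ls) icost l + f.
    rewrite big_map -szl -sum1_size -big_split /=; apply: leq_sum => l _.
    rewrite /icost /= -addnA leq_add2l cardsU1 addnC leq_add2l.
    by case: (_ \notin _).
  by case/andP: fP => _ f2; apply: bridge_arith f2 sz le.
move=> e; rewrite in_setU1 => /predU1P[->|eS] eG.
  case: ls lr lsP cov {sz} => [lr|l ls _ lsP _]; first by case: (f) fP lr.
  right; exists (ext l); first by rewrite mem_head.
  right; exists Y; split=> //; have [|] := lsP l; first by rewrite mem_head.
  by [].
have [[B Bin eB]|[l lin [el|[U [cU sU rU eU]]]]] := cov e eS eG.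
- by left; exists B.
- by right; exists (ext l); [exact: map_f | left].
right; exists (ext l); [exact: map_f | right; exists U; split=> //].
by apply: contra pY; apply: (subsetP sU).
Qed.

Let two_links_arith (a b c d e f g h k : nat) : b + c <= e + f -> d + g <= h + k ->
  (a + (b + d)) + (c + g) <= a + (e + f) + (h + k).
Proof. lia. Qed.

(** L1 delivers one item at r and L2 the other f - 1, so that each application of [link_homes]
    passes on at most one. *)
Lemma two_links T r f S k cs L1 L2 J1 J2 : 0 < f <= 2 ->
  (forall B, B \in cs -> signed_circuit B) -> homes_ok T L1 -> homes_ok T L2 ->
  oddv J1 = parity_set (map (fun a => ipos a.2) L1 ++ [:: r]) ->
  oddv J2 = parity_set (map (fun a => ipos a.2) L2 ++ nseq f.-1 r) ->
  2 * (\sum_(B <- cs) #|edges B| + (\sum_(a <- L1) icost a.2 + #|J1|) +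
    (\sum_(a <- L2) icost a.2 + #|J2|)) <= k ->
  (forall e, e \in S -> e \notin Ghat -> (exists2 B, B \in cs & e \in edges B) \/
     pending r L1 e \/ pending r L2 e) ->
  exists cs ls,
  [/\ forall B, B \in cs -> signed_circuit B,
      forall l, l \in ls -> is_item l /\ ends (icyc l) \subset T,
      map (@ipos G) ls = nseq f r,
      2 * (\sum_(B <- cs) #|edges B| + \sum_(l <- ls) icost l) <= k &
      forall e, e \in S -> e \notin Ghat -> settled T r cs ls e].
Proof.
move=> fP csP ok1 ok2 o1 o2 szk cov.
have [cs1 [ls1 [cs1P ls1P lr1 sz1 cov1]]] := link_homes (rr := [:: r]) r ok1 isT o1.
have szf : size (nseq f.-1 r) <= 1 by rewrite size_nseq; move: fP; clear; lia.
have [cs2 [ls2 [cs2P ls2P lr2 sz2 cov2]]] := link_homes (rr := nseq f.-1 r) r ok2 szf o2.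
exists (cs ++ cs1 ++ cs2), (ls1 ++ ls2); split.
- by move=> B; rewrite !mem_cat => /or3P[/csP|/cs1P|/cs2P].
- by move=> l; rewrite mem_cat => /orP[/ls1P|/ls2P].
- by rewrite map_cat lr1 lr2; case: (f) fP.
- apply: leq_trans szk; rewrite leq_mul2l /= !big_cat /=.
  exact: two_links_arith sz1 sz2.
move=> e eS eG; have [[B Bin eB]|[/cov1|/cov2]] := cov e eS eG.
- by left; exists B; rewrite // mem_cat Bin.
- by apply: settled_mono => // z zin; rewrite !mem_cat zin ?orbT.
by apply: settled_mono => // z zin; rewrite !mem_cat zin ?orbT.
Qed.

Lemma homes_mono T T' L : T \subset T' -> homes_ok T L -> homes_ok T' L.
Proof.
move=> sT [okL pL]; split=> // a aL; have [oka sa saT] := okL a aL.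
by split=> //; apply: subset_trans saT sT.
Qed.

Lemma homes_cat T L L' : homes_ok T L -> homes_ok T L' ->
  (forall a b, a \in L -> b \in L' -> [disjoint a.1 & b.1]) -> homes_ok T (L ++ L').
Proof.
move=> [okL pL] [okL' pL'] dL; split.
  by move=> a; rewrite mem_cat => /orP[/okL|/okL'].
by rewrite pairwise_cat pL pL' !andbT; apply/allrelP.
Qed.

Definition cycle_items (pt : {set E} -> V) Ds : seq homed :=
  [seq (ends D, (D, set0, pt D)) | D <- Ds].

Lemma cycle_homes X pt Ds : (forall D, D \in Ds -> [/\ negcyc D, ends D \subset X & pt D \in ends D]) ->
  pairwise (@vdisj G) Ds -> homes_ok X (cycle_items pt Ds).
Proof.
move=> DsP pDs; split; last by rewrite pairwise_map.
move=> _ /mapP[D /DsP[nD sD pD] ->]; split=> //; split=> //.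
by exists (pt D).
Qed.

Lemma cycle_items_cost pt Ds : \sum_(a <- cycle_items pt Ds) icost a.2 = \sum_(D <- Ds) #|D|.
Proof.
by rewrite big_map; apply: eq_bigr => D _; rewrite /icost /= cards0 addn0.
Qed.

Lemma cycle_items_pos pt Ds : map (fun a => ipos a.2) (cycle_items pt Ds) = map pt Ds.
Proof. by rewrite -map_comp. Qed.

Lemma cycle_items_pending r pt Ds D e : D \in Ds -> e \in D -> pending r (cycle_items pt Ds) e.
Proof. by move=> Din eD; exists (ends D, (D, set0, pt D)); [apply: map_f | left]. Qed.

Lemma pending_sub r L L' e : {subset L <= L'} -> pending r L e -> pending r L' e.
Proof. by move=> sL [a aL ae]; exists a; first exact: sL. Qed.

Lemma settled_pending Y p r cs ls e : r \notin Y -> settled Y p cs ls e ->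
  (exists2 B, B \in cs & e \in edges B) \/ pending r (map (pair Y) ls) e.
Proof.
move=> rY [|[l lin le]]; [by left | right; exists (Y, l); first exact: map_f].
case: le => [|[U [cU sU _ eU]]]; [by left | right; exists U; split=> //].
by apply: contra rY; apply: (subsetP sU).
Qed.

(* A port (p, Y, S, k) stands for a territory Y, already dealt with, in which the
   edges of S are covered and which is attached at the vertex p. *)
Definition port : Type := (V * {set V} * {set E} * nat)%type.
Implicit Types (q : port) (qs : seq port).
Definition pp q : V := q.1.1.1.
Definition pY q : {set V} := q.1.1.2.
Definition pS q : {set E} := q.1.2.
Definition pk q : nat := q.2.

Definition territory qs : {set V} := [set v | has (fun q => v \in pY q) qs].
Definition port_edges qs : {set E} := [set e | has (fun q => e \in pS q) qs].

Lemma territory_sup q qs : q \in qs -> pY q \subset territory qs.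
Proof. by move=> qin; apply/subsetP=> v vY; rewrite inE; apply/hasP; exists q. Qed.

Lemma ports_once r qs : 
  (forall q, q \in qs -> rooted (pY q) (pS q) (pk q) (pp q) /\ r \notin pY q) ->
  pairwise (fun q q' => [disjoint pY q & pY q']) qs ->
  exists cs L,
  [/\ forall B, B \in cs -> signed_circuit B, homes_ok (territory qs) L,
      map (fun a => ipos a.2) L = map pp qs,
      2 * (\sum_(B <- cs) #|edges B| + \sum_(a <- L) icost a.2) <= \sum_(q <- qs) pk q &
      (forall a, a \in L -> exists2 q, q \in qs & a.1 = pY q) /\
      forall q e, q \in qs -> e \in pS q -> e \notin Ghat ->
        (exists2 B, B \in cs & e \in edges B) \/ pending r L e].
Proof.
elim: qs => [|q qs IH] okq.
  by exists [::], [::]; split=> //; rewrite !big_nil.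
rewrite [X in is_true X -> _]/= => /andP[/allP dq pqs].
have [|cs [L [csP okL Lp sz [LY cov]]]] := IH _ pqs.
  by move=> q' q'in; apply: okq; rewrite inE q'in orbT.
have [rq rY] := okq q (mem_head q qs).
have [cs1 [ls1 [cs1P ls1P lr1 sz1 cov1]]] := rq 1 isT.
have [l [ls1E lp]] : exists l, ls1 = [:: l] /\ ipos l = pp q.
  by case: (ls1) lr1 => [//|l [|//]] [lp]; exists l.
rewrite {}ls1E {lr1} in ls1P sz1 cov1.
have [okl sl] := ls1P l (mem_head _ _).
exists (cs1 ++ cs), ((pY q, l) :: L); split.
- by move=> B; rewrite mem_cat => /orP[/cs1P|/csP].
- rewrite -[_ :: L]cat1s; apply: homes_cat.
  + by split=> // a; rewrite inE => /eqP->; split=> //; apply: territory_sup (mem_head _ _).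
  + apply: homes_mono okL; apply/subsetP=> v; rewrite !inE => /hasP[q' q'in vY].
    by apply/hasP; exists q'; rewrite ?inE ?q'in ?orbT.
  move=> a b; rewrite inE => /eqP-> /LY[q' q'in ->]; exact: dq.
- by rewrite /= Lp lp.
- rewrite big_cat !big_cons /=; rewrite big_seq1 in sz1.
  by move: sz sz1; rewrite -/(edges _); clear; lia.
split.
  move=> a; rewrite inE => /predU1P[->|/LY[q' q'in ->]]; first by exists q; rewrite ?mem_head.
  by exists q' => //; rewrite inE q'in orbT.
move=> q' e; rewrite inE => /predU1P[->|q'in] eS eG.
  have [[B Bin eB]|pe] := settled_pending rY (cov1 e eS eG).
    by left; exists B; rewrite // mem_cat Bin.
  by right; apply: pending_sub pe => a; rewrite !inE => ->.
have [[B Bin eB]|pe] := cov q' e q'in eS eG.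
  by left; exists B; rewrite // mem_cat Bin orbT.
by right; apply: pending_sub pe => a aL; rewrite inE aL orbT.
Qed.

Lemma half_join X (s : seq V) : block X -> (forall v, v \in s -> v \in X) -> ~~ odd (size s) ->
  exists J, [/\ J \subset inner X, oddv J = parity_set s & 2 * #|J| <= #|inner X|].
Proof.
move=> bX sX ev; apply: join_half; first exact: block_bridgeless.
case: bX => l _ _; apply: linked_even l _ _; last by rewrite odd_parity_set.
by apply/subsetP=> v /mem_parity_set; apply: sX.
Qed.

Lemma block_decompose X M : block X -> M \subset N :&: inner X -> exists H cs Ds,
  [/\ forall C : subgr G, C \in cs -> signed_circuit C,
      forall D, D \in Ds -> [/\ negcyc D, D \subset inner X & ends D \subset X],
      pairwise (@vdisj G) Ds,
      2 * (\sum_(C <- cs) #|edges C| + \sum_(D <- Ds) #|D|) <=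
        #|inner X :&: Ghat| + 2 * #|inner X :\: Ghat| &
      [/\ even_set H, H :&: N = M, cover_of cs Ds H & odd (size Ds) = odd #|M|]].
Proof.
move=> bX sM; have [H [eH sH HN szH]] := even_through bX sM.
have [cs [Ds [csP DsP pDs sz [cov par]]]] := decompose eH.
exists H, cs, Ds; split=> //; last by split=> //; rewrite par -N_parity // HN.
- by move=> D /DsP[nD sD]; rewrite ends_inner; split=> //; apply: subset_trans sD sH.
by rewrite sz.
Qed.

(** An edge outside N and [Ghat] has a partner n in N with which it forms a 2-cut, so an even set
    through n uses it too. *)
Lemma block_cover X F H e : block X -> even_set F -> even_set H ->
  (N :&: inner X) :\: F \subset H -> e \in inner X -> e \notin Ghat -> (e \in F) || (e \in H).
Proof.
move=> bX eF eH sH eA eG; have [eN|eN] := boolP (e \in N).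
  have [//|eNF] := boolP (e \in F).
  by apply: (subsetP sH); rewrite in_setD in_setI eNF eN.
have [n nNA np] := even_partner bX eA eN eG.
have [nF|nF] := boolP (n \in F); first by rewrite (np F).
by rewrite (np H) ?orbT //; apply: (subsetP sH); rewrite in_setD nF.
Qed.

Let cycle_arith (a g o c d f x y : nat) : g + o = a -> 2 * (c + d) <= g + 2 * o ->
  2 * x + f <= a -> 2 * y + f <= a -> 2 * (c + (f + x) + (d + y)) <= 3 * g + 6 * o.
Proof. lia. Qed.

(** A shortest negative cycle F becomes the item sent to r by the first join, and H covers the
    N-edges not left to F. The two joins from [cycle_join] together save |F|, which pays for F. *)
Lemma rooted_cycle X r : block X -> r \in X -> N :&: inner X != set0 ->
  rooted X (inner X) (wt (inner X)) r.
Proof.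
move=> bX rX /set0Pn[n nNA] f fP; have [lX _ _] := bX; set A := inner X in nNA lX *.
have [D0 D0P] : exists D0 : {set E}, negcyc D0 && (D0 \subset A).
  have [|H [cs [Ds [_ DsP _ _ [_ _ _ par]]]]] := block_decompose (M := [set n]) bX.
    by rewrite sub1set.
  have [D Din] : exists D, D \in Ds.
    by case: (Ds) par => [|D Ds']; [rewrite cards1 | exists D; rewrite mem_head].
  by have [nD sD _] := DsP D Din; exists D; rewrite nD.
pose F := [arg min_(F < D0 | negcyc F && (F \subset A)) #|F|].
have [/andP[nF sF] Fmin] : negcyc F && (F \subset A) /\
    forall D, negcyc D -> D \subset A -> #|F| <= #|D|.
  rewrite /F; case: arg_minnP => // F' F'P min; split=> // D nD sD.
  by apply: min; rewrite nD.
have /andP[cF oF] := nF; have evF := cyc_even cF.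
have eF : ends F \subset X by rewrite ends_inner.
(* Leaving the N-edges of F to F, or not doing so, switches the parity of the number of cycles in H,
   which has to be that of f - 1. *)
have [F' [evF' sF' oM]] : exists F' : {set E}, [/\ even_set F', F' \subset F &
    odd #|(N :&: A) :\: F'| = odd f.-1].
  have oFN : odd #|(N :&: A) :\: F| = ~~ odd #|N :&: A|.
    have := cardsID F (N :&: A); rewrite -setIA (setIidPr sF) setIC => <-.
    by rewrite oddD N_parity // oF addTb negbK.
  have [E1|E1] := eqVneq (odd #|N :&: A|) (odd f.-1).
    by exists set0; rewrite even_set0 sub0set setD0.
  by exists F; rewrite oFN; split=> //; move: E1; do 2 case: (odd _).
have [|H [cs [Ds [csP DsP pDs szH [evH HN covH par]]]]] :=
  block_decompose (M := (N :&: A) :\: F') bX; first exact: subsetDl.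
have brA := block_bridgeless bX; have szF := subset_leq_card sF.
have rXs (s : seq V) : {subset s <= [:: r]} -> forall u, u \in s -> u \in X.
  by move=> ss u /ss; rewrite inE => /eqP->.
have [|||p1 [J1 [p1P sJ1 oJ1 szJ1]]] := @cycle_join G A X [:: F] [:: r] #|F| r brA lX rX _ _
    (rXs _ _) isT isT szF; rewrite //.
  by move=> D; rewrite inE => /eqP->.
have [||||p2 [J2 [p2P sJ2 oJ2 szJ2]]] :=
    @cycle_join G A X Ds (nseq f.-1 r) #|F| r brA lX rX _ pDs (rXs _ _) _ _ szF.
- move=> D Din; have [nD sD eD] := DsP D Din; split=> //; first by case/andP: nD.
  exact: Fmin.
- by move=> u; rewrite mem_nseq inE => /andP[].
- by rewrite size_nseq; move: fP; clear; lia.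
- by rewrite oddD size_nseq par oM addbb.
apply: (@two_links X r f (inner X) _ cs (cycle_items p1 [:: F]) (cycle_items p2 Ds) J1 J2) => //.
- apply: cycle_homes => // D; rewrite inE => /eqP->; split=> //.
  by apply: p1P; rewrite mem_head.
- by apply: cycle_homes => // D Din; have [nD _ eD] := DsP D Din; split=> //; apply: p2P.
- by rewrite cycle_items_pos.
- rewrite !cycle_items_cost big_seq1.
  by apply: cycle_arith szH szJ1 szJ2; rewrite cardsID.
move=> e eA eG.
have sMH : (N :&: A) :\: F' \subset H by rewrite -HN subsetIl.
have /orP[eF'|eH] := block_cover bX evF' evH sMH eA eG.
  right; left; apply: (@cycle_items_pending _ _ _ F); rewrite ?mem_head //.
  exact: (subsetP sF').
have [[C Cin eC]|[D Din eD]] := covH e eH; first by left; exists C.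
by right; right; apply: cycle_items_pending Din eD.
Qed.

Let ports_arith (a g o h d c0 l l2 c1 i1 x y k0 k1 : nat) : g + o = a ->
  2 * (h + d) <= g + 2 * o -> 2 * (c0 + (l + l2)) <= k0 -> 2 * (c1 + i1) <= k1 ->
  2 * x <= a -> 2 * y <= a ->
  2 * (h + (c1 + c0) + (l + x) + (d + (i1 + l2) + y)) <= 3 * g + 6 * o + (k0 + k1).
Proof. lia. Qed.

(** With a port q at hand no cycle has to be repeated: q supplies the item sent to r and, if the
    second join would otherwise have an odd number of terminals, one more. *)
Lemma rooted_block X r qs : block X -> r \in X ->
  (forall q, q \in qs -> [/\ rooted (pY q) (pS q) (pk q) (pp q), pp q \in X &
     [disjoint pY q & X]]) ->
  pairwise (fun q q' => [disjoint pY q & pY q']) qs ->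
  (qs = [::] -> N :&: inner X != set0) ->
  rooted (X :|: territory qs) (inner X :|: port_edges qs) (wt (inner X) + \sum_(q <- qs) pk q) r.
Proof.
move=> bX rX qsP pqs qs0; case: qs => [|q qs] in qsP pqs qs0 *.
  apply: rooted_mono (rooted_cycle bX rX (qs0 erefl)); rewrite ?subsetUl ?leq_addr //.
  by apply/subsetP=> e; rewrite in_setU => /orP[//|]; rewrite inE.
have [rq pqX dq] := qsP q (mem_head q qs); move: pqs => /=/andP[/allP dqs pqs] f fP.
have rY q' : q' \in q :: qs -> r \notin pY q'.
  by move=> /qsP[_ _ d]; rewrite (disjointFl d rX).
set A := inner X; have [lX _ _] := bX; rewrite -/A in lX.
have [|H [csH [Ds [csHP DsP pDs szH [evH HN covH par]]]]] :=
  block_decompose (M := N :&: A) bX; first exact: subxx.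
have [|cs1 [L1 [cs1P okL1 L1p sz1 [L1Y cov1]]]] := @ports_once r qs _ pqs.
  move=> q' q'in; have q'in' : q' \in q :: qs by rewrite inE q'in orbT.
  by have [rq' _ _] := qsP q' q'in'; split; last exact: rY.
pose b := odd (size Ds + size qs + f.-1).
have [|cs0 [ls0 [cs0P ls0P lr0 sz0 cov0]]] := rq b.+1; first by case: b.
have [l [ls [ls0E lp lsp]]] : exists l ls, [/\ ls0 = l :: ls, ipos l = pp q &
    map (@ipos G) ls = nseq b (pp q)].
  by case: (ls0) lr0 => [//|l ls] [lp lsp]; exists l, ls.
rewrite {}ls0E {lr0} in ls0P sz0 cov0.
have szls : size ls = b by have := congr1 size lsp; rewrite size_map size_nseq.
pose pt D := odflt r [pick v in ends D].
have ptP D : D \in Ds -> pt D \in ends D.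
  move=> /DsP[/andP[cD _] _ _]; have [v vD] := cyc_ends cD.
  by rewrite /pt; case: pickP => //= no; have := no v; rewrite vD.
pose s2 := map (fun a => ipos a.2) (cycle_items pt Ds ++ L1 ++ map (pair (pY q)) ls).
have s2E : s2 = map pt Ds ++ map pp qs ++ nseq b (pp q).
  by rewrite /s2 !map_cat cycle_items_pos L1p -map_comp -lsp.
have [||J1 [sJ1 oJ1 szJ1]] := @half_join X [:: pp q; r] bX; rewrite //.
  by move=> v; rewrite !inE => /orP[] /eqP->.
have [||J2 [sJ2 oJ2 szJ2]] := @half_join X (s2 ++ nseq f.-1 r) bX.
- move=> v; rewrite s2E !mem_cat -!orbA => /or4P[/mapP[D Din ->]|/mapP[q' q'in ->]||].
  + by have [_ _ sD] := DsP D Din; apply: (subsetP sD); apply: ptP.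
  + by have [|] := qsP q'; rewrite // inE q'in orbT.
  + by rewrite mem_nseq => /andP[_ /eqP->].
  by rewrite mem_nseq => /andP[_ /eqP->].
- rewrite s2E !size_cat !size_map !size_nseq !addnA -addnA [b + _]addnC addnA oddD.
  by rewrite oddb addbb.
have okq ls' : {subset ls' <= l :: ls} -> size ls' <= 1 ->
    homes_ok (X :|: territory (q :: qs)) (map (pair (pY q)) ls').
  move=> sls szls'; split.
    move=> _ /mapP[l' /sls/ls0P[okl' sl'] ->]; split=> //.
    by apply: subset_trans (subsetUr _ _); apply: territory_sup; rewrite mem_head.
  by case: ls' szls' {sls} => [|? []].
have sT Y : Y \subset territory qs -> Y \subset X :|: territory (q :: qs).
  move=> sY; apply/subsetP=> v /(subsetP sY); rewrite !inE => /hasP[q' q'in vY].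
  by apply/orP; right; apply/orP; right; apply/hasP; exists q'.
have sls : {subset ls <= l :: ls} by move=> z zin; rewrite inE zin orbT.
have sl : {subset [:: l] <= l :: ls} by move=> z; rewrite inE => /eqP->; rewrite mem_head.
apply: (@two_links _ r f (A :|: port_edges (q :: qs)) _ (csH ++ cs1 ++ cs0)
  (map (pair (pY q)) [:: l]) (cycle_items pt Ds ++ L1 ++ map (pair (pY q)) ls) J1 J2) => //.
- by move=> B; rewrite !mem_cat => /or3P[/csHP|/cs1P|/cs0P].
- exact: okq.
- apply: homes_cat; first apply: homes_mono (subsetUl _ _) _.
  + by apply: cycle_homes => // D Din; have [nD _ eD] := DsP D Din; split=> //; apply: ptP.
  + apply: homes_cat; [apply: homes_mono okL1; exact: sT | apply: okq => // |].
      by rewrite szls; case: (b).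
    move=> a c /L1Y[q' q'in ->] /mapP[l' _ ->]; rewrite disjoint_sym; exact: dqs.
  move=> a c /mapP[D Din ->]; have [_ _ eD] := DsP D Din.
  have dX q' : q' \in q :: qs -> [disjoint ends D & pY q'].
    move=> /qsP[_ _ d]; rewrite disjoint_sym; exact: disjointWr eD d.
  rewrite mem_cat => /orP[/L1Y[q' q'in ->]|/mapP[l' _ ->]].
    by apply: dX; rewrite inE q'in orbT.
  by apply: dX; rewrite mem_head.
- by rewrite oJ1 /= lp.
- rewrite !big_cat cycle_items_cost !big_map !big_cons /= big_nil addn0.
  rewrite big_cons in sz0.
  by apply: ports_arith szH sz0 sz1 szJ1 szJ2; rewrite cardsID.
move=> e; rewrite in_setU => eAS eG.
have {eAS} : [\/ e \in A, e \in pS q | exists2 q', q' \in qs & e \in pS q'].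
  case/orP: eAS => [|]; first by constructor 1.
  rewrite inE /= => /orP[|/hasP[q' q'in eq]]; first by constructor 2.
  by constructor 3; exists q'.
case=> [eA|eq|[q' q'in eq]].
- have sMH : (N :&: A) :\: set0 \subset H by rewrite setD0 -HN subsetIl.
  have := block_cover bX (even_set0 G) evH sMH eA eG; rewrite in_set0 /= => eH.
  have [[C Cin eC]|[D Din eD]] := covH e eH; first by left; exists C; rewrite // mem_cat Cin.
  right; right; apply: pending_sub (cycle_items_pending r pt Din eD) => a aL.
  by rewrite mem_cat aL.
- have [[B Bin eB]|[a /mapP[l' l'in ->] pe]] := settled_pending (rY q (mem_head _ _)) (cov0 e eq eG).
    by left; exists B; rewrite // !mem_cat Bin !orbT.
  right; move: l'in; rewrite inE => /predU1P[E1|l'in]; [left|right].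
    by rewrite E1 in pe; exists (pY q, l); rewrite //= inE.
  by exists (pY q, l'); rewrite // !mem_cat (map_f (pair (pY q)) l'in) !orbT.
have [[B Bin eB]|pe] := cov1 q' e q'in eq eG.
  by left; exists B; rewrite // !mem_cat Bin orbT.
by right; right; apply: pending_sub pe => a aL; rewrite !mem_cat aL orbT.
Qed.

(** * Regions and the recursion over bridges *)

Lemma cut_half U e : e \in cut U ->
  exists h, [/\ h.1 = e, endpt h \in U & endpt (opp_half h) \notin U].
Proof.
rewrite inE /crosses => c; case f0: (endpt (e, false) \in U) c => /= c.
  by exists (e, false); split.
by exists (e, true); split; rewrite //= f0.
Qed.

Lemma inner_cutD Z U : inner Z :&: cut (Z :\: U) = inner Z :&: cut U.
Proof.
apply/setP=> e; rewrite !inE /crosses !inE.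
by do 2 case: (_ \in Z); rewrite ?andbF ?andbT //; do 2 case: (_ \in U).
Qed.

Lemma inner_cutI Z U : inner Z :&: cut (Z :&: U) = inner Z :&: cut U.
Proof.
apply/setP=> e; rewrite !inE /crosses !inE.
by do 2 case: (_ \in Z); rewrite ?andbF ?andbT //; do 2 case: (_ \in U).
Qed.

(** Inside Z only the edge of h leaves S, and U avoids its end in S, so the edges of Z that leave U
    stay in S. *)
Lemma side_cut Z (S : {set V}) U h : S \subset Z -> inner Z :&: cut S = [set h.1] -> endpt h \in S ->
  U \subset S -> endpt h \notin U -> inner Z :&: cut U = inner S :&: cut U.
Proof.
move=> sS cS hS sU hU; apply/setP=> e; rewrite !in_setI.
have [eU|] := boolP (e \in cut U); last by rewrite !andbF.
have [h' [<- aU bU]] := cut_half eU; rewrite !andbT !inner_half.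
have aS := subsetP sU _ aU; rewrite aS (subsetP sS _ aS) /=.
apply/idP/idP=> [bZ|]; last exact: subsetP sS _.
apply: contraT => bS; have : h'.1 \in [set h.1].
  rewrite -cS in_setI inner_half (subsetP sS _ aS) bZ inE crosses_half aS.
  by rewrite (negPf bS).
rewrite in_set1 => /eqP/same_edge[hh'|hh'].
  by rewrite hh' (negPf hU) in aU.
by rewrite hh' opp_halfK hS in bS.
Qed.

Lemma side_links Z (S : {set V}) h : links_all (inner Z) Z -> S \subset Z ->
  inner Z :&: cut S = [set h.1] -> endpt h \in S -> links_all (inner S) S.
Proof.
move=> lZ sS cS hS x y xS yS; apply: contraT => nc.
pose W := component (inner S) x.
have xW : x \in W by apply: component_refl.
have yW : y \notin W by rewrite inE.
have W0 : inner S :&: cut W = set0 by apply: component_cut.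
have sW : W \subset S.
  apply/subsetP=> z; rewrite inE => c; apply: contraT => zS.
  have [e eS eU] := connect_cut c xS zS.
  by have [h' [E1 aS bS]] := cut_half eU; move: eS; rewrite -E1 inner_half (negPf bS) andbF.
(* Of the component W and its complement in S, one avoids the end of h; nothing leaves it in Z
   either. *)
have [U [sU U0 hU xyU]] : exists U, [/\ U \subset S, inner S :&: cut U = set0,
    endpt h \notin U & (x \in U) (+) (y \in U)].
  have [hW|hW] := boolP (endpt h \in W); last by exists W; rewrite xW (negPf yW).
  exists (S :\: W); rewrite subsetDl inner_cutD W0 !in_setD hW xW yW yS.
  by split.
have /set0Pn[] : inner Z :&: cut U != set0; last first.
  by move=> e; rewrite (side_cut sS cS hS sU hU) U0 in_set0.
have cxy := lZ x y (subsetP sS _ xS) (subsetP sS _ yS); apply/set0Pn.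
case xU: (x \in U) xyU => /= yU.
  by have [e eZ eU] := connect_cut cxy xU yU; exists e; rewrite inE eZ.
have [e eZ eU] : exists2 e, e \in inner Z & e \in cut U.
  by rewrite (connE_sym _ x y) in cxy; apply: connect_cut cxy yU _; rewrite xU.
by exists e; rewrite inE eZ.
Qed.

Lemma mem_territory_filter (a : pred port) qs v :
  (v \in territory [seq q <- qs | a q]) = has (fun q => a q && (v \in pY q)) qs.
Proof.
rewrite inE; elim: qs => //= q qs IH; rewrite -IH.
by case: (a q).
Qed.

(** Z is the part still to be treated, with ports at its vertices. By the clause on U, a cut of Z
    given by a set without r becomes a cut of G once the territories attached in U are added. *)
Definition region Z r qs : Prop :=
  [/\ r \in Z, links_all (inner Z) Z,
    forall q, q \in qs -> [/\ rooted (pY q) (pS q) (pk q) (pp q), pp q \in Z &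
      [disjoint pY q & Z]],
    pairwise (fun q q' => [disjoint pY q & pY q']) qs &
    (forall U, U \subset Z -> r \notin U ->
       cut (U :|: territory [seq q <- qs | pp q \in U]) = inner Z :&: cut U) /\
    (qs = [::] -> N :&: inner Z != set0)].

Section Step.

Variables (Z S : {set V}) (r : V) (qs : seq port) (h : half_edge G).
Hypotheses (rZ : region Z r qs) (sS : S \subset Z) (rS : r \notin S)
  (cS : inner Z :&: cut S = [set h.1]) (hS : endpt h \in S) (pS' : endpt (opp_half h) \notin S).
Let qs1 := [seq q <- qs | pp q \in S].
Let qs2 := [seq q <- qs | pp q \notin S].
Let T1 := S :|: territory qs1.

Let hZ : h.1 \in inner Z.
Proof. by have := set11 h.1; rewrite -cS in_setI => /andP[]. Qed.

Let pZ : endpt (opp_half h) \in Z.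
Proof. by move: hZ; rewrite inner_half => /andP[]. Qed.

Let cT1 : cut T1 = [set h.1].
Proof. by have [_ _ _ _ [R2 _]] := rZ; rewrite -cS; apply: R2. Qed.

Let dT1 v : v \in T1 -> v \notin S -> exists2 q, q \in qs1 & v \in pY q.
Proof. by rewrite in_setU => /orP[->//|]; rewrite inE => /hasP[q q1 vq] _; exists q. Qed.

Let pT1 : endpt (opp_half h) \notin T1.
Proof.
apply/negP=> /dT1/(_ pS')[q]; rewrite mem_filter => /andP[_ qin] pq.
have [_ _ okq _ _] := rZ; have [_ _ d] := okq q qin.
by have := pZ; rewrite (disjointFr d pq).
Qed.

(** If S carries no ports, it is cut off in G by a single edge and so contains an edge of N. *)
Lemma inner_region : region S (endpt h) qs1.
Proof.
have [rinZ lZ okq pq [R2 _]] := rZ.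
have side U : U \subset S -> endpt h \notin U ->
    cut (U :|: territory [seq q <- qs1 | pp q \in U]) = inner S :&: cut U.
  move=> sU hU; rewrite -(side_cut sS cS hS sU hU) -R2 //.
  - rewrite -filter_predI; congr (cut (_ :|: territory _)); apply: eq_filter => q /=.
    by case: (boolP (pp q \in U)) => // /(subsetP sU) ->.
  - exact: subset_trans sU sS.
  by apply: contra rS; apply: (subsetP sU).
split=> //; first exact: side_links lZ sS cS hS.
- move=> q; rewrite mem_filter => /andP[qS qin]; have [rq _ d] := okq q qin; split=> //.
  exact: disjointWr sS d.
- exact: subseq_pairwise (filter_subseq _ _) pq.
split=> // q0; apply: (N_side (e := h.1)); rewrite -cS.
have := R2 S sS rS; rewrite -/qs1 q0 => <-; congr cut.
by apply/setP=> v; rewrite !inE orbF.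
Qed.

Variable k1 : nat.
Let q0 : port := (endpt (opp_half h), T1, h.1 |: (inner S :|: port_edges qs1), k1 + 6).
Hypothesis rT1 : rooted T1 (inner S :|: port_edges qs1) k1 (endpt h).

(** S with its territories becomes one new port, attached at the far end of the bridge. *)
Lemma outer_region : region (Z :\: S) r (q0 :: qs2).
Proof.
have [rinZ lZ okq pq [R2 _]] := rZ.
have cS' : inner Z :&: cut (Z :\: S) = [set (opp_half h).1] by rewrite inner_cutD.
have pD : endpt (opp_half h) \in Z :\: S by rewrite in_setD pS'.
have hT1 : endpt h \in T1 by rewrite in_setU hS.
split=> //; first by rewrite in_setD rS.
- exact: side_links lZ (subsetDl _ _) cS' pD.
- move=> q; rewrite inE => /predU1P[->|]; last first.
    rewrite mem_filter => /andP[qS qin]; have [rq qZ d] := okq q qin.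
    by split; rewrite ?in_setD ?qS //; apply: disjointWr (subsetDl _ _) d.
  split=> //; first exact: rooted_bridge cT1 hT1 pT1 rT1.
  apply/pred0P=> v /=; apply/negbTE/negP=> /andP[vT /setDP[vZ vS]].
  have [q'] := dT1 vT vS; rewrite mem_filter => /andP[_ qin] vq.
  by have [_ _ d] := okq q' qin; rewrite (disjointFr d vq) in vZ.
- rewrite /= (subseq_pairwise (filter_subseq _ _) pq) andbT; apply/allP=> q.
  rewrite mem_filter => /andP[qS qin]; have [_ _ dq] := okq q qin.
  apply/pred0P=> v /=; apply/negbTE/negP=> /andP[vT vq].
  have [vS|vS] := boolP (v \in S).
    by have := disjointFr dq vq; rewrite (subsetP sS v vS).
  have [q'] := dT1 vT vS; rewrite mem_filter => /andP[q'S q'in] vq'.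
  have d : [disjoint pY q' & pY q].
    apply: (@pairwise_in _ (fun c d : port => [disjoint pY c & pY d]) qs) => //.
      by move=> c d; rewrite disjoint_sym.
    by apply: contraNneq qS => <-.
  by rewrite (disjointFr d vq') in vq.
split=> // U sU rU.
have sUZ : U \subset Z by apply: subset_trans sU (subsetDl _ _).
have UF : [seq q <- qs2 | pp q \in U] = [seq q <- qs | pp q \in U].
  rewrite -filter_predI; apply: eq_filter => q /=.
  by case: (boolP (pp q \in U)) => // /(subsetP sU); rewrite in_setD => /andP[->].
rewrite /= UF; case: ifP => [pU|/negbT pU]; last first.
  by rewrite R2 // (side_cut (subsetDl _ _) cS' pD sU).
(* The new port brings S along, so the clause for Z is applied to the union of U and S. *)
have -> : U :|: territory (q0 :: [seq q <- qs | pp q \in U]) =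
    (U :|: S) :|: territory [seq q <- qs | pp q \in U :|: S].
  apply/setP=> v; rewrite !in_setU mem_territory_filter.
  have -> : (v \in territory (q0 :: [seq q <- qs | pp q \in U])) =
      (v \in T1) || (v \in territory [seq q <- qs | pp q \in U]).
    by rewrite [LHS]in_set [X in _ || X]in_set /=.
  rewrite in_setU !mem_territory_filter -!orbA; congr (_ || (_ || _)).
  rewrite orbC -has_predU; apply: eq_has => q /=.
  by rewrite in_setU andb_orl.
rewrite R2; first last.
- by rewrite in_setU negb_or rU.
- by rewrite subUset sUZ.
(* [side_cut] needs a set without the end of the bridge; the complement has the same cut and avoids
   it. *)
have D1 : (Z :\: S) :\: U = Z :\: (U :|: S) by rewrite setDDl setUC.
rewrite -inner_cutD -D1 (side_cut (subsetDl _ _) cS' pD (subsetDl _ _)) ?inner_cutD //.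
by rewrite in_setD pU.
Qed.

Lemma step_edges : inner Z :|: port_edges qs \subset
  inner (Z :\: S) :|: port_edges (q0 :: qs2).
Proof.
apply/subsetP=> e; rewrite in_setU => /orP[eZ|]; last first.
  rewrite inE => /hasP[q qin eq]; rewrite !in_setU.
  have [qS|qS] := boolP (pp q \in S); apply/orP; right; rewrite inE /=; apply/orP.
    left; rewrite !in_setU; apply/orP; right; apply/orP; right.
    by rewrite inE; apply/hasP; exists q; rewrite // mem_filter qS.
  by right; apply/hasP; exists q; rewrite // mem_filter qS.
rewrite in_setU; have [eU|eU] := boolP (e \in cut S).
  have : e \in [set h.1] by rewrite -cS in_setI eZ.
  by move=> e1; apply/orP; right; rewrite inE /= in_setU e1.
apply/orP; have [a0|a0] := boolP (endpt (e, false) \in S).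
  right; rewrite inE /=; apply/orP; left; rewrite !in_setU; apply/orP; right; apply/orP; left.
  by move: eU; rewrite !inE /crosses a0 /= negbK.
by left; move: eU eZ; rewrite !inE /crosses a0 (negPf a0) /= => -> /andP[-> ->].
Qed.

Lemma step_wt : wt (inner (Z :\: S)) + wt (inner S) + 6 = wt (inner Z).
Proof.
have -> : inner Z = inner (Z :\: S) :|: (h.1 |: inner S).
  apply/eqP; rewrite eqEsubset; apply/andP; split; apply/subsetP=> e.
    move=> eZ; rewrite !in_setU; have [eU|eU] := boolP (e \in cut S).
      have : e \in [set h.1] by rewrite -cS in_setI eZ.
      by move=> ->; rewrite orbT.
    move: eU eZ; rewrite !inE /crosses.
    by case: (endpt (e, false) \in S); case: (endpt (e, true) \in S); rewrite ?orbT // => _ ->.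
  rewrite in_setU in_setU1 => /or3P[|/eqP->//|]; rewrite !inE.
    by move=> /andP[/andP[_ ->] /andP[_ ->]].
  by move=> /andP[a b]; rewrite !(subsetP sS).
have hS' : h.1 \notin inner S by rewrite inner_half (negPf pS') andbF.
have wh := wt_bridge cT1.
rewrite !wt_setU //.
- by rewrite wh; clear; lia.
- by rewrite disjoints1.
apply/pred0P=> e /=; rewrite in_setU1; apply/negbTE/negP=> /andP[eD].
move=> /predU1P[E1|].
  by move: eD; rewrite E1 inner_half in_setD hS.
by move: eD; rewrite !inE => /andP[/andP[/negPf-> _] _].
Qed.

End Step.

(** At a bridge the side without r is solved first and then enters the other side as a port; without
    bridges the region is a block. *)
Lemma region_rooted Z r qs : region Z r qs ->
  rooted (Z :|: territory qs) (inner Z :|: port_edges qs) (wt (inner Z) + \sum_(q <- qs) pk q) r.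
Proof.
have [n] := ubnP #|Z|; elim: n Z r qs => // n IH Z r qs; rewrite ltnS => leZ rZ.
have [rinZ lZ okq pq [R2 R3]] := rZ.
have [nocut|] := boolP [forall U : {set V}, forall e, inner Z :&: cut U != [set e]].
  apply: rooted_block => //; split=> //.
    by move=> U e; move/forallP: nocut => /(_ U)/forallP/(_ e).
  (* The cut clause of [region] asks for a set without r; if r lies in U, the complement in Z is
     used. *)
  move=> U sU; have [rU|rU] := boolP (r \in U); last by rewrite -R2 //; eexists.
  rewrite -inner_cutD -R2 ?subsetDl ?in_setD ?rU //; by eexists.
rewrite negb_forall => /existsP[U]; rewrite negb_forall => /existsP[e].
rewrite negbK => /eqP cU.
have [S [sS rS cS]] : exists S : {set V}, [/\ S \subset Z, r \notin S & inner Z :&: cut S = [set e]].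
  have [rU|rU] := boolP (r \in U).
    by exists (Z :\: U); rewrite subsetDl inner_cutD in_setD rU.
  by exists (Z :&: U); rewrite subsetIl inner_cutI in_setI rinZ.
have /setIP[eZ eS] : e \in inner Z :&: cut S by rewrite cS set11.
have [h [he hS pS']] := cut_half eS; rewrite -he in cS eZ.
have pZ : endpt (opp_half h) \in Z by move: eZ; rewrite inner_half => /andP[].
pose qs1 := [seq q <- qs | pp q \in S].
pose qs2 := [seq q <- qs | pp q \notin S].
have ltS : #|S| < n.
  apply: leq_trans leZ; apply: proper_card; rewrite properE sS /=.
  by apply/subsetPn; exists (endpt (opp_half h)).
have r1 := IH S _ qs1 ltS (inner_region rZ sS rS cS hS).
have ltD : #|Z :\: S| < n.
  apply: leq_trans leZ; apply: proper_card; rewrite properE subsetDl /=.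
  by apply/subsetPn; exists (endpt h); rewrite ?in_setD ?hS // (subsetP sS).
have r2 := IH _ r _ ltD (outer_region rZ sS rS cS hS pS' r1).
apply: rooted_mono r2.
- apply/subsetP=> v; rewrite !in_setU => /orP[/setDP[-> //]|].
  rewrite inE /= => /orP[|/hasP[q]].
    rewrite in_setU => /orP[/(subsetP sS)->//|]; rewrite inE => /hasP[q].
    rewrite mem_filter => /andP[_ qin] vq; apply/orP; right.
    by rewrite inE; apply/hasP; exists q.
  rewrite mem_filter => /andP[_ qin] vq; apply/orP; right.
  by rewrite inE; apply/hasP; exists q.
- exact: step_edges.
rewrite !big_cons /= -(step_wt rZ sS rS cS hS pS').
have sumE : \sum_(q <- qs) pk q = \sum_(q <- qs1) pk q + \sum_(q <- qs2) pk q.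
  by rewrite /qs1 /qs2 !big_filter (bigID (fun q => pp q \in S)).
by apply: eq_leq; rewrite sumE !addnA; congr (_ + _); apply: addnAC.
Qed.

(** * Covering whole components, where no item is passed on *)

Definition covered S k : Prop := exists cs,
  [/\ forall B, B \in cs -> signed_circuit B, 2 * \sum_(B <- cs) #|edges B| <= k &
      forall e, e \in S -> e \notin Ghat -> exists2 B, B \in cs & e \in edges B].

Lemma link_cycles pt Ds J : (forall D, D \in Ds -> negcyc D) ->
  (forall D, D \in Ds -> pt D \in ends D) -> pairwise (@vdisj G) Ds ->
  oddv J = parity_set (map pt Ds) -> exists cs,
  [/\ forall B, B \in cs -> signed_circuit B,
      \sum_(B <- cs) #|edges B| <= \sum_(D <- Ds) #|D| + #|J| &
      forall D e, D \in Ds -> e \in D -> exists2 B, B \in cs & e \in edges B].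
Proof.
move=> nD pD dD oJ; case: Ds => [|D0 Ds] in nD pD dD oJ *.
  by exists [::]; split=> //; rewrite !big_nil.
have okL : homes_ok setT (cycle_items pt (D0 :: Ds)).
  by apply: cycle_homes => // D Din; split; rewrite ?subsetT ?nD ?pD.
have [|cs [ls [csP _ lr sz cov]]] := @link_homes setT (pt D0) _ [::] J okL isT.
  by rewrite cats0 cycle_items_pos.
have ls0 : ls = [::] by case: (ls) lr.
exists cs; split=> //.
  by move: sz; rewrite ls0 big_nil addn0 cycle_items_cost.
move=> D e Din eD; have [//|[l]] := cov e (cycle_items_pending _ pt Din eD).
by rewrite ls0.
Qed.

Lemma perm_pairwise (Q : eqType) (R : rel Q) (s t : seq Q) : symmetric R ->
  perm_eq s t -> pairwise R s -> pairwise R t.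
Proof.
move=> symR; elim: s t => [|a s IH] t pst; first by move: pst; rewrite perm_sym => /perm_nilP->.
have ain : a \in t by rewrite -(perm_mem pst) mem_head.
case/splitPr: ain pst => t1 t2; rewrite perm_sym perm_catC /= perm_cons perm_catC perm_sym.
move=> pst /=/andP[Ra /(IH _ pst)]; rewrite !pairwise_cat /= allrel_consr.
move=> /and3P[-> -> ->]; move: Ra; rewrite (perm_all _ pst) all_cat => /andP[R1 ->].
rewrite !andbT /=; apply/allP=> z zin; rewrite symR; exact: (allP R1).
Qed.

Let even_arith (a g o c d x s : nat) : g + o = a -> 2 * (c + d) <= g + 2 * o ->
  2 * x <= a -> s <= d + x -> 2 * (c + s) <= 3 * g + 6 * o.
Proof. lia. Qed.

Let omit_arith (a g o c d f m x y s t : nat) : g + o = a -> 2 * (c + (d + m)) <= g + 2 * o ->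
  2 * x + f <= a -> 2 * y + f <= a -> s <= m + x -> t <= f + d + y ->
  2 * (c + (s + t)) <= 3 * g + 6 * o.
Proof. lia. Qed.

Let barbell_arith (a g o c d f w b : nat) : g + o = a -> 2 * (c + d) <= g + 2 * o ->
  w + f = a -> b <= d + f + w -> 2 * (b + c) <= 3 * g + 6 * o.
Proof. lia. Qed.

Let meet_arith (g o c d s t : nat) : 2 * (c + d) <= g + 2 * o ->
  2 * s <= g + 2 * o + d -> 2 * t <= g + 2 * o + d -> 2 * (s + t) <= 3 * g + 6 * o.
Proof. lia. Qed.

Let half_arith (g c d x s m : nat) : 2 * (c + d) <= g -> 2 * x <= m -> s <= d + x ->
  2 * (c + s) <= g + m.
Proof. lia. Qed.

(** A walk towards F is stopped where it first meets F. A connection without edges of F leaves |F|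
    in the budget for the cycle itself. *)
Lemma reach_cycle A X F x : links_all A X -> x \in X -> ends F \subset X -> F != set0 ->
  exists2 y, y \in ends F & connect (adjE (A :\: F)) x y.
Proof.
move=> lA xX sF /set0Pn[e0 e0F]; pose U := component (A :\: F) x.
have [y0U|y0U] := boolP (endpt (e0, false) \in U).
  by exists (endpt (e0, false)); [apply: mem_ends | move: y0U; rewrite inE].
have [e eA eU] := connect_cut (lA x _ xX (subsetP sF _ (mem_ends false e0F)))
  (component_refl _ x) y0U.
have eF : e \in F.
  apply: contraT => eF; have := in_set0 e.
  by rewrite -(component_cut (A :\: F) x) in_setI in_setD eF eA eU.
have [h [he hU _]] := cut_half eU; exists (endpt h); last by move: hU; rewrite inE.
by apply: mem_ends_half; rewrite he.
Qed.

Lemma even_set_covered X H cs Ds : block X -> even_set H -> N :&: inner X \subset H ->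
  cover_of cs Ds H -> forall cs', (forall D e, D \in Ds -> e \in D ->
    exists2 B, B \in cs' & e \in edges B) ->
  forall e, e \in inner X -> e \notin Ghat -> exists2 B, B \in cs ++ cs' & e \in edges B.
Proof.
move=> bX eH sH cov cs' cov' e eA eG.
have sH' : (N :&: inner X) :\: set0 \subset H by rewrite setD0.
have := block_cover bX (even_set0 G) eH sH' eA eG; rewrite in_set0 /= => e_H.
have [[B Bin eB]|[D Din eD]] := cov e e_H; first by exists B; rewrite // mem_cat Bin.
by have [B Bin eB] := cov' D e Din eD; exists B; rewrite // mem_cat Bin orbT.
Qed.

(** The difficulty is an odd number of negative cycles. With three or more, a shortest one is used
    twice. A single one is paired with a disjoint negative cycle; if there is none, all negative
    cycles meet it, and it carries the joins of two other even sets. *)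
Lemma block_covered X : block X -> X != set0 -> #|N :&: inner X| != 1 ->
  covered (inner X) (wt (inner X)).
Proof.
move=> bX /set0Pn[x0 x0X] k1; have [lX _ _] := bX; set A := inner X in k1 lX *.
have brA := block_bridgeless bX.
have aE : #|A :&: Ghat| + #|A :\: Ghat| = #|A| by rewrite cardsID.
have [|H [cs [Ds [csP DsP pDs szH [evH HN covH par]]]]] :=
  block_decompose (M := N :&: A) bX; first exact: subxx.
have sNH : N :&: A \subset H by rewrite -HN subsetIl.
pose pt D := odflt x0 [pick v in ends D].
have ptP D : negcyc D -> pt D \in ends D.
  move=> /andP[cD _]; have [v vD] := cyc_ends cD.
  by rewrite /pt; case: pickP => //= no; have := no v; rewrite vD.
have ptX D : D \in Ds -> pt D \in X.
  by move=> /DsP[nD _ eD]; apply: (subsetP eD); apply: ptP.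
have [ev|od] := boolP (~~ odd (size Ds)).
  have [||J [_ oJ szJ]] := @half_join X (map pt Ds) bX.
  - by move=> _ /mapP[D Din ->]; apply: ptX.
  - by rewrite size_map.
  have [|D|cs' [csP' szcs' cov']] := link_cycles _ _ pDs oJ.
  + by move=> D /DsP[].
  + by move=> /DsP[nD _ _]; apply: ptP.
  exists (cs ++ cs'); split.
  - by move=> B; rewrite mem_cat => /orP[/csP|/csP'].
  - by rewrite big_cat; apply: even_arith aE szH szJ szcs'.
  exact: even_set_covered bX evH sNH covH _ cov'.
rewrite negbK in od.
have [sz1|sz1] := leqP (size Ds) 1; last first.
  have [Dm Dmin leDm] : exists2 Dm, Dm \in Ds & forall D, D \in Ds -> #|Dm| <= #|D|.
    have [D0 D0in] : exists D0, D0 \in Ds.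
      by case: (Ds) od => // D Ds' _; exists D; rewrite mem_head.
    by case: (arg_minnP (fun D : {set E} => #|D|) D0in) => D Din le; exists D.
  have [K [R permD]] : exists (K : {set E}) (R : seq {set E}), perm_eq Ds [:: Dm, K & R].
    have permD := perm_to_rem Dmin; move: sz1; rewrite (perm_size permD) /=.
    by case: (rem Dm Ds) permD => // K R permD _; exists K, R.
  have memD D : (D \in Ds) = (D \in [:: Dm, K & R]) := perm_mem permD D.
  have : pairwise (@vdisj G) [:: Dm, K & R].
    by apply: perm_pairwise permD pDs => D D'; rewrite /vdisj disjoint_sym.
  move=> /=/andP[/andP[dDK dmR] /andP[_ pR]].
  have Kin : K \in Ds by rewrite memD !inE eqxx orbT.
  have subR D : D \in Dm :: R -> D \in Ds.
    by rewrite memD !inE => /orP[->|->]; rewrite ?orbT.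
  have okD D : D \in Ds -> [/\ cyc D, D \subset A, ends D \subset X & #|Dm| <= #|D|].
    by move=> Din; have [/andP[cD _] sD eD] := DsP D Din; split=> //; apply: leDm.
  have leA : #|Dm| <= #|A| by apply: subset_leq_card; have [] := okD Dm Dmin.
  have pDmR : pairwise (@vdisj G) (Dm :: R) by rewrite /= dmR.
  (* [Dm] is used twice, with R and with K; each of the two joins saves half of |Dm|. *)
  have [|//||p1 [J1 [p1P _ oJ1 szJ1]]] := @cycle_join G A X (Dm :: R) [::] #|Dm| x0 brA lX x0X
      _ pDmR _ isT _ leA.
  - by move=> D /subR/okD.
  - by move: od; rewrite (perm_size permD) /= addn0 !negbK.
  have [||p2 [J2 [p2P _ oJ2 szJ2]]] := @cycle_join G A X [:: Dm] [:: pt K] #|Dm| x0 brA lX x0X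
      _ isT _ isT isT leA.
  - by move=> D; rewrite inE => /eqP->; apply: okD.
  - by move=> u; rewrite inE => /eqP->; apply: ptX.
  have [|D|||cs1 [csP1 szcs1 cov1]] := @link_cycles p1 (Dm :: R) J1.
  - by move=> D /subR/DsP[].
  - exact: p1P.
  - exact: pDmR.
  - by rewrite oJ1 cats0.
  have nDmK : Dm != K.
    apply: contraTneq dDK => ->; have [/andP[cK _] _ _] := DsP K Kin.
    have [v vK] := cyc_ends cK; apply/negP=> d.
    by have := disjointFr d vK; rewrite vK.
  have [|D|||cs2 [csP2 szcs2 cov2]] :=
      @link_cycles (fun D => if D == Dm then p2 Dm else pt D) [:: Dm; K] J2.
  - by move=> D; rewrite !inE => /orP[] /eqP->; [case: (DsP Dm Dmin) | case: (DsP K Kin)].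
  - rewrite !inE => /orP[] /eqP->; rewrite ?eqxx; first by apply: p2P; rewrite mem_head.
    rewrite eq_sym (negPf nDmK); apply: ptP.
    by have [] := DsP K Kin.
  - by rewrite /= dDK.
  - by rewrite oJ2 /= eqxx eq_sym (negPf nDmK).
  exists (cs ++ (cs1 ++ cs2)); split.
  - by move=> B; rewrite !mem_cat => /or3P[/csP|/csP1|/csP2].
  - rewrite !big_cat /=; rewrite (perm_big _ permD) !big_cons /= in szH.
    rewrite big_cons in szcs1; rewrite !big_cons big_nil addn0 in szcs2.
    by apply: (omit_arith aE _ szJ1 szJ2 szcs1 szcs2); move: szH; rewrite [#|Dm| + _]addnCA.
  apply: even_set_covered bX evH sNH covH _ _ => D e.
  rewrite memD !inE => /or3P[/eqP->|/eqP->|DR] eD.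
  - have [B Bin eB] := cov1 Dm e (mem_head _ _) eD; exists B; rewrite // mem_cat Bin //.
  - have [|B Bin eB] := cov2 K e _ eD; rewrite ?inE ?eqxx ?orbT //.
    by exists B; rewrite // mem_cat Bin orbT.
  have [|B Bin eB] := cov1 D e _ eD; first by rewrite inE DR orbT.
  by exists B; rewrite // mem_cat Bin.
have [D1 DsE] : exists D1, Ds = [:: D1].
  by case: (Ds) od sz1 => [//|D1 [|//]] _ _; exists D1.
rewrite {}DsE {od sz1 pDs ptX} in DsP covH par szH.
have [nD1 sD1 eD1] := DsP D1 (mem_head _ _); have /andP[cD1 oD1] := nD1.
rewrite big_seq1 in szH.
have [/existsP[F /and3P[nF sF dF]]|noF] :=
    boolP [exists F : {set E}, [&& negcyc F, F \subset A & vdisj D1 F]].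
  have eF : ends F \subset X by rewrite ends_inner.
  have /andP[cF _] := nF.
  have [y yF cy] : exists2 y, y \in ends F & connect (adjE (A :\: F)) (pt D1) y.
    apply: reach_cycle lX _ eF _; first by apply: (subsetP eD1); apply: ptP.
    by case/cycP: cF.
  have [B [sB cB szB _]] := barbell_join nD1 nF dF (ptP D1 nD1) yF cy.
  exists (B :: cs); split.
  - by move=> C; rewrite inE => /predU1P[->|/csP].
  - rewrite big_cons; apply: (barbell_arith aE szH _ szB).
    by rewrite addnC -(cardsID F A) (setIidPr sF).
  move=> e eA eG.
  have [|B' B'in eB'] := even_set_covered bX evH sNH covH (cs' := [:: B]) _ eA eG.
    move=> D e'; rewrite inE => /eqP-> e'D; exists B; rewrite ?mem_head //.
    by apply: (subsetP cB); rewrite in_setU e'D.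
  by exists B'; rewrite // inE; move: B'in; rewrite mem_cat mem_seq1 orbC.
have meet D : negcyc D -> D \subset A -> exists v, v \in ends D :&: ends D1.
  move=> nD sD; apply/set0Pn; apply: contraNneq noF => D0.
  by apply/existsP; exists D; rewrite nD sD /vdisj -setI_eq0 setIC D0 eqxx.
pose pt1 D := odflt x0 [pick v in ends D :&: ends D1].
have pt1P D : negcyc D -> D \subset A -> pt1 D \in ends D :&: ends D1.
  move=> nD sD; have [v vD] := meet D nD sD.
  by rewrite /pt1; case: pickP => //= no; have := no v; rewrite vD.
(* Since all negative cycles meet D1, their terminals are taken on D1 and joined by at most half of
   it. *)
have half M : M \subset N :&: A -> ~~ odd #|M| -> exists H' cs',
    [/\ forall B, B \in cs' -> signed_circuit B, even_set H', H' :&: N = M,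
        2 * \sum_(B <- cs') #|edges B| <= #|A :&: Ghat| + 2 * #|A :\: Ghat| + #|D1| &
        forall e, e \in H' -> exists2 B, B \in cs' & e \in edges B].
  move=> sM evM; have [H' [cs1 [Ds' [cs1P DsP' pDs' szH' [evH' HN' covH' par']]]]] :=
    block_decompose bX sM.
  have okD D : D \in Ds' -> negcyc D /\ pt1 D \in ends D :&: ends D1.
    by move=> /DsP'[nD sD _]; split; last exact: pt1P.
  have [||J [_ oJ szJ]] := @join_half G D1 (parity_set (map pt1 Ds')).
  - exact: cyc_bridgeless.
  - apply: linked_even (cyc_connect cD1) _ _; last by rewrite odd_parity_set size_map par'.
    apply/subsetP=> v /mem_parity_set/mapP[D Din ->].
    by have [_] := okD D Din; rewrite in_setI => /andP[].
  have [|D|cs2 [cs2P szcs2 cov2]] := link_cycles _ _ pDs' oJ.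
  - by move=> D /okD[].
  - by move=> /okD[_]; rewrite in_setI => /andP[].
  exists H', (cs1 ++ cs2); split=> //.
  - by move=> B; rewrite mem_cat => /orP[/cs1P|/cs2P].
  - by rewrite big_cat; apply: half_arith szH' szJ szcs2.
  move=> e /covH'[[B Bin eB]|[D Din eD]]; first by exists B; rewrite // mem_cat Bin.
  by have [B Bin eB] := cov2 D e Din eD; exists B; rewrite // mem_cat Bin orbT.
have oddNA : odd #|N :&: A| by rewrite -par.
(* The number of N-edges is odd and not 1. The pair e, e' and the N-edges other than e are both even
   in number and together exhaust N in A. *)
have [e [e' [eNA eNA' nee]]] : exists e e', [/\ e \in N :&: A, e' \in N :&: A & e != e'].
  have [e eNA] : exists e, e \in N :&: A.
    by apply/set0Pn; rewrite -card_gt0 lt0n; apply: contraTneq oddNA => ->.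
  have [e'] : exists e', e' \in (N :&: A) :\ e.
    apply/set0Pn; rewrite -card_gt0 lt0n; apply: contra_neq k1 => E0.
    by rewrite (cardsD1 e) eNA E0.
  by rewrite in_setD1 => /andP[nee eNA']; exists e, e'; rewrite eq_sym.
have [||H1 [cs1 [cs1P evH1 HN1 sz1 cov1]]] := half [set e; e'].
- by rewrite subUset !sub1set eNA.
- by rewrite cards2 nee.
have [||H2 [cs2 [cs2P evH2 HN2 sz2 cov2]]] := half ((N :&: A) :\ e).
- exact: subsetDl.
- by move: oddNA; rewrite (cardsD1 e) eNA.
exists (cs1 ++ cs2); split.
- by move=> B; rewrite mem_cat => /orP[/cs1P|/cs2P].
- by rewrite big_cat; apply: meet_arith szH sz1 sz2.
move=> g gA gG; have sH2 : (N :&: A) :\: H1 \subset H2.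
  apply/subsetP=> n /setDP[nNA nH1].
  suff : n \in H2 :&: N by rewrite in_setI => /andP[].
  rewrite HN2 in_setD1 nNA andbT; apply: contraNneq nH1 => ->.
  suff : e \in H1 :&: N by rewrite in_setI => /andP[].
  by rewrite HN1 !inE eqxx.
have /orP[/cov1|/cov2] := block_cover bX evH1 evH2 sH2 gA gG.
  by case=> B Bin gB; exists B; rewrite // mem_cat Bin.
by case=> B Bin gB; exists B; rewrite // mem_cat Bin orbT.
Qed.

Lemma side_rooted (S : {set V}) h : cut S = [set h.1] -> endpt h \in S -> links_all (inner S) S ->
  rooted S (inner S) (wt (inner S)) (endpt h).
Proof.
move=> cS hS lS.
have r0 : region S (endpt h) [::].
  split=> //; split=> [U sU hU|_]; last exact: N_side cS.
  have -> : U :|: territory [seq q <- ([::] : seq port) | pp q \in U] = U.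
    by apply/setP=> v; rewrite !inE orbF.
  have iT : inner setT = setT :> {set E} by apply/setP=> e; rewrite !inE.
  have := @side_cut setT S U h (subsetT _) _ hS sU hU; rewrite iT !setTI; exact.
apply: rooted_mono (region_rooted r0).
- by apply/subsetP=> v; rewrite !inE orbF.
- exact: subsetUl.
by rewrite big_nil addn0.
Qed.

Lemma closed_cut T U : cut T = set0 -> U \subset T -> cut U = inner T :&: cut U.
Proof.
move=> T0 sU; apply/setP=> e; rewrite in_setI.
have [eU|] := boolP (e \in cut U); last by rewrite andbF.
have [h [<- hU _]] := cut_half eU; rewrite inner_half (subsetP sU _ hU) /= andbT.
have := in_set0 h.1; rewrite -T0 inE crosses_half (subsetP sU _ hU).
by case: (_ \in T).
Qed.

Let two_sides_arith (a b c e i j w x : nat) : 2 * (a + i) <= w -> 2 * (b + j) <= x ->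
  c <= i + j + 1 -> x + w + 6 <= e -> 2 * (c + (a + b)) <= e.
Proof. lia. Qed.

(** At a bridge each side yields one item at its end. The barbell made of both contains this bridge
    and all bridges that the two sides have left to their items. *)
Lemma component_covered T : cut T = set0 -> T != set0 -> links_all (inner T) T ->
  covered (inner T) (wt (inner T)).
Proof.
move=> T0 Tn0 lT.
have [nocut|] := boolP [forall U : {set V}, forall e, inner T :&: cut U != [set e]].
  apply: block_covered => //.
    split=> // [U e|U sU]; first by move/forallP: nocut => /(_ U)/forallP/(_ e).
    by exists U; apply: closed_cut.
  apply: contraT; rewrite negbK => /cards1P[e Ne].
  by have := N_support T e; rewrite T0 set0U Ne eqxx.
rewrite negb_forall => /existsP[U]; rewrite negb_forall => /existsP[e].
rewrite negbK => /eqP cU; pose S := T :&: U; pose S' := T :\: S.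
have sS : S \subset T by apply: subsetIl.
have sS' : S' \subset T by apply: subsetDl.
have iS : inner T :&: cut S = [set e] by rewrite inner_cutI.
have iS' : inner T :&: cut S' = [set e] by rewrite inner_cutD.
have cS : cut S = [set e] by rewrite (closed_cut T0 sS).
have cS' : cut S' = [set e] by rewrite (closed_cut T0 sS').
have [h [he hS oS]] : exists h, [/\ h.1 = e, endpt h \in S & endpt (opp_half h) \notin S].
  by apply: cut_half; rewrite cS set11.
have oS' : endpt (opp_half h) \in S'.
  have : e \in inner T :&: cut S by rewrite iS set11.
  by rewrite -he in_setI inner_half in_setD oS => /andP[/andP[]].
rewrite -he in cS cS' iS iS'.
have r1 := side_rooted cS hS (side_links lT sS iS hS).
have r2 := side_rooted (h := opp_half h) cS' oS' (side_links (h := opp_half h) lT sS' iS' oS').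
have [cs1 [ls1 [cs1P ls1P lr1 sz1 cov1]]] := r1 1 isT.
have [cs2 [ls2 [cs2P ls2P lr2 sz2 cov2]]] := r2 1 isT.
have one (ls : seq (item G)) v : map (@ipos G) ls = nseq 1 v -> exists l, ls = [:: l] /\ ipos l = v.
  by case: ls => [//|l [|//]] [lv]; exists l.
have [l1 [E1 p1]] := one ls1 _ lr1; have [l2 [E2 p2]] := one ls2 _ lr2.
rewrite E1 in ls1P sz1 cov1; rewrite E2 in ls2P sz2 cov2.
have [ok1 s1] := ls1P l1 (mem_head _ _); have [ok2 s2] := ls2P l2 (mem_head _ _).
have dSS' : [disjoint S & S'] by apply/pred0P=> v /=; rewrite in_setD; case: (v \in S).
have [||B [sB cB szB brB]] := @barbell_items G l1 l2 [set h.1] ok1 ok2.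
- by apply: disjointWl s1 _; apply: disjointWr s2 _.
- by rewrite p1 p2; apply/connect1/adjE_edge; rewrite set11.
exists (B :: cs1 ++ cs2); split.
- by move=> C; rewrite inE mem_cat => /or3P[/eqP->|/cs1P|/cs2P].
- rewrite big_seq1 in sz1; rewrite big_seq1 in sz2; rewrite cards1 in szB.
  rewrite big_cons big_cat; apply: two_sides_arith sz1 sz2 szB _.
  rewrite -(wt_bridge cS).
  have d1 : [disjoint inner S' & inner S].
    apply/pred0P=> g /=; rewrite !inE; apply/negbTE/negP=> /andP[/andP[a _] /andP[b _]].
    by rewrite b in a.
  rewrite -wt_setU // -wt_setU; last first.
    rewrite disjoint_sym disjoints1 in_setU !inner_half negb_or !negb_and oS orbT andbT.
    by rewrite in_setD hS.
  apply: wt_sub; rewrite !subUset sub1set -andbA; apply/and3P; split.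
  + by rewrite -ends_inner; apply: subset_trans sS'; rewrite ends_inner.
  + by rewrite -ends_inner; apply: subset_trans sS; rewrite ends_inner.
suff : h.1 \in inner T :&: cut S by rewrite in_setI => /andP[].
  by rewrite iS set11.
move=> g gT gG; have [gS|gS] := boolP (g \in cut S).
  exists B; first exact: mem_head.
  move: gS; rewrite cS in_set1 => /eqP->; apply: brB cS _.
  by rewrite s1 (disjointWl s2) // disjoint_sym.
have catl (C : subgr G) : C \in cs1 -> C \in B :: cs1 ++ cs2.
  by move=> Cin; rewrite inE mem_cat Cin orbT.
have catr (C : subgr G) : C \in cs2 -> C \in B :: cs1 ++ cs2.
  by move=> Cin; rewrite inE mem_cat Cin !orbT.
have [gS1|gS2] : g \in inner S \/ g \in inner S'.
  apply/orP; move: gS gT; rewrite !inE /crosses !inE.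
  by case: (endpt (g, false) \in T); case: (endpt (g, true) \in T) => //;
    case: (endpt (g, false) \in U); case: (endpt (g, true) \in U).
- have [[C Cin gC]|[l]] := cov1 g gS1 gG; first by exists C; first exact: catl.
  rewrite inE => /eqP-> gl; exists B; rewrite ?mem_head //.
  case: gl => [gl|[U' [cU' sU' _ eU']]]; first by apply: (subsetP cB); rewrite in_setU gl.
  apply: brB cU' _; rewrite eU' (disjointWl s2) //.
  by apply: disjointWr sU' _; rewrite disjoint_sym.
have [[C Cin gC]|[l]] := cov2 g gS2 gG; first by exists C; first exact: catr.
rewrite inE => /eqP-> gl; exists B; rewrite ?mem_head //.
case: gl => [gl|[U' [cU' sU' _ eU']]]; first by apply: (subsetP cB); rewrite in_setU gl orbT.
apply: brB cU' _; rewrite eU' (disjointWl s1) ?orbT //.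
exact: disjointWr sU' _.
Qed.

Lemma component_links x (T := component setT x) : links_all (inner T) T.
Proof.
have T0 : cut T = set0 by have := component_cut setT x; rewrite setTI.
move=> y z yT zT; apply: contraT => nc.
pose W := component (inner T) y.
have sW : W \subset T.
  apply/subsetP=> w; rewrite inE => c; apply: contraT => wT.
  by have [e _] := connect_cut c yT wT; rewrite T0 in_set0.
have cyz : connect (adjE setT) y z.
  move: yT zT; rewrite !inE => cy; apply: connect_trans; by rewrite connE_sym.
have zW : z \notin W by rewrite inE.
have [e _ eW] := connect_cut cyz (component_refl _ y) zW.
by move: eW; rewrite (closed_cut T0 sW) component_cut in_set0.
Qed.

Lemma closed_covered Z : cut Z = set0 -> covered (inner Z) (wt (inner Z)).
Proof.
have [n] := ubnP #|Z|; elim: n Z => // n IH Z leZ Z0.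
have [Ze|[x xZ]] := set_0Vmem Z.
  by exists [::]; split; rewrite ?big_nil // => e; rewrite inE Ze in_set0.
pose T := component setT x.
have T0 : cut T = set0 by have := component_cut setT x; rewrite setTI.
have xT : x \in T by apply: component_refl.
have sT : T \subset Z.
  apply/subsetP=> w; rewrite inE => c; apply: contraT => wT.
  by have [e _] := connect_cut c xZ wT; rewrite Z0 in_set0.
have D0 : cut (Z :\: T) = set0.
  by rewrite (closed_cut Z0 (subsetDl _ _)) inner_cutD T0 setI0.
have [|cs1 [cs1P sz1 cov1]] := component_covered T0 _ (@component_links x).
- by apply/set0Pn; exists x.
have [|cs2 [cs2P sz2 cov2]] := IH (Z :\: T) _ D0.
  apply: leq_trans (proper_card _) leZ; rewrite properE subsetDl /=.
  by apply/subsetPn; exists x; rewrite ?in_setD ?xT.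
exists (cs1 ++ cs2); split.
- by move=> B; rewrite mem_cat => /orP[/cs1P|/cs2P].
- rewrite big_cat mulnDr; apply: leq_trans (leq_add sz1 sz2) _.
  rewrite -wt_setU.
    apply: wt_sub; rewrite subUset -!ends_inner; apply/andP; split.
      by apply: subset_trans sT; rewrite ends_inner.
    by apply: subset_trans (subsetDl Z T); rewrite ends_inner.
  apply/pred0P=> g /=; rewrite !inE; apply/negbTE/negP=> /andP[/andP[a _] /andP[/andP[b _] _]].
  by move: b; rewrite a.
move=> e eZ eG; have [eT|eT] := boolP (e \in inner T).
  by have [B Bin eB] := cov1 e eT eG; exists B; rewrite // mem_cat Bin.
have [|B Bin eB] := cov2 e _ eG; last by exists B; rewrite // mem_cat Bin orbT.
have : e \notin cut T by rewrite T0 in_set0.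
move: eT eZ; rewrite !inE /crosses !inE.
by do 2 case: (connect _ _ _) => //=.
Qed.

End Secondary.

(** * Switching *)

Section Switching.

Variable G : sgraph.
Local Notation V := (vertex G).
Local Notation E := (edge G).
Implicit Types (C : {set E}) (U T : {set V}) (e : E) (h : half_edge G).

Definition switched U : {set E} := symd [set e | negative e] (cut U).

Lemma cut_symd U U' : cut (symd U U') = symd (cut U) (cut U').
Proof.
by apply/setP=> e; rewrite !inE /crosses !inE addbACA.
Qed.

Lemma switched_parity U C : even_set C -> odd #|C :&: switched U| = oddneg C.
Proof.
move=> eC; rewrite setIC symdI odd_symd [cut U :&: C]setIC (negPf (even_cut U eC)) addbF.
by rewrite /oddneg; congr odd; apply: eq_card => e; rewrite !inE andbC.
Qed.

(** Switching at U as well adds [cut U] mod 2 to the set of negative edges, which cannot make a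
    smallest one smaller. *)
Lemma switched_min U0 : (forall U, #|switched U0| <= #|switched U|) ->
  forall U, 2 * #|switched U0 :&: cut U| <= #|cut U|.
Proof.
move=> min U; have := min (symd U0 U); rewrite /switched cut_symd symdA -/(switched U0).
by have := card_symdI (switched U0) (cut U); clear; lia.
Qed.

(** In the sum of the conservation laws over T only e would contribute, namely f e or twice it up to
    sign, which is not 0. *)
Lemma switched_support U0 T e : flow_admissible G ->
  cut T :|: (switched U0 :&: inner T) != [set e].
Proof.
case=> tau [f [tauP fP fn0]]; apply/eqP=> supp.
(* Reversing all half-edges at U0 turns [tau] into an orientation with negative edges [switched U0];
   the laws at the vertices survive up to sign. *)
pose s h := tau h (+) (endpt h \in U0).
pose g h : int := if s h then f h.1 else (- f h.1)%R.
have sE e' : (s (e', false) == s (e', true)) = (e' \in switched U0).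
  rewrite in_symd inE -(tauP e') inE /crosses /s.
  by do 2 case: (tau _); do 2 case: (_ \in U0).
have g0 v : (\sum_(h : E * bool | endpt h == v) g h = 0)%R.
  have bal : (\sum_(h : E * bool | endpt h == v) (if tau h then f h.1 else - f h.1) = 0)%R.
    rewrite (bigID tau) /=.
    rewrite (eq_bigr (fun h => f h.1)); last by move=> h /andP[_ ->].
    rewrite [X in (_ + X)%R](eq_bigr (fun h => - f h.1)%R); last first.
      by move=> h /andP[_ /negPf->].
    by rewrite sumrN fP subrr.
  have [vU|vU] := boolP (v \in U0); last first.
    by rewrite -[RHS]bal; apply: eq_bigr => h /eqP hv; rewrite /g /s hv (negPf vU) addbF.
  apply: oppr_inj; rewrite oppr0 -[RHS]bal -sumrN; apply: eq_bigr => h /eqP hv.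
  by rewrite /g /s hv vU addbT; case: (tau h); rewrite //= opprK.
pose F e' : int := ((if endpt (e', false) \in T then g (e', false) else 0) +
  (if endpt (e', true) \in T then g (e', true) else 0))%R.
have sumF : (\sum_e' F e' = 0)%R.
  transitivity (\sum_(v in T) \sum_(h : E * bool | endpt h == v) g h)%R; last first.
    by apply: big1 => v _; apply: g0.
  rewrite (exchange_big_dep predT) //=.
  transitivity (\sum_(h : E * bool) (if endpt h \in T then g h else 0))%R.
    rewrite (eq_bigr (fun e' => \sum_(b : bool) (if endpt (e', b) \in T then g (e', b) else 0)))%R.
      by rewrite pair_bigA /=; apply: eq_bigr => -[].
    by move=> e' _; rewrite /F big_bool addrC.
  apply: eq_bigr => h _; rewrite big_mkcond /=.
  rewrite (eq_bigr (fun v => if v == endpt h then (if endpt h \in T then g h else 0) else 0))%R.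
    by rewrite -big_mkcond big_pred1_eq.
  by move=> v _; rewrite eq_sym; have [->|_] := eqVneq v (endpt h); rewrite ?andbT ?andbF.
have F0 e' : e' != e -> (F e' = 0)%R.
  move=> nee; have : e' \notin [set e] by rewrite in_set1.
  rewrite -supp in_setU in_setI -sE !inE /crosses /F.
  case: (_ \in T); case: (_ \in T); rewrite //= ?addr0 // andbT /g.
  by case: (s _); case: (s _); rewrite //= ?addrN ?addNr.
have : e \in [set e] by rewrite set11.
rewrite -supp in_setU in_setI -sE !inE /crosses.
have : (F e = 0)%R by rewrite -[RHS]sumF (bigD1 e) //= big1 ?addr0.
have := fn0 e; rewrite /F /g.
case: (_ \in T); case: (_ \in T); case: (s _); case: (s _) => //=; clear; lia.
Qed.

End Switching.

(** * Covering the edges of Ghat by positive cycles and short barbells obtained from even sets *)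

Section Primary.

Variables (G : sgraph) (N : {set edge G}).
Hypothesis N_parity : forall C : {set edge G}, even_set C -> odd #|C :&: N| = oddneg C.

Lemma Ghat_bridgeless : bridgeless (Ghat N).
Proof.
move=> e; rewrite inE => /existsP[C /and3P[eC sC eiC]]; exists C; last by rewrite eC.
by apply/subsetP=> e' e'C; rewrite inE; apply/existsP; exists C; rewrite eC sC.
Qed.

Lemma Ghat_disjoint : [disjoint Ghat N & N].
Proof.
apply/pred0P=> e /=; rewrite inE; apply/negbTE/negP=> /andP[/existsP[C /and3P[_ sC eiC]] eN].
by have := subsetP sC e eiC; rewrite inE eN.
Qed.

Lemma even_positive_cover (H : {set edge G}) : even_set H -> H \subset Ghat N ->
  exists cs : seq (subgr G), [/\ forall B, B \in cs -> signed_circuit B,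
    \sum_(B <- cs) #|edges B| = #|H| &
    forall e, e \in H -> exists2 B, B \in cs & e \in edges B].
Proof.
move=> eH sH; have [cs [Ds [csP DsP _ sz [cov _]]]] := decompose eH.
have Ds0 : Ds = [::].
  case: (Ds) DsP => // D Ds' /(_ D (mem_head _ _))[/andP[cD oD] sD].
  move: oD; rewrite -N_parity; last exact: cyc_even.
  by rewrite disjoint_setI0 ?cards0 // (disjointWl (subset_trans sD sH) Ghat_disjoint).
exists cs; split=> //; first by move: sz; rewrite Ds0 big_nil addn0.
by move=> e /cov[//|[D]]; rewrite Ds0.
Qed.

Lemma primary_cover : exists cs : seq (subgr G),
  [/\ forall B, B \in cs -> signed_circuit B,
    3 * \sum_(B <- cs) #|edges B| <= 5 * #|Ghat N| &
    forall e, e \in Ghat N -> exists2 B, B \in cs & e \in edges B].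
Proof.
have [E1 [E2 [E3 [e1 e2 e3 EU sz]]]] := even_cover Ghat_bridgeless.
have s1 : E1 \subset Ghat N by rewrite -EU -setUA subsetUl.
have s2 : E2 \subset Ghat N by rewrite -EU setUAC subsetUr.
have s3 : E3 \subset Ghat N by rewrite -EU subsetUr.
have [cs1 [cs1P sz1 cov1]] := even_positive_cover e1 s1.
have [cs2 [cs2P sz2 cov2]] := even_positive_cover e2 s2.
have [cs3 [cs3P sz3 cov3]] := even_positive_cover e3 s3.
exists (cs1 ++ cs2 ++ cs3); split.
- by move=> B; rewrite !mem_cat => /or3P[/cs1P|/cs2P|/cs3P].
- by rewrite !big_cat /= sz1 sz2 sz3 addnA.
move=> e; rewrite -EU !in_setU => /orP[/orP[/cov1|/cov2]|/cov3] [B Bin eB];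
  by exists B; rewrite // !mem_cat Bin ?orbT.
Qed.

End Primary.

Lemma total_arith (a b g o m : nat) : 0 < o -> 3 * a <= 5 * g -> 2 * b <= 3 * g + 6 * o ->
  g + o = m -> 6 * (a + b) < 19 * m.
Proof. lia. Qed.

Theorem theorem1p6 (G : sgraph) (hE : (0 < #|edge G|)%N)
    (hG : flow_admissible G) :
  exists cs : seq (subgr G),
    signed_circuit_cover cs /\
    ((cover_length cs)%:R < 19%:R / 6%:R * #|edge G|%:R :> rat)%R.
Proof.
pose U0 := [arg min_(U < set0 : {set vertex G}) #|switched U|].
have U0min (U : {set vertex G}) : #|switched U0| <= #|switched U|.
  by rewrite /U0; case: arg_minnP => // U' _ min; apply: min.
pose N := switched U0.
have par (C : {set edge G}) : even_set C -> odd #|C :&: N| = oddneg C by apply: switched_parity.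
have [cs1 [cs1P sz1 cov1]] := primary_cover par.
have cT : cut (setT : {set vertex G}) = set0 by apply/setP=> e; rewrite !inE /crosses !inE.
have [cs2 [cs2P sz2 cov2]] := closed_covered par (switched_min U0min)
  (fun T e => switched_support U0 T e hG) cT.
have iT : inner setT = setT :> {set edge G} by apply/setP=> e; rewrite !inE.
have szG := cardsC (Ghat N).
suff [cs [csP szcs cov]] : exists cs : seq (subgr G),
    [/\ forall B, B \in cs -> signed_circuit B, 6 * \sum_(B <- cs) #|edges B| < 19 * #|edge G| &
      forall e, exists2 B, B \in cs & e \in edges B].
  exists cs; split=> //; rewrite mulrAC ltr_pdivlMr ?ltr0n // -!natrM ltr_nat.
  by rewrite mulnC.
(* If [Ghat N] is everything, the first cover suffices, and [hE] makes 5/3 of the edges strictly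
   less than 19/6 of them. *)
have [o0|o0] := eqVneq (~: Ghat N) set0.
  exists cs1; split=> //.
    by move: sz1 szG hE; rewrite o0 cards0 /N; clear; lia.
  move=> e; apply: cov1; have : e \notin ~: Ghat N by rewrite o0 in_set0.
  by rewrite in_setC negbK.
exists (cs1 ++ cs2); split.
- by move=> B; rewrite mem_cat => /orP[/cs1P|/cs2P].
- rewrite big_cat /=; move: sz1 sz2 szG; rewrite iT /wt setTI setTD.
  by rewrite -card_gt0 in o0; apply: total_arith.
move=> e; have [eG|eG] := boolP (e \in Ghat N).
  by have [B Bin eB] := cov1 e eG; exists B; rewrite // mem_cat Bin.
have [|B Bin eB] := cov2 e _ eG; first by rewrite iT in_setT.
by exists B; rewrite // mem_cat Bin orbT.
Qed.
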